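(* Let $M$ and $\widehat M$ be tiled manifolds, each composed of $V$ copies of the same building block $B$ with reflecting faces indexed by $1,\dots,C$, together with Zaremba problems that are described by adjacency matrices $(A^{c})_{c=1}^{C}$ and $(\widehat A^{c})_{c=1}^{C}$, respectively. Let $T$ be an invertible real $V\times V$ matrix. Then the transplantation $T\colon L^2(M)\to L^2(\widehat M)$ with transplantation matrix $T$ is intertwining if and only if $$\widehat A^{c}=T A^{c}T^{-1}\qquad\text{for all } c=1,\dots,C.$$ In particular, $M$ and $\widehat M$ are transplantable precisely if there exists an invertible real matrix $T$ satisfying this condition.
   Context: $\Delta$ is the Laplacian with the sign convention that makes it nonnegative ($\Delta=-\operatorname{div}\nabla$). Building block: a compact Riemannian manifold $B$ of dimension $d$ with piecewise smooth boundary $\partial B$, which contains disjoint open smooth subsets $\partial_R^1B,\dots,\partial_R^CB$ (reflecting faces), each having a neighborhood in $B$ isometric to an open subset of closed Euclidean upper half space. Gluing: two copies $B_1,B_2$ of $B$ are glued along $\partial_R^cB_1$ and $\partial_R^cB_2$ by identifying the closures of these faces (via the identity of $B$). The result is required to be Riemannian near the face: if $\psi_1,\psi_2$ are corresponding local isometries of $B_1,B_2$ with Euclidean domain $(-l,l)^{d-1}\times(-l,0]$ (where $x_d=0$ corresponds to the face), then the map equal to $\psi_1(x_1,\dots,x_d)$ for $x_d\le 0$ and $\psi_2(x_1,\dots,x_{d-1},-x_d)$ for $x_d>0$ is a local isometry with domain $(-l,l)^d$. Tiled manifold: a compact Riemannian manifold $M=(B_1\cup\dots\cup B_V)/\!\sim$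 with piecewise smooth boundary such that: $B_1,\dots,B_V$ are copies of a building block $B$ with reflecting faces $(\partial_R^cB)_{c=1}^C$ and disjoint open smooth subsets $\partial_DB,\partial_NB$ of $\partial B\setminus\bigcup_c\overline{\partial_R^cB}$ with $\partial B=\overline{(\bigcup_c\partial_R^cB)\cup\partial_DB\cup\partial_NB}$; the copies are glued along disjoint pairs of reflecting faces $((\partial_R^{c_k}B_{i_k},\partial_R^{c_k}B_{j_k}))_k$; $M^\circ=(B_1^\circ\cup\dots\cup B_V^\circ\cup\bigcup_k\partial_R^{c_k}B_{i_k})/\!\sim$; glued faces are called inner faces, the unglued reflecting faces are called outer faces and belong to $\partial M$. On each outer face one imposes either Dirichlet or Neumann conditions; $\partial_DM$ (resp. $\partial_NM$) is the union of all $\partial_DB_i$ (resp. $\partial_NB_i$) and of the outer faces carrying Dirichlet (resp. Neumann) conditions. The Zaremba problem is $\Delta\varphi=\lambda\varphi$ on $M^\circ$, $\varphi=0$ on $\partial_DM$, $\partial\varphi/\partial n=0$ on $\partial_NM$, with solutions $\varphi\in C(M)\cap C^\infty(M^\circ\cup\partial_DM\cup\partial_NM)$. It is part of the definition of a tiled manifold that for every such choice of boundary conditions Assumption A holds: the eigenvalues $\lambda$ for which nonzero solutions exist form an unbounded sequence $0\le\lambda_0\le\lambda_1\le\dots$, each eigenspace is finite dimensional, and $L^2(M)$ is the orthogonal direct sum of all eigenspaces. Adjacency matrices describing a Zaremba problem on $M$: for each $c\in\{1,\dots,C\}$, the $V\times V$ matrix $A^c$ with, for $i\ne j$, $A^c_{ij}=1$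 if $B_i$ and $B_j$ are glued along their $c$-th reflecting faces and $0$ otherwise; and $A^c_{ii}=-1$ if $\partial_R^cB_i$ is an outer face with Dirichlet conditions, $A^c_{ii}=1$ if it is an outer face with Neumann conditions, and $A^c_{ii}=0$ otherwise. Transplantation: an invertible real $V\times V$ matrix $T$ defines a linear isomorphism $T\colon L^2(M)\to L^2(\widehat M)$, $\widehat\varphi=T(\varphi)$, by $\widehat\varphi_i=\sum_{j=1}^VT_{ij}\varphi_j$ almost everywhere, where $(\varphi_j)_j$, $(\widehat\varphi_i)_i$ are the restrictions of $\varphi,\widehat\varphi$ to the building blocks of $M$ and $\widehat M$ (all identified with $B$). $T$ is intertwining if $T$ and $T^{-1}$ convert solutions of the Zaremba problem on one manifold into solutions of the Zaremba problem on the other; $M$ and $\widehat M$ (with given boundary conditions) are transplantable if an intertwining transplantation exists. *)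

(* Defs.v *)
From HB Require Import structures.
From mathcomp Require Import all_boot all_order all_algebra.
From mathcomp Require Import all_classical all_reals all_analysis.

Set Implicit Arguments.
Unset Strict Implicit.
Unset Printing Implicit Defensive.
Import Order.TTheory GRing.Theory Num.Theory.
Import numFieldNormedType.Exports.

Local Open Scope classical_set_scope.
Local Open Scope ring_scope.

Section Euclidean.
Context {R : realType}.

Definition partial (W : normedModType R) n (i : 'I_n.+1)
    (f : 'rV[R]_n.+1 -> W) : 'rV[R]_n.+1 -> W :=
  fun x => 'D_(delta_mx 0 i) f x.

(* C^oo in a neighbourhood of x: every iterated partial derivative is
   differentiable there. *)
Definition smooth_near (W : normedModType R) n (f : 'rV[R]_n.+1 -> W)
    (x : 'rV[R]_n.+1) : Prop :=
  \forall y \near x, forall s : seq 'I_n.+1,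
    differentiable (foldr (@partial W n) f s) y.

(* F is a C^oo extension of f|U to a full neighbourhood of x.  When U is open,
   or relatively open in a closed half space, the derivatives of F at a point
   of U depend on f|U only. *)
Definition smooth_extension (W : normedModType R) n (U : set 'rV[R]_n.+1)
    (f : 'rV[R]_n.+1 -> W) (x : 'rV[R]_n.+1) (F : 'rV[R]_n.+1 -> W) : Prop :=
  smooth_near F x /\ \forall y \near x, U y -> F y = f y.

Definition smooth_at (W : normedModType R) n (U : set 'rV[R]_n.+1)
    (f : 'rV[R]_n.+1 -> W) (x : 'rV[R]_n.+1) : Prop :=
  exists F, smooth_extension U f x F.

Definition lastc n (x : 'rV[R]_n.+1) : R := x 0 ord_max.

Definition half_space n : set 'rV[R]_n.+1 := [set x | lastc x <= 0].

Definition cube n (l : R) : set 'rV[R]_n.+1 :=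
  [set x | forall i, - l < x 0 i < l].

Definition half_cube n (l : R) : set 'rV[R]_n.+1 :=
  cube l `&` @half_space n.

Definition reflect_last n (x : 'rV[R]_n.+1) : 'rV[R]_n.+1 :=
  \row_i (if i == ord_max then - x 0 i else x 0 i).

(* By Tonelli, this is the Lebesgue integral over R^n of f whenever f is a
   nonnegative Borel function; it is only used for such f. *)
Fixpoint iterated_integral n : ('rV[R]_n -> \bar R) -> \bar R :=
  match n with
  | 0 => fun f => f 0
  | m.+1 => fun f =>
      (\int[@lebesgue_measure R]_t
         @iterated_integral m
           (fun x => f (row_mx (t%:M : 'rV[R]_1) x : 'rV[R]_(1 + m))))%E
  end.

End Euclidean.

Definition borel (X : ptopologicalType) := g_sigma_algebraType (@open X).

Section Manifolds.
Context {R : realType}.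

(* A local parametrization of X defined on a subset of R^(n+1), together with
   the matrix of the Riemannian metric in these coordinates.  Only the values
   on [cdom] are meaningful. *)
Record chart n (X : Type) := Chart {
  cdom : set 'rV[R]_n.+1 ;
  cmap : 'rV[R]_n.+1 -> X ;
  cmet : 'rV[R]_n.+1 -> 'M[R]_n.+1 }.

Definition cimage n X (p : chart n X) : set X := cmap p @` cdom p.

Definition interior_domain n (X : Type) (I : set X) (p : chart n X) : Prop :=
  open (cdom p) /\ cimage p `<=` I.

Definition boundary_domain n (X : Type) (I : set X) (p : chart n X) : Prop :=
  (exists2 W, open W & cdom p = W `&` @half_space R n) /\
  forall x, cdom p x -> (I (cmap p x) <-> lastc x < 0).

Definition is_chart n (X : topologicalType) (I : set X) (p : chart n X) :=
  [/\ interior_domain I p \/ boundary_domain I p,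
      set_inj (cdom p) (cmap p),
      {within cdom p, continuous (cmap p)},
      forall W, open W -> open (cmap p @` (cdom p `&` W)) &
      forall x, cdom p x ->
        [/\ smooth_at (cdom p) (cmet p) x,
            (cmet p x)^T = cmet p x &
            forall v : 'rV[R]_n.+1, v != 0 ->
              0 < (v *m cmet p x *m v^T) 0 0]].

(* The change of coordinates from p to q is smooth and isometric.  The library
   Jacobian acts on row vectors on the right, v |-> v *m 'J tau x. *)
Definition isometric_change n (X : Type) (p q : chart n X) : Prop :=
  forall x y, cdom p x -> cdom q y -> cmap p x = cmap q y ->
  exists tau : 'rV[R]_n.+1 -> 'rV[R]_n.+1,
    [/\ smooth_near tau x,
        tau x = y,
        \forall z \near x, cdom p z ->
          cdom q (tau z) /\ cmap q (tau z) = cmap p z &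
        cmet p x = ('J tau x) *m cmet q y *m ('J tau x)^T].

(* Compact Riemannian manifold of dimension n+1 with piecewise smooth boundary.
   [inter] is the (manifold) interior, its complement is the boundary.  The
   points covered by the maximal atlas form a Riemannian manifold with smooth
   boundary containing [inter]; its boundary, the smooth part of the boundary
   of X, is dense in the boundary of X.  Nothing is required at the singular
   boundary points (corners, cone points of any angle) except that they do not
   make the volume infinite.  [vol] is the Riemannian volume, which is uniquely
   determined by the last two fields. *)
Record riemannian n (X : ptopologicalType) := Riemannian {
  inter : set X ;
  atlas : set (chart n X) ;
  vol : {finite_measure set (borel X) -> \bar R} ;
  X_compact : compact [set: X] ;
  X_hausdorff : hausdorff_space X ;
  X_second_countable : @second_countable X ;
  inter_open : open inter ;
  inter_dense : closure inter = [set: X] ;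
  atlas_chart : forall p, atlas p -> is_chart inter p ;
  atlas_compat : forall p q, atlas p -> atlas q -> isometric_change p q ;
  atlas_maximal : forall p, is_chart inter p ->
    cimage p `<=` \bigcup_(q in atlas) cimage q ->
    (forall q, atlas q -> isometric_change p q /\ isometric_change q p) ->
    atlas p ;
  atlas_cover : inter `<=` \bigcup_(p in atlas) cimage p ;
  smooth_boundary_dense :
    ~` inter `<=` closure ((\bigcup_(p in atlas) cimage p) `\` inter) ;
  vol_boundary : vol (~` inter) = 0%E ;
  vol_chart : forall (p : chart n X) (A : set (borel 'rV[R]_n.+1)), atlas p ->
    measurable A -> A `<=` cdom p ->
    vol (cmap p @` A) =
      iterated_integral
        (fun x => (Num.sqrt (\det (cmet p x)) * \1_A x)%:E) }.

Definition boundary n X (g : riemannian n X) : set X := ~` inter g.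

Definition open_smooth_part n X (g : riemannian n X) (S : set X) : Prop :=
  S `<=` \bigcup_(p in atlas g) cimage p /\
  exists2 W, open W & S = W `&` boundary g.

(* - (1 / sqrt (det g)) sum_i d_i (sqrt (det g) sum_j g^ij d_j f) *)
Definition laplacian n (g : 'rV[R]_n.+1 -> 'M[R]_n.+1)
    (f : 'rV[R]_n.+1 -> R) (x : 'rV[R]_n.+1) : R :=
  - ((Num.sqrt (\det (g x)))^-1 *
     \sum_i partial i
       (fun y => Num.sqrt (\det (g y)) *
                 \sum_j invmx (g y) i j * partial j f y) x).

(* Derivative of f along the outward unit normal g^dj / sqrt g^dd, at a point x
   of the face x_d = 0 of the half space x_d <= 0. *)
Definition normal_derivative n (g : 'rV[R]_n.+1 -> 'M[R]_n.+1)
    (f : 'rV[R]_n.+1 -> R) (x : 'rV[R]_n.+1) : R :=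
  \sum_j (invmx (g x) ord_max j / Num.sqrt (invmx (g x) ord_max ord_max)) *
         partial j f x.

Definition zaremba n X (g : riemannian n X) (D N : set X) (lambda : R)
    (phi : X -> R) : Prop :=
  [/\ continuous phi,
      forall p x, atlas g p -> cdom p x ->
        (inter g `|` D `|` N) (cmap p x) ->
        smooth_at (cdom p) (phi \o cmap p) x,
      forall p x, atlas g p -> cdom p x -> inter g (cmap p x) ->
        laplacian (cmet p) (phi \o cmap p) x = lambda * phi (cmap p x),
      forall m, D m -> phi m = 0 &
      forall p x F, atlas g p -> cdom p x -> N (cmap p x) ->
        smooth_extension (cdom p) (phi \o cmap p) x F ->
        normal_derivative (cmet p) F x = 0].

(* The eigenvalues form an unbounded sequence in [0, +oo[, eigenspaces are finite
   dimensional, pairwise orthogonal, and their sum is dense in L^2. *)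
Definition spectral_assumption n X (g : riemannian n X) (D N : set X) : Prop :=
  [/\ exists lam : nat -> R,
        [/\ 0 <= lam 0%N,
            forall k, lam k <= lam k.+1,
            forall K, exists k, K < lam k &
            forall l, (exists2 phi, zaremba g D N l phi & exists m, phi m != 0)
                      <-> exists k, lam k = l],
      forall l, exists m (b : 'I_m -> X -> R),
        (forall k, zaremba g D N l (b k)) /\
        (forall phi, zaremba g D N l phi ->
           exists a : 'I_m -> R, forall x, phi x = \sum_k a k * b k x),
      forall l l' phi phi', l != l' ->
        zaremba g D N l phi -> zaremba g D N l' phi' ->
        Rintegral (vol g) setT (fun x => phi x * phi' x) = 0 &
      forall (f : borel X -> R) (e : R), f \in Lfun (vol g) 2%:E -> 0 < e ->
        exists m (l : 'I_m -> R) (phi : 'I_m -> X -> R),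
          (forall k, zaremba g D N (l k) (phi k)) /\
          ('N[vol g]_2%:E[(fun x => (f x - \sum_k phi k x)%:E)] < e%:E)%E].

(* The reflecting faces are required to be nonempty: gluing along an empty face
   would leave no trace in M.  The parts [bdir] and [bneu] belong to the block,
   so they are the same for all manifolds tiled by it. *)
Record building_block n (B : ptopologicalType) (C : nat) := BuildingBlock {
  bmfd :> riemannian n B ;
  face : 'I_C -> set B ;
  bdir : set B ;
  bneu : set B ;
  face_nonempty : forall c, face c !=set0 ;
  face_smooth : forall c, open_smooth_part bmfd (face c) ;
  face_disjoint : forall c c', c != c' -> face c `&` face c' = set0 ;
  face_flat : forall c, exists p,
    [/\ atlas bmfd p,
        exists2 W, open W & cdom p = W `&` @half_space R n,
        forall x, cdom p x -> cmet p x = 1%:M &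
        face c `<=` cimage p] ;
  bdir_smooth : open_smooth_part bmfd bdir ;
  bneu_smooth : open_smooth_part bmfd bneu ;
  bdir_bneu_disjoint : bdir `&` bneu = set0 ;
  bdir_bneu_face : forall c, (bdir `|` bneu) `&` closure (face c) = set0 ;
  block_boundary : boundary bmfd =
    closure ((\bigcup_(c in [set: 'I_C]) face c) `|` bdir `|` bneu) }.

(* M is the quotient of V copies of B, via the maps [inc i] from the i-th copy:
   closures of glued faces are identified via the identity of B.
   [glued c i j] means that copies i and j are glued along their c-th faces;
   [glued_unique] says that the glued pairs of faces are disjoint. *)
Record tiling n B C (b : building_block n B C) (V : nat)
    (M : ptopologicalType) := Tiling {
  tmfd :> riemannian n M ;
  glued : 'I_C -> rel 'I_V ;
  inc : 'I_V -> B -> M ;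
  glued_sym : forall c, symmetric (glued c) ;
  glued_irrefl : forall c, irreflexive (glued c) ;
  glued_unique : forall c i j k, glued c i j -> glued c i k -> j = k ;
  inc_surj : forall m, exists i x, inc i x = m ;
  inc_eq : forall i j x y, inc i x = inc j y <->
    x = y /\ connect (fun i' j' =>
      [exists c, glued c i' j' && `[< closure (face b c) x >]]) i j ;
  inc_open : forall W : set M, open W <-> forall i, open (inc i @^-1` W) ;
  tiling_inter : inter tmfd =
    (\bigcup_(i in [set: 'I_V]) (inc i @` inter b)) `|`
    [set m | exists c i j, glued c i j /\ (inc i @` face b c) m] ;
  inc_isometry : forall i (p : chart n B), atlas b p ->
    (forall c j, glued c i j -> cimage p `&` closure (face b c) = set0) ->
    atlas tmfd (Chart (cdom p) (inc i \o cmap p) (cmet p)) ;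
  inner_face_isometry : forall c i j (l : R) (psi : 'rV[R]_n.+1 -> B),
    glued c i j -> 0 < l ->
    atlas b (Chart (half_cube l) psi (fun=> 1%:M)) ->
    (forall x, half_cube l x -> lastc x = 0 -> face b c (psi x)) ->
    atlas tmfd (Chart (cube l)
      (fun x => if lastc x <= 0 then inc i (psi x)
                else inc j (psi (reflect_last x)))
      (fun=> 1%:M)) }.

Section Tiled.
Context n B C (b : building_block n B C) (V : nat).

Section BoundaryConditions.
Variables (M : ptopologicalType) (t : tiling b V M).

Definition outer (c : 'I_C) (i : 'I_V) : bool := ~~ [exists j, glued t c i j].

(* bc c i is true for Dirichlet and false for Neumann conditions; only its
   values at outer faces matter. *)
Variable bc : 'I_C -> 'I_V -> bool.

Definition dirichlet_part : set M :=
  (\bigcup_(i in [set: 'I_V]) (inc t i @` bdir b)) `|`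
  [set m | exists c i, [/\ outer c i, bc c i & (inc t i @` face b c) m]].

Definition neumann_part : set M :=
  (\bigcup_(i in [set: 'I_V]) (inc t i @` bneu b)) `|`
  [set m | exists c i, [/\ outer c i, ~~ bc c i & (inc t i @` face b c) m]].

Definition adjacency (c : 'I_C) : 'M[R]_V :=
  \matrix_(i, j)
    if i == j then (if outer c i then (if bc c i then -1 else 1) else 0)
    else (glued t c i j)%:R.

End BoundaryConditions.

Record tiled_manifold (M : ptopologicalType) := TiledManifold {
  ttiling :> tiling b V M ;
  tiled_spectral : forall bc,
    spectral_assumption ttiling (dirichlet_part ttiling bc)
      (neumann_part ttiling bc) }.

Definition solution M (t : tiled_manifold M) bc (lambda : R) (phi : M -> R) :=
  zaremba t (dirichlet_part t bc) (neumann_part t bc) lambda phi.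

Section Transplantation.
Variables (M M' : ptopologicalType).
Variables (t : tiled_manifold M) (t' : tiled_manifold M').

(* phi' represents the transplanted class T(phi). *)
Definition transplants (T : 'M[R]_V) (phi : M -> R) (phi' : M' -> R) : Prop :=
  forall i, {ae vol b, forall x : borel B,
    phi' (inc t' i x) = \sum_j T i j * phi (inc t j x)}.

End Transplantation.

Definition converts M M' (t : tiled_manifold M) (t' : tiled_manifold M')
    (bc bc' : 'I_C -> 'I_V -> bool) (T : 'M[R]_V) : Prop :=
  forall lambda phi, solution t bc lambda phi ->
    exists2 phi', solution t' bc' lambda phi' & transplants t t' T phi phi'.

Definition intertwining M M' (t : tiled_manifold M) (t' : tiled_manifold M')
    bc bc' (T : 'M[R]_V) : Prop :=
  converts t t' bc bc' T /\ converts t' t bc' bc (invmx T).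

Definition transplantable M M' (t : tiled_manifold M) (t' : tiled_manifold M')
    bc bc' : Prop :=
  exists2 T : 'M[R]_V, T \in unitmx & intertwining t t' bc bc' T.

End Tiled.
End Manifolds.

Arguments riemannian R n X : clear implicits.
Arguments building_block R n B C : clear implicits.

(* Main.v *)
From HB Require Import structures.
Require Import Defs.
From mathcomp Require Import all_boot all_order all_algebra.
From mathcomp Require Import all_classical all_reals all_analysis.
From mathcomp Require Import measurable_realfun.
From mathcomp Require Import ring lra.

Set Implicit Arguments.
Unset Strict Implicit.
Unset Printing Implicit Defensive.
Import Order.TTheory GRing.Theory Num.Theory.
Import numFieldNormedType.Exports.
Local Open Scope classical_set_scope.
Local Open Scope ring_scope.

(* The transplanted function T(phi) is smooth on the interior of each block, so
   everything happens at the reflecting faces.  In flat coordinates near the c-th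
   face, the reflection principle says that the restrictions f_j of a solution
   satisfy f_j = sum_k A^c_jk f_k and d_n f_j = - sum_k A^c_jk d_n f_k on the
   face, and conversely this first-order condition yields a smooth solution
   across the face, because the equation determines all higher normal
   derivatives by parity.  If A'^c T = T A^c, these conditions carry over from
   (f_j) to T(f).  If T is intertwining, T(f) satisfies them for both A'^c and
   T A^c T^-1, so sum_j (A'^c T - T A^c)_ij f_j has zero Cauchy data on the face
   and vanishes near it by unique continuation, on an open set which does not
   depend on the solution.  The span of the eigenfunctions being dense in L^2,
   the f_j satisfy no such linear relation, whence A'^c T = T A^c.

   Unique continuation is obtained from the interior gradient estimate for
   lap u = - lam u (maximum principle) and Taylor's formula. *)

(** * Smooth functions *)

(** Only collars of the faces are flat, and only there is unique continuation needed, so it concerns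
    the Euclidean Laplacian alone. Derivatives of a solution are then again solutions, which lets
    the gradient estimate be iterated. The m-th derivative costs a factor of order m^m, and m^m <=
    4^m m! lets the factorial in Taylor's remainder absorb it once the strip is thin. Taylor's
    formula also needs a base point where all derivatives vanish: zero Cauchy data allow a smooth
    extension by zero beyond the face, and the base point is taken on the face. A strip that shrinks
    as lam grows would be useless, since the eigenfunctions approximating an indicator function in
    L^2 have no common bound on their eigenvalues. In the converse direction two obstacles remain.
    Gluing identifies closures of faces, corners included, where solutions are merely continuous, so
    T(f) must be well defined there by continuity. And the equation and the boundary conditions must
    be verified in arbitrary charts: away from the faces by linearity in common coordinates, at the
    faces by comparison with a flat chart. *)

Section DifferentiabilityLocal.
Context {R : realType} {V W : normedModType R}.
Implicit Types f g : V -> W.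

(** Whatever is dominated in norm by an o(h) is itself o(h), so the zero differential passes from g
    to f. In [glue_diff] the dominating function is the difference of two pieces that agree to first
    order. *)
Lemma differentiable_dominated f g (x : V) :
  differentiable g x -> g x = 0 -> (forall v, 'd g x v = 0) ->
  (\forall y \near x, `|f y| <= `|g y|) ->
  differentiable f x /\ (forall v, 'd f x v = 0).
Proof.
move=> dg g0 d0 fg.
have f0 : f x = 0.
  have := nbhs_singleton fg; rewrite /= g0 normr0 normr_le0.
  by move/eqP.
have E : f \o shift x = cst (f x) + (cst 0 : V -> W) +o_ 0 id.
  apply: eqaddoE; rewrite addr0; apply/eqaddoP => e e0.
  have /diff_locallyP[_ /eqaddoP /(_ e e0)] := dg.
  have -> : cst (g x) + 'd g x = cst 0 :> (V -> W).
    by apply/funext => h; rewrite fctE /= g0 d0 addr0.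
  move=> H.
  rewrite f0; move: fg; rewrite (near_shift 0) /= => fg.
  apply: filterS2 fg H => h; rewrite /= subr0 !fctE /= !subr0 => A B.
  exact: le_trans A B.
have C : continuous (cst 0 : V -> W) by exact: cst_continuous.
have D : 'd f x = (\0 : {linear V -> W}) :> (V -> W).
  by apply: diff_unique => //.
split.
  by apply/diff_locallyP; rewrite D; split => //; rewrite E.
by move=> v; rewrite D.
Qed.

End DifferentiabilityLocal.

Lemma near_eq_differentiable {R : realType} {V W : normedModType R}
    (f g : V -> W) (x : V) :
  (\forall y \near x, f y = g y) -> differentiable f x -> differentiable g x.
Proof.
move=> fg df.
have [dh _] : differentiable (g - f) x /\ (forall v, 'd (g - f) x v = 0).
  apply: (@differentiable_dominated R V W _ (cst 0)) => //.
  - by move=> v; rewrite diff_cst.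
  - by apply: filterS fg => y e; rewrite -[(g - f) y]/(g y - f y) e subrr.
rewrite (_ : g = f + (g - f)); first exact: differentiableD.
by rewrite addrC subrK.
Qed.

Lemma is_derive_line {R : realType} {V W : normedModType R} (f : V -> W)
    (x v : V) (t : R) : derivable f (x + t *: v) v ->
  is_derive t 1 (fun t : R => f (x + t *: v)) ('D_v f (x + t *: v)).
Proof.
have E : (fun h : R => h^-1 *: ((fun t => f (x + t *: v)) (h *: 1 + t)
                               - f (x + t *: v)))
  = (fun h => h^-1 *: (f (h *: v + (x + t *: v)) - f (x + t *: v))).
  apply/funext => h; congr (_ *: (f _ - _)).
  by rewrite addrCA -scalerDl [h *: 1]mulr1.
move=> df; apply: DeriveDef.
  by move: df; rewrite /derivable -E.
by rewrite /derive -E.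
Qed.

Section Smooth.
Context {R : realType} {n : nat}.
Local Notation E := 'rV[R]_n.+1.
Local Notation e_ i := (delta_mx 0 i : E).

Section Vector.
Context {W : normedModType R}.
Implicit Types (f g : E -> W) (U : set E).

Definition smooth_on U f : Prop := forall s y, U y ->
  differentiable (foldr (@partial R W n) f s) y.

Lemma partialE f x i : differentiable f x -> partial i f x = 'd f x (e_ i).
Proof. by move=> df; rewrite /partial deriveE. Qed.

Lemma diff_partial f x v : differentiable f x ->
  'd f x v = \sum_i v 0 i *: partial i f x.
Proof.
move=> df; rewrite {1}(row_sum_delta v) linear_sum /=.
by apply: eq_bigr => i _; rewrite linearZ /= partialE.
Qed.

Lemma near_eq_partial f g x i : (\forall y \near x, f y = g y) ->
  partial i f x = partial i g x.
Proof. by move=> fg; exact: near_eq_derive. Qed.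

Lemma smooth_nearP f x :
  smooth_near f x <-> exists U, [/\ open U, U x & smooth_on U f].
Proof.
split=> [H|[U [oU Ux sf]]].
  exists (interior [set y | forall s, differentiable (foldr (@partial R W n) f s) y]).
  split; [exact: open_interior|exact: H|].
  by move=> s y /interior_subset; apply.
by near=> y => s; apply: sf; near: y; exact: open_nbhs_nbhs.
Unshelve. all: by end_near. Qed.

Lemma smooth_on_diff U f y : smooth_on U f -> U y -> differentiable f y.
Proof. by move=> sf; exact: (sf [::]). Qed.

Lemma smooth_on_continuous U f y : smooth_on U f -> U y -> {for y, continuous f}.
Proof. by move=> sf Uy; apply/differentiable_continuous/(smooth_on_diff sf). Qed.

Lemma smooth_on_partial U f i : smooth_on U f -> smooth_on U (partial i f).
Proof. by move=> sf s y Uy; rewrite -foldr_rcons; exact: sf. Qed.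

Lemma smooth_on_sub U U' f : U' `<=` U -> smooth_on U f -> smooth_on U' f.
Proof. by move=> UU sf s y /UU; exact: sf. Qed.

(** By induction on the list, the iterated derivatives of a member of P are again members of P up to
    equality on U. Equality on U is enough because U is open, and it is all that the differentiation
    rules provide. *)
Lemma smooth_coind U (P : (E -> W) -> Prop) : open U ->
  (forall f, P f -> forall y, U y -> differentiable f y) ->
  (forall f i, P f -> exists2 g, P g & forall y, U y -> partial i f y = g y) ->
  forall f, P f -> smooth_on U f.
Proof.
move=> oU dP pP f Pf s.
have [g Pg fg] : exists2 g, P g &
    forall y, U y -> foldr (@partial R W n) f s y = g y.
  elim: s => [|i s [g Pg fg]] /=; first by exists f.
  have [h Ph gh] := pP _ i Pg; exists h => // y Uy.
  rewrite -gh //; apply: near_eq_partial.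
  by apply: filterS (open_nbhs_nbhs (conj oU Uy)) => z /fg.
move=> y Uy; apply: near_eq_differentiable (dP _ Pg _ Uy).
by apply: filterS (open_nbhs_nbhs (conj oU Uy)) => z /fg.
Qed.

Lemma near_open_eq U f g y : open U -> (forall y, U y -> f y = g y) -> U y ->
  \forall z \near y, f z = g z.
Proof.
by move=> oU fg Uy; apply: filterS (open_nbhs_nbhs (conj oU Uy)) => z /fg.
Qed.

Lemma smooth_on_eq U f g : open U -> (forall y, U y -> f y = g y) ->
  smooth_on U f -> smooth_on U g.
Proof.
move=> oU fg sf.
pose P g := exists2 f, smooth_on U f & forall y, U y -> f y = g y.
apply: (@smooth_coind U P) => //; last by exists f.
- move=> {}g [{}f {}sf {}fg] y Uy.
  apply: near_eq_differentiable (smooth_on_diff sf Uy).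
  exact: near_open_eq fg Uy.
- move=> {}g i [{}f {}sf {}fg]; exists (partial i g) => //.
  exists (partial i f); first exact: smooth_on_partial.
  by move=> y Uy; apply/near_eq_partial/(near_open_eq oU fg).
Qed.

Lemma smooth_near_eq f g x : (\forall y \near x, f y = g y) ->
  smooth_near f x -> smooth_near g x.
Proof.
move=> fg /smooth_nearP[U [oU Ux sf]]; apply/smooth_nearP.
exists (U `&` interior [set y | f y = g y]); split.
- by apply: openI => //; exact: open_interior.
- by split.
- apply: (@smooth_on_eq _ f).
  + by apply: openI => //; exact: open_interior.
  + by move=> y [_ /interior_subset].
  + by apply: smooth_on_sub sf => y [].
Qed.

Lemma smooth_near_nbhs f x : smooth_near f x -> \forall y \near x, smooth_near f y.
Proof.
move=> /smooth_nearP[U [oU Ux sf]].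
apply: filterS (open_nbhs_nbhs (conj oU Ux)) => y Uy.
by apply/smooth_nearP; exists U.
Qed.

Lemma smooth_near_diff f x : smooth_near f x -> differentiable f x.
Proof. by move=> /smooth_nearP[U [oU Ux sf]]; exact: smooth_on_diff sf Ux. Qed.

Lemma smooth_near_continuous f x : smooth_near f x -> {for x, continuous f}.
Proof. by move=> /smooth_near_diff; exact: differentiable_continuous. Qed.

Lemma smooth_near_partial f x i : smooth_near f x -> smooth_near (partial i f) x.
Proof.
move=> /smooth_nearP[U [oU Ux sf]]; apply/smooth_nearP; exists U; split => //.
exact: smooth_on_partial.
Qed.

Lemma foldr_partial_shift f (v : E) s :
  foldr (@partial R W n) (fun x => f (x + v)) s =
  (fun x => foldr (@partial R W n) f s (x + v)).
Proof.
elim: s => //= i s ->; apply/funext => x.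
set F := foldr _ f s.
have H : (fun h : R => h^-1 *: ((fun x => F (x + v)) (h *: e_ i + x) - F (x + v)))
  = (fun h => h^-1 *: (F (h *: e_ i + (x + v)) - F (x + v))).
  by apply/funext => h; rewrite addrA.
exact: (congr1 (fun k => lim (k @ 0^')) H).
Qed.

Lemma differentiable_shift f (v x : E) :
  differentiable f (x + v) -> differentiable (fun x => f (x + v)) x.
Proof.
move=> df; have ds : differentiable (fun x : E => x + v) x.
  apply: (@differentiableD _ _ _ id (cst v)); last exact: differentiable_cst.
  exact: ex_diff.
exact: (differentiable_comp ds df).
Qed.

Lemma smooth_near_shift f (v x : E) :
  smooth_near f (x + v) -> smooth_near (fun x => f (x + v)) x.
Proof.
have c : {for x, continuous (fun x : E => x + v)}.
  by apply: (@continuousD _ _ _ id (cst v)); [exact: cvg_id|exact: cst_continuous].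
move=> sf.
have : \forall y \near x, forall s, differentiable (foldr (@partial R W n) f s) (y + v).
  exact: (c _ sf).
apply: filterS => y H s.
by rewrite foldr_partial_shift; exact: differentiable_shift.
Qed.

Lemma partial_cst (c : W) i : partial i (cst c) = cst 0 :> (E -> W).
Proof. by apply/funext => x; rewrite /partial derive_cst. Qed.

Lemma smooth_on_cst U (c : W) : smooth_on U (cst c).
Proof.
move=> s y _.
have [d ->] : exists d, foldr (@partial R W n) (cst c) s = cst d.
  elim: s => [|i s [d dE]] /=; first by exists c.
  by exists 0; rewrite dE partial_cst.
by apply: differentiable_cst.
Qed.

Lemma smooth_near_cst (x : E) (c : W) : smooth_near (cst c) x.
Proof.
apply/smooth_nearP; exists setT.
split; [exact: openT|by []|exact: smooth_on_cst].
Qed.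

Lemma partialD f g x i : differentiable f x -> differentiable g x ->
  partial i (fun y => f y + g y) x = partial i f x + partial i g x.
Proof.
by move=> df dg; rewrite /partial -deriveD //; exact: diff_derivable.
Qed.

Lemma partialZ (a : R) f x i : differentiable f x ->
  partial i (fun y => a *: f y) x = a *: partial i f x.
Proof.
by move=> df; rewrite /partial -deriveZ //; exact: diff_derivable.
Qed.

End Vector.
End Smooth.

Section Coordinates.
Context {R : realType} {n : nat}.
Local Notation E := 'rV[R]_n.+1.

Lemma differentiable_entry {V : normedModType R} p q (f : V -> 'M[R]_(p, q)) x i j :
  differentiable f x -> differentiable (fun y => f y i j) x.
Proof.
move=> df; exact: (differentiable_comp df (differentiable_coord (f x) i j)).
Qed.

Lemma partial_entry p q (f : E -> 'M[R]_(p.+1, q.+1)) x i j k :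
  differentiable f x -> partial k (fun y => f y i j) x = (partial k f x) i j.
Proof.
by move=> df; rewrite /partial derive_mx ?mxE //; exact: diff_derivable.
Qed.

Lemma smooth_on_entry p q (U : set E) (f : E -> 'M[R]_(p.+1, q.+1)) i j :
  open U -> smooth_on U f -> smooth_on U (fun y => f y i j).
Proof.
move=> oU sf.
pose P g := exists2 f : E -> 'M[R]_(p.+1, q.+1), smooth_on U f &
  g = (fun y => f y i j).
apply: (@smooth_coind _ _ _ U P) => //; last by exists f.
- move=> _ [{}f {}sf ->] y Uy; apply: differentiable_entry.
  exact: smooth_on_diff sf Uy.
- move=> _ k [{}f {}sf ->]; exists (fun y => (partial k f y) i j).
    by exists (partial k f) => //; exact: smooth_on_partial.
  by move=> y Uy; rewrite partial_entry //; exact: smooth_on_diff sf Uy.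
Qed.

Lemma partial_comp (f : E -> R) (tau : E -> E) x i :
  differentiable tau x -> differentiable f (tau x) ->
  partial i (f \o tau) x =
  \sum_j partial j f (tau x) * partial i (fun y => tau y 0 j) x.
Proof.
move=> dt df; rewrite (partialE _ (differentiable_comp dt df)).
rewrite (diff_comp dt df) /= diff_partial //; apply: eq_bigr => j _.
by rewrite partial_entry // (partialE i dt) mulrC.
Qed.

Lemma partialM (f g : E -> R) x i : differentiable f x -> differentiable g x ->
  partial i (fun y => f y * g y) x = f x * partial i g x + g x * partial i f x.
Proof. by move=> df dg; rewrite /partial -deriveM //; exact: diff_derivable. Qed.

Lemma partialV (f : E -> R) x i : differentiable f x -> f x != 0 ->
  partial i (fun y => (f y)^-1) x = - ((f x)^-1 * (f x)^-1) * partial i f x.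
Proof.
move=> df f0; rewrite /partial deriveV //; last exact: diff_derivable.
by rewrite -exprVn expr2.
Qed.

(** Where f is negative the square root is locally the constant 0 and the formula gives 0. The
    derivative contains the root of 1/f rather than the inverse of the root of f: 1/f is again
    nonzero, while the root may vanish, so this form stays inside [smooth_closure]. *)
Lemma differentiable_sqrt (f : E -> R) x : differentiable f x -> f x != 0 ->
  differentiable (fun y => Num.sqrt (f y)) x /\
  forall i, partial i (fun y => Num.sqrt (f y)) x =
            2^-1 * Num.sqrt ((f x)^-1) * partial i f x.
Proof.
move=> df; rewrite neq_lt => /orP[f0|f0].
  have N : \forall y \near x, (cst 0 : E -> R) y = Num.sqrt (f y).
    have : \forall y \near x, f y < 0.
      have /differentiable_continuous c := df.
      exact: (cvgr_lt _ c _ f0).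
    by apply: filterS => y /ltW /ler0_sqrtr ->.
  split; first by apply: near_eq_differentiable N _; exact: differentiable_cst.
  move=> i; rewrite -(near_eq_partial _ N) partial_cst.
  by rewrite ler0_sqrtr ?mulr0 ?mul0r // invr_le0 ltW.
have ds : differentiable (@Num.sqrt R) (f x).
  by apply/derivable1_diffP; apply: ex_derive; exact: is_derive1_sqrt.
have dc : differentiable (fun y => Num.sqrt (f y)) x.
  exact: (differentiable_comp df ds).
split => // i; rewrite (partialE i dc) (partialE i df).
have H : 'd (fun y => Num.sqrt (f y)) x = 'd (@Num.sqrt R) (f x) \o 'd f x :> (E -> R).
  exact: (diff_comp df ds).
apply: (etrans (congr1 (fun k : E -> R => k (delta_mx 0 i)) H)).
rewrite /= diff1E // derive1E derive_sqrt // sqrtrV ?ltW // invfM.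
by rewrite [LHS]mulrC.
Qed.

End Coordinates.

Section Scalar.
Context {R : realType} {n : nat}.
Local Notation E := 'rV[R]_n.+1.
Implicit Types (U : set E) (f g : E -> R).

(** The differentiation rule of each constructor is expressible by the constructors, so the class is
    stable under [partial] and [smooth_coind] applies to it once and for all. Inverses and roots are
    there for the metric: Cramer's rule and the root of its determinant. *)
Inductive smooth_closure U : (E -> R) -> Prop :=
| SmoothBase f of smooth_on U f : smooth_closure U f
| SmoothAdd f g of smooth_closure U f & smooth_closure U g :
    smooth_closure U (fun y => f y + g y)
| SmoothMul f g of smooth_closure U f & smooth_closure U g :
    smooth_closure U (fun y => f y * g y)
| SmoothInv f of smooth_closure U f & (forall y, U y -> f y != 0) :
    smooth_closure U (fun y => (f y)^-1)
| SmoothSqrt f of smooth_closure U f & (forall y, U y -> f y != 0) :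
    smooth_closure U (fun y => Num.sqrt (f y))
| SmoothComp U' f (tau : E -> E) of open U' & smooth_on U' f &
    smooth_on U tau & (forall y, U y -> U' (tau y)) :
    smooth_closure U (f \o tau).

Lemma smooth_closure_diff U f : smooth_closure U f ->
  forall y, U y -> differentiable f y.
Proof.
move=> sf y Uy; elim: sf => {f}.
- by move=> f sf; exact: smooth_on_diff sf Uy.
- by move=> f g _ df _ dg; exact: differentiableD.
- by move=> f g _ df _ dg; exact: differentiableM.
- by move=> f _ df f0; apply: differentiableV => //; exact: f0.
- by move=> f _ df f0; case: (differentiable_sqrt df (f0 _ Uy)).
- move=> U' f tau oU' sf st UU'; apply: differentiable_comp.
    exact: smooth_on_diff st Uy.
  by apply: smooth_on_diff sf _; exact: UU'.
Qed.

Lemma smooth_closure_sum U (I : Type) (r : seq I) (P : pred I) (F : I -> E -> R) :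
  (forall i, P i -> smooth_closure U (F i)) ->
  smooth_closure U (fun y => \sum_(i <- r | P i) F i y).
Proof.
move=> sF; elim: r => [|i r IH].
  rewrite (_ : (fun _ => _) = cst 0); last by apply/funext => y; rewrite big_nil.
  exact/SmoothBase/smooth_on_cst.
case Pi : (P i); last first.
  by rewrite (_ : (fun _ => _) = (fun y => \sum_(i <- r | P i) F i y)) //;
     apply/funext => y; rewrite big_cons Pi.
rewrite (_ : (fun _ => _) = (fun y => F i y + \sum_(i <- r | P i) F i y)).
  by apply: SmoothAdd => //; exact: sF.
by apply/funext => y; rewrite big_cons Pi.
Qed.

Lemma smooth_closure_prod U (I : Type) (r : seq I) (P : pred I) (F : I -> E -> R) :
  (forall i, P i -> smooth_closure U (F i)) ->
  smooth_closure U (fun y => \prod_(i <- r | P i) F i y).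
Proof.
move=> sF; elim: r => [|i r IH].
  rewrite (_ : (fun _ => _) = cst 1); last by apply/funext => y; rewrite big_nil.
  exact/SmoothBase/smooth_on_cst.
case Pi : (P i); last first.
  by rewrite (_ : (fun _ => _) = (fun y => \prod_(i <- r | P i) F i y)) //;
     apply/funext => y; rewrite big_cons Pi.
rewrite (_ : (fun _ => _) = (fun y => F i y * \prod_(i <- r | P i) F i y)).
  by apply: SmoothMul => //; exact: sF.
by apply/funext => y; rewrite big_cons Pi.
Qed.

Lemma smooth_closure_cst U c : smooth_closure U (fun=> c).
Proof. exact/SmoothBase/smooth_on_cst. Qed.

Lemma smooth_closure_partial U f i : open U -> smooth_closure U f ->
  exists2 g, smooth_closure U g & forall y, U y -> partial i f y = g y.
Proof.
move=> oU; elim => {f}.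
- move=> f sf; exists (partial i f) => //.
  by apply: SmoothBase; exact: smooth_on_partial.
- move=> f g sf [f' sf' ff'] sg [g' sg' gg'].
  exists (fun y => f' y + g' y); first exact: SmoothAdd.
  move=> y Uy; rewrite partialD ?ff' ?gg' //; exact: smooth_closure_diff Uy.
- move=> f g sf [f' sf' ff'] sg [g' sg' gg'].
  exists (fun y => f y * g' y + g y * f' y).
    by apply: SmoothAdd; exact: SmoothMul.
  move=> y Uy; rewrite partialM ?ff' ?gg' //; exact: smooth_closure_diff Uy.
- move=> f sf [f' sf' ff'] f0.
  exists (fun y => (-1 * ((f y)^-1 * (f y)^-1)) * f' y).
    apply: SmoothMul => //; apply: SmoothMul; first exact: smooth_closure_cst.
    by apply: SmoothMul; exact: SmoothInv.
  move=> y Uy; rewrite partialV ?ff' ?mulN1r //; last exact: f0.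
  exact: smooth_closure_diff Uy.
- move=> f sf [f' sf' ff'] f0.
  exists (fun y => 2^-1 * Num.sqrt ((f y)^-1) * f' y).
    apply: SmoothMul => //; apply: SmoothMul; first exact: smooth_closure_cst.
    apply: SmoothSqrt; first exact: SmoothInv.
    by move=> y Uy; rewrite invr_eq0 f0.
  move=> y Uy; rewrite -ff' //.
  by case: (differentiable_sqrt (smooth_closure_diff sf Uy) (f0 _ Uy)).
- move=> U' f tau oU' sf st UU'.
  exists (fun y => \sum_j partial j f (tau y) * partial i (fun y => tau y 0 j) y).
    apply: smooth_closure_sum => j _; apply: SmoothMul.
      by apply: (@SmoothComp U U' (partial j f) tau) => //; exact: smooth_on_partial.
    by apply/SmoothBase/smooth_on_partial/(@smooth_on_entry _ _ 0).
  move=> y Uy; rewrite partial_comp //; first exact: smooth_on_diff st Uy.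
  by apply: smooth_on_diff sf _; exact: UU'.
Qed.

Lemma smooth_closureP U f : open U -> smooth_closure U f -> smooth_on U f.
Proof.
move=> oU; apply: smooth_coind => // {}f; first exact: smooth_closure_diff.
by move=> i sf; exact: smooth_closure_partial.
Qed.

Lemma smooth_near_comp f (tau : E -> E) x :
  smooth_near tau x -> smooth_near f (tau x) -> smooth_near (f \o tau) x.
Proof.
move=> /smooth_nearP[U [oU Ux st]] /smooth_nearP[U' [oU' U'x sf]].
apply/smooth_nearP; exists (U `&` tau @^-1` U').
have oV : open (U `&` tau @^-1` U').
  rewrite openE => y [Uy U'y]; rewrite /interior; apply: filterI.
    exact: open_nbhs_nbhs.
  exact: (smooth_on_continuous st Uy (open_nbhs_nbhs (conj oU' U'y))).
split => //; apply: smooth_closureP => //.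
apply: (@SmoothComp _ U') => //; last by move=> y [].
by apply: smooth_on_sub st => y [].
Qed.

Lemma smooth_near_lin (I : finType) (a : I -> R) (F : I -> E -> R) x :
  (forall i, smooth_near (F i) x) ->
  smooth_near (fun y => \sum_i a i * F i y) x.
Proof.
move=> sF.
have /choice[U HU] : forall i, exists U, [/\ open U, U x & smooth_on U (F i)].
  by move=> i; apply/smooth_nearP.
have N : \forall y \near x, forall i, U i y.
  apply: (@filter_forall E I U (nbhs x) _) => i; case: (HU i) => oU Ux _.
  exact: (open_nbhs_nbhs (conj oU Ux)).
apply/smooth_nearP; exists (interior [set y | forall i, U i y]).
split; [exact: open_interior|exact: N|].
apply: smooth_closureP; first exact: open_interior.
apply: smooth_closure_sum => i _; apply: SmoothMul; first exact: smooth_closure_cst.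
apply: SmoothBase; case: (HU i) => _ _; apply: smooth_on_sub => y.
by move=> /interior_subset; apply.
Qed.

Lemma partial_sum (I : Type) (r : seq I) (F : I -> E -> R) x k :
  (forall i, differentiable (F i) x) ->
  differentiable (fun y => \sum_(i <- r) F i y) x /\
  partial k (fun y => \sum_(i <- r) F i y) x = \sum_(i <- r) partial k (F i) x.
Proof.
move=> dF; elim: r => [|i r [d1 p1]].
  rewrite (_ : (fun _ => _) = cst 0); last by apply/funext => y; rewrite big_nil.
  by rewrite partial_cst big_nil; split => //; exact: differentiable_cst.
rewrite (_ : (fun _ => _) = (fun y => F i y + \sum_(i <- r) F i y)).
  by split; [exact: differentiableD|rewrite partialD // p1 big_cons].
by apply/funext => y; rewrite big_cons.
Qed.

Lemma partial_lin (I : finType) (a : I -> R) (F : I -> E -> R) x k :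
  (forall i, differentiable (F i) x) ->
  partial k (fun y => \sum_i a i * F i y) x = \sum_i a i * partial k (F i) x.
Proof.
move=> dF; have d i : differentiable (fun y => a i * F i y) x.
  by apply: differentiableM => //; exact: differentiable_cst.
rewrite (proj2 (partial_sum _ k d)); apply: eq_bigr => i _.
exact: (@partialZ R n R (a i) (F i)).
Qed.

End Scalar.

(** * Symmetry of mixed second derivatives *)

Section Clairaut.
Context {R : realType} {n : nat}.
Local Notation E := 'rV[R]_n.+1.
Local Notation e_ i := (delta_mx 0 i : E).
Implicit Types (f : E -> R).

Lemma norm_delta_le1 i : `|e_ i| <= 1.
Proof.
rewrite [`|_|]mx_normrE; apply: bigmax_le => // -[a j] _ /=.
by rewrite mxE; case: (_ && _); rewrite ?normr1 ?normr0.
Qed.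

Lemma MVT_line f (x : E) i h : 0 < h ->
  (forall t, 0 <= t <= h -> differentiable f (x + t *: e_ i)) ->
  exists2 t, 0 < t < h & f (x + h *: e_ i) - f x = h * partial i f (x + t *: e_ i).
Proof.
move=> h0 df.
have D t : 0 <= t <= h ->
    is_derive t 1 (fun t => f (x + t *: e_ i)) (partial i f (x + t *: e_ i)).
  by move=> th; apply: is_derive_line; exact/diff_derivable/df.
have [||t] := @MVT R (fun t => f (x + t *: e_ i)) (fun t => partial i f (x + t *: e_ i)) 0 h h0.
- by move=> t; rewrite in_itv /= => /andP[t0 th]; apply: D; rewrite !ltW.
- apply: derivable_within_continuous => t; rewrite in_itv /= => th.
  by case: (D _ th).
rewrite in_itv /= scale0r addr0 subr0 mulrC => th e.
by exists t.
Qed.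

(** Mean value theorem twice: for z |-> f (z + h e_j) - f z along e_i, then for [partial i f] along
    e_j. The left side is symmetric in i and j, which is what [partialC] exploits. *)
Lemma second_difference f (y : E) i j h : 0 < h ->
  (forall s t, 0 <= s <= h -> 0 <= t <= h ->
     differentiable f (y + s *: e_ i + t *: e_ j) /\
     differentiable (partial i f) (y + s *: e_ i + t *: e_ j)) ->
  exists s t, [/\ 0 < s < h, 0 < t < h &
    f (y + h *: e_ i + h *: e_ j) - f (y + h *: e_ i) - (f (y + h *: e_ j) - f y)
    = h * h * partial j (partial i f) (y + s *: e_ i + t *: e_ j)].
Proof.
move=> h0 df.
have df1 s : 0 <= s <= h -> differentiable f (y + s *: e_ i).
  have h00 : 0 <= (0 : R) <= h by rewrite lexx ltW.
  by move=> sh; case: (df s 0 sh h00); rewrite scale0r addr0.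
have df2 s : 0 <= s <= h -> differentiable f (y + s *: e_ i + h *: e_ j).
  have hh : 0 <= h <= h by rewrite lexx ltW.
  by move=> sh; case: (df s h sh hh).
have dN s : 0 <= s <= h -> differentiable (fun z => -1 * f z) (y + s *: e_ i).
  move=> sh; apply: differentiableM; first exact: differentiable_cst.
  exact: df1.
have [s sh] := @MVT_line (fun z => f (z + h *: e_ j) + -1 * f z) y i h h0
  (fun s sh => differentiableD (differentiable_shift (df2 s sh)) (dN s sh)).
have sh' : 0 <= s <= h by case/andP: sh => *; rewrite !ltW.
rewrite partialD; [|exact: differentiable_shift (df2 s sh')|exact: dN].
rewrite (@partialZ R n R (-1) f _ i (df1 s sh')).
have -> : partial i (fun z => f (z + h *: e_ j)) (y + s *: e_ i) =
          partial i f (y + s *: e_ i + h *: e_ j).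
  by have := congr1 (@^~ (y + s *: e_ i)) (foldr_partial_shift f (h *: e_ j) [:: i]).
have [t th Ht] := @MVT_line (partial i f) (y + s *: e_ i) j h h0
  (fun t th => proj2 (df s t sh' th)).
rewrite scaleN1r Ht !mulN1r => e.
by exists s, t; split => //; apply: (etrans _ (mulrA _ _ _)); rewrite -e.
Qed.

Lemma partialC f U y i j : open U -> smooth_on U f -> U y ->
  partial i (partial j f) y = partial j (partial i f) y.
Proof.
move=> oU sf Uy.
pose a := partial j (partial i f); pose b := partial i (partial j f).
have ca : {for y, continuous a}.
  by apply: (smooth_on_continuous _ Uy); do 2!apply: smooth_on_partial.
have cb : {for y, continuous b}.
  by apply: (smooth_on_continuous _ Uy); do 2!apply: smooth_on_partial.
change (b y = a y); apply/eqP; rewrite -subr_eq0 -normr_le0; apply/ler_addgt0Pl => e e0.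
have e2 : 0 < e / 2 by rewrite divr_gt0.
have N : \forall z \near y, [/\ `|a y - a z| < e / 2, `|b y - b z| < e / 2 & U z].
  have Na : \forall z \near y, `|a y - a z| < e / 2.
    by apply: (proj1 (cvgrPdist_lt _ _) ca).
  have Nb : \forall z \near y, `|b y - b z| < e / 2.
    by apply: (proj1 (cvgrPdist_lt _ _) cb).
  by apply: filterS3 Na Nb (open_nbhs_nbhs (conj oU Uy)).
have [r /= r0 Hr] := (nbhs_normP y _).1 N.
(* Intermediate points differ from y by at most 2 h = r / 2 in norm, hence stay in the ball of
   radius r. *)
pose h := r / 4.
have h0 : 0 < h by rewrite divr_gt0.
have Hr' k l s t : 0 <= s <= h -> 0 <= t <= h ->
  [/\ `|a y - a (y + s *: e_ k + t *: e_ l)| < e / 2,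
      `|b y - b (y + s *: e_ k + t *: e_ l)| < e / 2
      & U (y + s *: e_ k + t *: e_ l)].
  move=> /andP[s0 sh] /andP[t0 th]; apply: Hr => /=.
  rewrite -addrA opprD addrA subrr add0r normrN.
  apply: le_lt_trans (ler_normD _ _) _; rewrite !normrZ !ger0_norm //.
  apply: (@le_lt_trans _ _ (h * 1 + h * 1)); last by rewrite /h; lra.
  by apply: lerD; apply: ler_pM => //; exact: norm_delta_le1.
have [s [t [sh th e1]]] := @second_difference f y i j h h0 (fun s t sh th =>
  let: And3 _ _ u := Hr' i j s t sh th in
  conj (smooth_on_diff sf u) (smooth_on_diff (smooth_on_partial i sf) u)).
have [s' [t' [sh' th' e2']]] := @second_difference f y j i h h0 (fun s t sh th =>
  let: And3 _ _ u := Hr' j i s t sh th in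
  conj (smooth_on_diff sf u) (smooth_on_diff (smooth_on_partial j sf) u)).
have ab : a (y + s *: e_ i + t *: e_ j) = b (y + s' *: e_ j + t' *: e_ i).
  apply: (@mulfI _ (h * h)); first by rewrite mulf_neq0 // gt_eqF.
  apply: (etrans (esym e1)); apply: (etrans _ e2').
  rewrite [y + h *: e_ j + _]addrAC -!addrA; congr (_ + _).
  by rewrite !opprB addrCA [RHS]addrCA; congr (_ + _); exact: addrC.
have W (u : R) : 0 < u < h -> 0 <= u <= h by case/andP => *; rewrite !ltW.
have [A1 _ _] := Hr' i j s t (W _ sh) (W _ th).
have [_ B1 _] := Hr' j i s' t' (W _ sh') (W _ th').
rewrite addr0.
have -> : b y - a y = (b y - b (y + s' *: e_ j + t' *: e_ i))
                      - (a y - a (y + s *: e_ i + t *: e_ j)).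
  by rewrite ab opprB addrA subrK.
rewrite (splitr e); apply: le_trans (ler_normB _ _) (lerD (ltW B1) (ltW A1)).
Qed.

End Clairaut.

(** * Gluing along a hyperplane *)

Section Gluing.
Context {R : realType} {n : nat}.
Local Notation E := 'rV[R]_n.+1.
Local Notation e_ i := (delta_mx 0 i : E).
Local Notation lst := (ord_max : 'I_n.+1).
Implicit Types (f g F G : E -> R) (U : set E).

Lemma lastcD (x y : E) : lastc (x + y) = lastc x + lastc y.
Proof. by rewrite /lastc mxE. Qed.

Lemma lastcZ a (x : E) : lastc (a *: x) = a * lastc x.
Proof. by rewrite /lastc mxE. Qed.

Lemma lastc_delta i : lastc (e_ i) = (i == lst)%:R.
Proof. by rewrite /lastc mxE eqxx /= eq_sym. Qed.

Lemma continuous_lastc : continuous (@lastc R n).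
Proof. by move=> x; exact: coord_continuous. Qed.

Lemma open_lastc_lt0 : open [set x : E | lastc x < 0].
Proof.
apply: (@open_comp _ _ (@lastc R n) [set t | t < 0]); last exact: open_lt.
by move=> x _; exact: continuous_lastc.
Qed.

Lemma open_lastc_gt0 : open [set x : E | 0 < lastc x].
Proof.
apply: (@open_comp _ _ (@lastc R n) [set t | 0 < t]); last exact: open_gt.
by move=> x _; exact: continuous_lastc.
Qed.

(** A derivative known to exist may be computed from negative steps alone. *)
Lemma derive_left0 f (x v : E) : derivable f x v -> f x = 0 ->
  (\forall h \near (0 : R), h < 0 -> f (h *: v + x) = 0) -> 'D_v f x = 0.
Proof.
move=> df f0 Hf; rewrite /derive cvg_at_leftE //.
apply: (@cvg_lim _ _ _ (at_left (0 : R))) => //.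
apply: cvg_near_cst.
have : \forall h \near (0 : R)^'-, h < 0 -> f (h *: v + x) = 0.
  exact: cvg_within Hf.
have : \forall h \near (0 : R)^'-, h < 0 by exact: nbhs_left_lt.
by apply: filterS2 => h h0 /(_ h0) fh0; rewrite /= fh0 f0 subrr scaler0.
Qed.

Lemma half_line (P : E -> Prop) (y v : E) : nbhs y P ->
  \forall h \near (0 : R), P (h *: v + y).
Proof.
move=> H.
have c : (h *: v + y) @[h --> (0 : R)] --> y.
  have E0 : 0 *: v + y = y by rewrite scale0r add0r.
  rewrite -[X in _ --> X]E0; apply: cvgD; last exact: cvg_cst.
  exact: scalel_continuous.
exact: c H.
Qed.

Lemma partialB f g y i : differentiable f y -> differentiable g y ->
  partial i (f - g) y = partial i f y - partial i g y.
Proof. by move=> df dg; rewrite /partial deriveB //; exact: diff_derivable. Qed.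

Lemma partialMl a f y i : differentiable f y ->
  partial i (fun z => a * f z) y = a * partial i f y.
Proof. exact: (@partialZ R n R a). Qed.

Lemma differentiableMl a f y : differentiable f y ->
  differentiable (fun z => a * f z) y.
Proof. by move=> df; apply: differentiableM => //; exact: differentiable_cst. Qed.

(** Steps h e_i with h < 0 never leave the half space, whatever i is, so values on the half space
    determine all partial derivatives even at the face. *)
Lemma partial_one_sided f g y i : differentiable f y -> differentiable g y ->
  lastc y <= 0 -> (\forall z \near y, lastc z <= 0 -> f z = g z) ->
  partial i f y = partial i g y.
Proof.
move=> df dg y0 fg.
have dh : differentiable (f - g) y by exact: differentiableB.
have : partial i (f - g) y = 0.
  apply: derive_left0; first exact: diff_derivable.
    by rewrite -[LHS]/(f y - g y) (nbhs_singleton fg) // subrr.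
  apply: filterS (half_line (e_ i) fg) => h H h0.
  rewrite -[LHS]/(f (h *: e_ i + y) - g (h *: e_ i + y)) H ?subrr //.
  rewrite lastcD lastcZ lastc_delta.
  by case: eqP => _; rewrite ?mulr1 ?mulr0 ?add0r //; lra.
rewrite partialB //.
by move/eqP; rewrite subr_eq0 => /eqP.
Qed.

Lemma partial_tangential f y i : differentiable f y -> i != lst ->
  lastc y = 0 -> (\forall z \near y, lastc z = 0 -> f z = 0) ->
  partial i f y = 0.
Proof.
move=> df il y0 f0; apply: derive_left0; first exact: diff_derivable.
  exact: (nbhs_singleton f0).
apply: filterS (half_line (e_ i) f0) => h H h0; apply: H.
by rewrite lastcD lastcZ lastc_delta (negbTE il) mulr0 add0r.
Qed.

Definition half_glue F G (x : E) : R := if lastc x <= 0 then F x else G x.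

(** The difference [half_glue F G - F] is 0 or G - F at each point, and G - F vanishes to first
    order at y. *)
Lemma glue_diff F G y : differentiable F y -> differentiable G y ->
  lastc y = 0 -> F y = G y -> (forall i, partial i F y = partial i G y) ->
  differentiable (half_glue F G) y /\
  forall i, partial i (half_glue F G) y = partial i F y.
Proof.
move=> dF dG y0 FG pFG.
have dd : differentiable (G - F) y by exact: differentiableB.
have d0 v : 'd (G - F) y v = 0.
  rewrite diff_partial // big1 // => i _.
  by rewrite partialB // pFG subrr scaler0.
have [dh h0] : differentiable (half_glue F G - F) y /\
               forall v, 'd (half_glue F G - F) y v = 0.
  apply: (differentiable_dominated dd) => //.
    by rewrite -[LHS]/(G y - F y) FG subrr.
  apply: filterE => z; rewrite -[(half_glue F G - F) z]/(half_glue F G z - F z).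
  by rewrite /half_glue; case: ifP => // _; rewrite subrr normr0.
have E1 : half_glue F G = (half_glue F G - F) + F by rewrite subrK.
rewrite E1; split; first exact: differentiableD.
move=> i; rewrite /partial deriveD; [|exact: diff_derivable|exact: diff_derivable].
by rewrite [X in X + _]deriveE // h0 add0r.
Qed.

Lemma near_glue_lt F G y : lastc y < 0 -> \forall z \near y, F z = half_glue F G z.
Proof.
move=> y0; apply: filterS (open_nbhs_nbhs (conj open_lastc_lt0 y0)) => z /= z0.
by rewrite /half_glue ltW.
Qed.

Lemma near_glue_gt F G y : 0 < lastc y -> \forall z \near y, G z = half_glue F G z.
Proof.
move=> y0; apply: filterS (open_nbhs_nbhs (conj open_lastc_gt0 y0)) => z /= z0.
by rewrite /half_glue leNgt z0.
Qed.

(** Gluing commutes with partial derivatives, so the glued functions whose pieces agree to all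
    orders on the hyperplane form a class suited to [smooth_coind]. *)
Lemma glue_smooth U F G : open U -> smooth_on U F -> smooth_on U G ->
  (forall s y, U y -> lastc y = 0 ->
     foldr (@partial R R n) F s y = foldr (@partial R R n) G s y) ->
  smooth_on U (half_glue F G).
Proof.
move=> oU sF sG FG.
pose P H := exists F G, [/\ smooth_on U F, smooth_on U G,
  (forall s y, U y -> lastc y = 0 ->
     foldr (@partial R R n) F s y = foldr (@partial R R n) G s y) & H = half_glue F G].
have key H : P H -> (forall y, U y -> differentiable H y) /\
    (forall i, exists2 K, P K & forall y, U y -> partial i H y = K y).
  move=> [{}F [{}G [{}sF {}sG {}FG ->]]].
  have dF y : U y -> differentiable F y by move=> Uy; exact: smooth_on_diff sF Uy.
  have dG y : U y -> differentiable G y by move=> Uy; exact: smooth_on_diff sG Uy.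
  have gd y (Uy : U y) (y0 : lastc y = 0) := @glue_diff F G y (dF _ Uy) (dG _ Uy) y0
    (FG [::] y Uy y0) (fun i => FG [:: i] y Uy y0).
  split.
    move=> y Uy; have [y0|y0|y0] := ltgtP (lastc y) 0.
    + exact: near_eq_differentiable (near_glue_lt F G y0) (dF _ Uy).
    + exact: near_eq_differentiable (near_glue_gt F G y0) (dG _ Uy).
    + by case: (gd y Uy y0).
  move=> i; exists (half_glue (partial i F) (partial i G)).
    exists (partial i F), (partial i G); split => //.
    + exact: smooth_on_partial.
    + exact: smooth_on_partial.
    + by move=> s y Uy y0; rewrite -!foldr_rcons; exact: FG.
  move=> y Uy; rewrite {2}/half_glue; have [y0|y0|y0] := ltgtP (lastc y) 0.
  + by rewrite (near_eq_partial i (near_glue_lt F G y0)).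
  + by rewrite (near_eq_partial i (near_glue_gt F G y0)).
  + by case: (gd y Uy y0).
apply: (smooth_coind (P := P)) => //.
- by move=> H /key[].
- by move=> H i /key[_]; exact.
- by exists F, G; split.
Qed.

Definition lap f (x : E) : R := \sum_i partial i (partial i f) x.

(* [b] is the parity to first order: odd if true, even if false.  The class is
   stable under all partial derivatives, the last one changing the parity. *)
Definition boundary_class U lam (b : bool) F : Prop :=
  [/\ smooth_on U F,
      forall y, U y -> lastc y <= 0 -> lap F y = - lam * F y &
      forall y, U y -> lastc y = 0 -> if b then F y = 0 else partial lst F y = 0].

Lemma lap_partial U f y i : open U -> smooth_on U f -> U y ->
  lap (partial i f) y = partial i (lap f) y.
Proof.
move=> oU sf Uy.
have sp k : smooth_on U (partial k f) by exact: smooth_on_partial.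
rewrite (proj2 (@partial_sum R n _ _ (fun k => partial k (partial k f)) y i
  (fun k => smooth_on_diff (smooth_on_partial k (sp k)) Uy))).
apply: eq_bigr => k _.
apply: (etrans _ (@partialC R n (partial k f) U y k i oU (sp k) Uy)).
apply: near_eq_partial; apply: (near_open_eq oU _ Uy) => z Uz.
exact: (@partialC R n f U z k i oU sf Uz).
Qed.

Lemma smooth_on_lap U f : open U -> smooth_on U f -> smooth_on U (lap f).
Proof.
move=> oU sf; apply: smooth_closureP => //.
by apply: smooth_closure_sum => i _; apply: SmoothBase; do 2!apply: smooth_on_partial.
Qed.

Lemma near_open (P : E -> Prop) U y : open U -> U y -> (forall z, U z -> P z) ->
  \forall z \near y, P z.
Proof. by move=> oU Uy H; apply: filterS (open_nbhs_nbhs (conj oU Uy)) => z /H. Qed.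

Lemma boundary_class_partial U lam b F i : open U -> boundary_class U lam b F ->
  boundary_class U lam (b (+) (i == lst)) (partial i F).
Proof.
move=> oU [sF pde bd].
have sp k : smooth_on U (partial k F) by exact: smooth_on_partial.
have dF y : U y -> differentiable F y by move=> Uy; exact: smooth_on_diff sF Uy.
have dp k y : U y -> differentiable (partial k F) y.
  by move=> Uy; exact: smooth_on_diff (sp k) Uy.
split => //.
  move=> y Uy y0; rewrite (lap_partial _ oU sF Uy).
  rewrite -(partialMl (- lam) i (dF _ Uy)).
  (* The equation for F is known on the half space only; the one-sided comparison allows
     differentiating it up to the hyperplane. *)
  apply: partial_one_sided => //.
  - exact: smooth_on_diff (smooth_on_lap oU sF) Uy.
  - exact/differentiableMl/dF.
  - exact: near_open oU Uy pde.
have tang k y : U y -> b -> k != lst -> lastc y = 0 -> partial k F y = 0.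
  move=> Uy bt kl y0; apply: partial_tangential => //; first exact: dF.
  by apply: near_open oU Uy _ => z Uz z0; have := bd z Uz z0; rewrite bt.
move=> y Uy y0; case: eqVneq => [->|il]; case: (b) bd tang => bd tang /=.
(* F odd, normal derivative: the only case that uses the equation. It expresses the second normal
   derivative through F and the second tangential derivatives, which all vanish on the
   hyperplane. *)
- have := pde y Uy; rewrite y0 => /(_ (lexx _)); rewrite (bd y Uy y0) mulr0.
  rewrite /lap (bigD1 lst) //= big1 ?addr0 // => k kl.
  apply: partial_tangential => //; first exact: dp.
  by apply: near_open oU Uy _ => z Uz z0; exact: tang.
- exact: bd.
- exact: tang.
- rewrite (partialC lst i oU sF Uy); apply: partial_tangential => //.
    exact: dp.
  exact: near_open oU Uy bd.
Qed.

(** Each derivative in the last coordinate flips the parity; the condition on b and s says that the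
    resulting derivative is in the odd class, whose members vanish on the hyperplane. *)
Lemma boundary_class_foldr U lam b F s y : open U -> boundary_class U lam b F ->
  U y -> lastc y = 0 -> b (+) odd (count_mem lst s) ->
  foldr (@partial R R n) F s y = 0.
Proof.
move=> oU KF Uy y0.
have : boundary_class U lam (b (+) odd (count_mem lst s))
         (foldr (@partial R R n) F s).
  elim: s => [|i s IH] /=; first by rewrite addbF.
  have := boundary_class_partial i oU IH.
  by rewrite -addbA oddD [_ (+) (i == lst)]addbC oddb.
by move=> [_ _ /(_ y Uy y0) H] b1; move: H; rewrite b1.
Qed.

Lemma reflect_last_lastc (x : E) : lastc (reflect_last x) = - lastc x.
Proof. by rewrite /lastc mxE eqxx. Qed.

Lemma reflect_lastK : involutive (@reflect_last R n).
Proof.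
by move=> x; apply/rowP => i; rewrite !mxE; case: (i == lst); rewrite ?opprK.
Qed.

Lemma reflect_last_id (x : E) : lastc x = 0 -> reflect_last x = x.
Proof.
move=> x0; apply/rowP => i; rewrite mxE; case: eqP => // ->.
by move: x0; rewrite /lastc => ->; rewrite oppr0.
Qed.

Lemma partial_coord (x : E) i j : partial i (fun y : E => y 0 j) x = (i == j)%:R.
Proof.
have dx : differentiable (@idfun E) x by exact: ex_diff.
rewrite (@partial_entry R n 0 n idfun x 0 j i dx) /partial derive_id mxE eqxx /=.
by rewrite eq_sym.
Qed.

Lemma smooth_on_coord U i : smooth_on U (fun y : E => y 0 i).
Proof.
have H s : exists c : R, forall y, foldr (@partial R R n) (fun y : E => y 0 i) s y
   = if s is [::] then y 0 i else c.
  elim: s => [|j s [c IH]]; first by exists 0.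
  case: s IH => [|k s] IH.
    by exists (j == i)%:R => y; rewrite /= partial_coord.
  exists 0 => y; rewrite [LHS]/=.
  rewrite -[RHS](congr1 (@^~ y) (@partial_cst R n R c j)); congr (partial j _ y).
  exact/funext.
move=> s y _; have [c Hc] := H s; case: s Hc => [|j s] Hc.
  exact: differentiable_coord.
rewrite (_ : foldr _ _ _ = cst c); first exact: differentiable_cst.
exact/funext.
Qed.

Lemma reflect_last_coord (x : E) j :
  reflect_last x 0 j = (-1) ^+ (j == lst) * x 0 j.
Proof. by rewrite mxE; case: eqP; rewrite ?mulN1r ?mul1r. Qed.

Lemma reflect_last_is_linear : linear (@reflect_last R n).
Proof.
move=> a x y; apply/rowP => i; rewrite !(mxE, reflect_last_coord).
by case: (i == lst); rewrite ?expr1 ?expr0; ring.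
Qed.

Lemma reflect_lastE (x : E) : reflect_last x = x - (2 * lastc x) *: e_ lst.
Proof.
apply/rowP => i; rewrite reflect_last_coord !mxE eqxx /= /lastc.
case: (eqVneq i lst) => [->|_] /=.
  by rewrite mulr1 expr1 mulN1r; lra.
by rewrite mulr0 expr0 mul1r subr0.
Qed.

Lemma continuous_reflect_last : continuous (@reflect_last R n).
Proof.
have -> : @reflect_last R n = (fun x => x - (2 * lastc x) *: e_ lst).
  by apply/funext => x; exact: reflect_lastE.
have c2 : continuous (fun t : R => (2 * t) *: e_ lst).
  move=> t; apply: (@continuous_comp R R E ( *%R 2) (fun t : R => t *: e_ lst)).
    exact: mulrl_continuous.
  exact: scalel_continuous.
move=> x; apply: (@continuousB _ _ _ id); first exact: cvg_id.
exact: (continuous_comp (@continuous_lastc x) (@c2 _)).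
Qed.

Lemma is_diff_reflect_last (x : E) : differentiable (@reflect_last R n) x /\
  forall v, 'd (@reflect_last R n) x v = reflect_last v.
Proof.
pose sxlM := GRing.isLinear.Build _ _ _ _ _ reflect_last_is_linear.
pose L : {linear E -> E} := HB.pack (@reflect_last R n) sxlM.
have cL : continuous L by exact: continuous_reflect_last.
split; first exact: (@linear_differentiable _ _ _ L x cL).
by move=> v; rewrite (@diff_lin _ _ _ L x cL).
Qed.

Lemma partial_reflect F i (x : E) : differentiable F (reflect_last x) ->
  differentiable (F \o @reflect_last R n) x /\
  partial i (F \o @reflect_last R n) x =
    (-1) ^+ (i == lst) * partial i F (reflect_last x).
Proof.
move=> dF; have [dr rE] := is_diff_reflect_last x.
have dc := differentiable_comp dr dF.
split; first exact: dc.
rewrite (partialE i dc) (partialE i dF).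
apply: (etrans (congr1 (fun k : E -> R => k (e_ i)) (diff_comp dr dF))).
rewrite /= rE.
have -> : reflect_last (e_ i) = (-1) ^+ (i == lst) *: e_ i.
  apply/rowP => j; rewrite reflect_last_coord !mxE eqxx /=.
  by case: (eqVneq j i) => [->|]; rewrite ?mulr0.
by rewrite linearZ.
Qed.

Lemma foldr_partial_reflect U F s (x : E) : open U -> smooth_on U F ->
  U (reflect_last x) ->
  foldr (@partial R R n) (F \o @reflect_last R n) s x =
  (-1) ^+ count_mem lst s * foldr (@partial R R n) F s (reflect_last x).
Proof.
move=> oU sF; have oV : open (@reflect_last R n @^-1` U).
  by apply: open_comp => // y _; exact: continuous_reflect_last.
elim: s x => [|i s IH] x Ux; first by rewrite mul1r.
have dG := sF s _ Ux.
have [d1 p1] := partial_reflect i dG.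
rewrite /= exprD.
transitivity (partial i (fun y => (-1) ^+ count_mem lst s *
   (foldr (@partial R R n) F s \o @reflect_last R n) y) x).
  by apply: near_eq_partial; apply: near_open oV Ux _ => z; exact: IH.
by rewrite (partialMl _ i d1) p1 mulrA [X in X * _]mulrC.
Qed.

Lemma smooth_on_reflect U F : open U -> smooth_on U F ->
  smooth_on (@reflect_last R n @^-1` U) (F \o @reflect_last R n).
Proof.
move=> oU sF; have oV : open (@reflect_last R n @^-1` U).
  by apply: open_comp => // y _; exact: continuous_reflect_last.
move=> s x Ux.
have [d1 _] := partial_reflect ord0 (sF s _ Ux).
apply: (@near_eq_differentiable _ _ _
  (fun y => (-1) ^+ count_mem lst s *
     (foldr (@partial R R n) F s \o @reflect_last R n) y)).
  by apply: near_open oV Ux _ => z Uz; rewrite (foldr_partial_reflect s oU sF Uz).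
exact: differentiableMl.
Qed.

(* [F] and [G] solve the same equation on the half space and the value and the
   first normal derivative of [F] match those of the reflection of [G]; by
   parity all higher derivatives then match. *)
Lemma glue_reflect_smooth U lam F G : open U ->
  (forall y, U y -> U (reflect_last y)) ->
  smooth_on U F -> smooth_on U G ->
  (forall y, U y -> lastc y <= 0 -> lap F y = - lam * F y) ->
  (forall y, U y -> lastc y <= 0 -> lap G y = - lam * G y) ->
  (forall y, U y -> lastc y = 0 -> F y = G y) ->
  (forall y, U y -> lastc y = 0 -> partial lst F y = - partial lst G y) ->
  smooth_on U (half_glue F (G \o @reflect_last R n)).
Proof.
move=> oU Ur sF sG pF pG FG dFG.
have sGr : smooth_on U (G \o @reflect_last R n).
  by apply: smooth_on_sub (smooth_on_reflect oU sG) => y /Ur.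
apply: glue_smooth => // s y Uy y0.
rewrite (foldr_partial_reflect s oU sG (Ur _ Uy)) reflect_last_id //.
(* F + G has zero normal derivative and is even (a = 1, b false); F - G has zero values and is odd
   (a = -1, b true). The first is killed by an odd number of normal derivatives, the second by an
   even number, which is the sign produced by the reflection. *)
have comb (a : R) b : (forall z, U z -> lastc z = 0 ->
    if b then F z + a * G z = 0 else
      partial lst F z + a * partial lst G z = 0) ->
    forall s, b (+) odd (count_mem lst s) ->
    foldr (@partial R R n) F s y + a * foldr (@partial R R n) G s y = 0.
  move=> Hb s' par.
  have dF z : U z -> differentiable F z by exact: smooth_on_diff.
  pose H z := F z + a * G z.
  have fH s2 z : U z -> foldr (@partial R R n) H s2 z =
      foldr (@partial R R n) F s2 z + a * foldr (@partial R R n) G s2 z.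
    elim: s2 z => //= i s2 IH z Uz.
    have dG2 := sG s2 z Uz; have dF2 := sF s2 z Uz.
    rewrite (near_eq_partial i (near_open_eq oU IH Uz)) partialD //.
      by rewrite partialMl.
    exact: differentiableMl.
  rewrite -fH //; apply: (@boundary_class_foldr U lam b) => //.
  split.
  - move=> s2 z Uz; apply: (@near_eq_differentiable _ _ _ (fun z =>
      foldr (@partial R R n) F s2 z + a * foldr (@partial R R n) G s2 z)).
      by apply: near_open oU Uz _ => w Uw; rewrite fH.
    apply: differentiableD; first exact: sF.
    exact/differentiableMl/sG.
  - move=> z Uz z0.
    have -> : lap H z = lap F z + a * lap G z.
      rewrite /lap mulr_sumr -big_split; apply: eq_bigr => i _.
      exact: (fH [:: i; i] z Uz).
    by rewrite pF // pG // /H; ring.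
  - move=> z Uz z0; have := Hb z Uz z0; case: (b) => //.
    by rewrite -(fH [:: lst] z Uz).
case: (boolP (odd (count_mem lst s))) => par.
  have := comb 1 false _ s par; rewrite mul1r -signr_odd par expr1 mulN1r.
  move=> H; apply/eqP; rewrite -subr_eq0 opprK; apply/eqP; apply: H.
  by move=> z Uz z0; rewrite mul1r dFG // addNr.
have := comb (-1) true _ s par; rewrite -signr_odd (negbTE par) expr0 !mul1r mulN1r.
move=> H; apply/eqP; rewrite -subr_eq0; apply/eqP; apply: H.
by move=> z Uz z0; rewrite mulN1r FG // subrr.
Qed.

Lemma glue_zero_smooth U lam F : open U -> smooth_on U F ->
  (forall y, U y -> lastc y <= 0 -> lap F y = - lam * F y) ->
  (forall y, U y -> lastc y = 0 -> F y = 0) ->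
  (forall y, U y -> lastc y = 0 -> partial lst F y = 0) ->
  smooth_on U (half_glue F (cst 0)).
Proof.
move=> oU sF pF F0 dF0; apply: glue_smooth => //; first exact: smooth_on_cst.
move=> s y Uy y0.
have -> : foldr (@partial R R n) (cst 0) s = cst 0.
  by elim: s => //= i s ->; rewrite partial_cst.
(* With zero values and zero normal derivative, F belongs to both classes; the parity is chosen to
   fit the given derivative. *)
apply: (@boundary_class_foldr U lam (~~ odd (count_mem lst s))) => //; last first.
  by case: odd.
by split => // z Uz z0; case: ifP => _; [exact: F0|exact: dF0].
Qed.

End Gluing.

(** * Unique continuation *)

Section MaximumPrinciple.
Context {R : realType} {n : nat}.
Local Notation E := 'rV[R]_n.+1.
Local Notation e_ i := (delta_mx 0 i : E).
Local Notation lst := (ord_max : 'I_n.+1).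
Implicit Types (f g F G : E -> R) (U : set E).

(** The first derivative vanishes at the maximum. A positive second derivative would stay positive
    nearby, and the mean value theorem applied to g and then to [partial i g] would give a larger
    value. *)
Lemma second_partial_at_max g U z i (delta : R) :
  open U -> smooth_on U g -> U z -> 0 < delta ->
  (forall t : R, `|t| < delta -> U (z + t *: e_ i)) ->
  (forall t : R, `|t| < delta -> g (z + t *: e_ i) <= g z) ->
  partial i (partial i g) z <= 0.
Proof.
move=> oU sg Uz d0 Ud gmax; rewrite leNgt; apply/negP => pos.
pose gi := partial i g.
have sgi : smooth_on U gi by exact: smooth_on_partial.
have line (f : E -> R) (t : R) : smooth_on U f -> `|t| < delta ->
    is_derive t 1 (fun t => f (z + t *: e_ i)) (partial i f (z + t *: e_ i)).
  move=> sf td; apply: is_derive_line; apply: diff_derivable.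
  exact: smooth_on_diff sf (Ud _ td).
have z0 : z + 0 *: e_ i = z by rewrite scale0r addr0.
have d00 : `|0 : R| < delta by rewrite normr0.
have gi0 : gi z = 0.
  have : is_derive (0 : R) 1 (fun t => g (z + t *: e_ i)) 0.
    apply: (@derive1_at_max R _ (- delta) delta).
    - by rewrite ge0_cp // ltW.
    - move=> t; rewrite in_itv /= -ltr_norml => td.
      by case: (line g t sg td).
    - by rewrite in_itv /= oppr_lt0 d0.
    - move=> t; rewrite in_itv /= -ltr_norml z0; exact: gmax.
  move=> H; have := line g 0 sg d00; rewrite z0 => H'.
  by rewrite /gi -(@derive_val _ _ _ _ _ _ _ H') (@derive_val _ _ _ _ _ _ _ H).
have cp : {for z, continuous (partial i gi)}.
  by apply: smooth_on_continuous Uz; exact: smooth_on_partial.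
have Np : \forall y \near z, 0 < partial i gi y by exact: (cvgr_gt _ cp _ pos).
have [r /= r0 Hr] := (nbhs_normP (0 : R) _).1 (half_line (e_ i) Np).
have Hr' (u : R) : `|u| < r -> 0 < partial i gi (z + u *: e_ i).
  by move=> ur; rewrite (addrC z); apply: Hr; rewrite /ball_ /= sub0r normrN.
pose h := Num.min r delta / 2.
have h0 : 0 < h by rewrite divr_gt0 // lt_min r0 d0.
have hr : h < r.
  by rewrite /h; apply: (@lt_le_trans _ _ (Num.min r delta));
    [rewrite ltr_pdivrMr // ltr_pMr ?lt_min ?r0 ?d0 // ltr1n | rewrite ge_min lexx].
have hd : h < delta.
  by rewrite /h; apply: (@lt_le_trans _ _ (Num.min r delta));
    [rewrite ltr_pdivrMr // ltr_pMr ?lt_min ?r0 ?d0 // ltr1n | rewrite ge_min lexx orbT].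
have inU (t : R) : 0 <= t <= h -> U (z + t *: e_ i).
  move=> /andP[t0 th]; apply: Ud; rewrite ger0_norm //; exact: le_lt_trans th hd.
have [t /andP[t0 th] gt] := @MVT_line R n g z i h h0
  (fun t th => smooth_on_diff sg (inU t th)).
have inU' (s : R) : 0 <= s <= t -> U (z + s *: e_ i).
  by move=> /andP[s0 st]; apply: inU; rewrite s0 (le_trans st) // ltW.
have [s /andP[s0 st]] := @MVT_line R n gi z i t t0
  (fun s st => smooth_on_diff sgi (inU' s st)).
rewrite gi0 subr0 => gis.
have : 0 < gi (z + t *: e_ i).
  have sr : `|s| < r by rewrite gtr0_norm // (lt_trans st) // (lt_trans th).
  rewrite gis; exact: (mulr_gt0 t0 (Hr' s sr)).
move=> git; have : 0 < g (z + h *: e_ i) - g z.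
  rewrite gt; exact: (mulr_gt0 h0 git).
have hn : `|h| < delta by rewrite gtr0_norm.
by rewrite subr_gt0 ltNge gmax.
Qed.

(** At a maximum point around which D contains a segment in every coordinate direction, all second
    derivatives are nonpositive, against the strict inequality for [lap g]. Asking for segments only
    avoids describing the topological boundary of the box to which this is applied. *)
Lemma maximum_principle g U (D : set E) : open U -> smooth_on U g -> D `<=` U ->
  compact D ->
  (forall z, D z -> 0 < lap g z) ->
  (forall z, D z -> g z <= 0 \/ forall i, exists2 delta : R, 0 < delta &
     forall t : R, `|t| < delta -> D (z + t *: e_ i)) ->
  forall z, D z -> g z <= 0.
Proof.
move=> oU sg DU cD lapg bd z Dz.
have cg : {within D, continuous g}.
  apply: continuous_in_subspaceT => y; rewrite inE => Dy.
  exact: smooth_on_continuous sg (DU _ Dy).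
have [c cD' cmax] := EVT_max_rV (ex_intro _ z Dz) cD cg.
have Dc : D c by rewrite inE in cD'.
apply: le_trans (cmax z _) _; first by rewrite inE.
case: (bd c Dc) => // int.
have := lapg c Dc; rewrite ltNge => /negP; case.
apply: sumr_le0 => i _; have [delta d0 Hd] := int i.
apply: (second_partial_at_max oU sg (DU _ Dc) d0).
  by move=> t td; apply/DU/Hd.
by move=> t td; apply: cmax; rewrite inE; exact: Hd.
Qed.

Lemma partial_le_slope f U x i a d : open U -> smooth_on U f -> U x -> 0 < d ->
  (forall t : R, 0 < t <= d -> f (x + t *: e_ i) - f x <= t * a) ->
  partial i f x <= a.
Proof.
move=> oU sf Ux d0 fa; rewrite leNgt; apply/negP => pos.
have cp : {for x, continuous (partial i f)}.
  by apply: smooth_on_continuous Ux; exact: smooth_on_partial.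
have Np : \forall y \near x, a < partial i f y /\ U y.
  by apply: filterI; [exact: (cvgr_gt _ cp _ pos)|exact: open_nbhs_nbhs].
have [r /= r0 Hr] := (nbhs_normP (0 : R) _).1 (half_line (e_ i) Np).
have Hr' (u : R) : `|u| < r -> a < partial i f (x + u *: e_ i) /\ U (x + u *: e_ i).
  by move=> ur; rewrite (addrC x); apply: Hr; rewrite /ball_ /= sub0r normrN.
pose h := Num.min (r / 2) d.
have h0 : 0 < h by rewrite lt_min d0 divr_gt0.
have hd : h <= d by rewrite ge_min lexx orbT.
have hr : h < r.
  by apply: (@le_lt_trans _ _ (r / 2)); [rewrite ge_min lexx|lra].
have dif (t : R) : 0 <= t <= h -> differentiable f (x + t *: e_ i).
  move=> /andP[t0 th].
  have tr : `|t| < r by rewrite ger0_norm // (le_lt_trans th).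
  exact: smooth_on_diff sf (proj2 (Hr' t tr)).
have [t /andP[t0 th] e] := @MVT_line R n f x i h h0 dif.
have tr : `|t| < r by rewrite gtr0_norm // (lt_trans th).
have h0d : 0 < h <= d by rewrite h0.
have := fa h h0d; rewrite e ler_pM2l // leNgt.
by rewrite (proj1 (Hr' t tr)).
Qed.

Lemma quadratic_smooth (a b : 'I_n.+1 -> R) U : open U ->
  smooth_on U (fun z : E => \sum_j (a j * z 0 j + b j * (z 0 j * z 0 j))).
Proof.
move=> oU; apply: smooth_closureP => //; apply: smooth_closure_sum => j _.
have c : smooth_closure U (fun z : E => z 0 j) by apply/SmoothBase/smooth_on_coord.
apply: SmoothAdd; apply: SmoothMul; try exact: smooth_closure_cst => //.
  exact: c.
exact: SmoothMul.
Qed.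

Lemma partial_quadratic (a b : 'I_n.+1 -> R) i (x : E) :
  partial i (fun z : E => \sum_j (a j * z 0 j + b j * (z 0 j * z 0 j))) x =
  a i + 2 * b i * x 0 i.
Proof.
have dc j (y : E) : differentiable (fun z : E => z 0 j) y by exact: differentiable_coord.
have dq j (y : E) : differentiable (fun z : E => z 0 j * z 0 j) y by exact: differentiableM.
have ds j : differentiable (fun z : E => a j * z 0 j + b j * (z 0 j * z 0 j)) x.
  by apply: differentiableD; exact: differentiableMl.
rewrite (proj2 (partial_sum _ i ds)) (bigD1 i) //= big1 => [|j ji].
  rewrite addr0 partialD; [|exact: differentiableMl|exact: differentiableMl].
  rewrite !partialMl // partialM // partial_coord eqxx mulr1n; ring.
rewrite partialD; [|exact: differentiableMl|exact: differentiableMl].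
rewrite !partialMl // partialM // partial_coord eq_sym (negbTE ji) mulr0n; ring.
Qed.

Lemma lap_quadratic (a b : 'I_n.+1 -> R) (x : E) :
  lap (fun z : E => \sum_j (a j * z 0 j + b j * (z 0 j * z 0 j))) x =
  \sum_j 2 * b j.
Proof.
apply: eq_bigr => i _.
have -> : partial i (fun z : E => \sum_j (a j * z 0 j + b j * (z 0 j * z 0 j))) =
          (fun z : E => a i + 2 * b i * z 0 i).
  by apply/funext => z; exact: partial_quadratic.
have dc : differentiable (fun z : E => z 0 i) x by exact: differentiable_coord.
rewrite partialD; [|exact: differentiable_cst|exact: differentiableMl].
by rewrite partial_cst partialMl // partial_coord eqxx add0r mulr1.
Qed.

Lemma lapD U F G a x : open U -> U x -> smooth_on U F -> smooth_on U G ->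
  lap (fun z => F z + a * G z) x = lap F x + a * lap G x.
Proof.
move=> oU Ux sF sG.
rewrite /lap mulr_sumr -big_split; apply: eq_bigr => i _ /=.
have H z : U z -> partial i (fun z => F z + a * G z) z =
    partial i F z + a * partial i G z.
  move=> Uz; have dG := smooth_on_diff sG Uz; have dF := smooth_on_diff sF Uz.
  by rewrite partialD ?partialMl //; exact: differentiableMl.
rewrite (near_eq_partial i (near_open_eq oU H Ux)).
have dG := smooth_on_diff (smooth_on_partial i sG) Ux.
have dF := smooth_on_diff (smooth_on_partial i sF) Ux.
by rewrite partialD ?partialMl //; exact: differentiableMl.
Qed.

Lemma smooth_onD U F G a : open U -> smooth_on U F -> smooth_on U G ->
  smooth_on U (fun z => F z + a * G z).
Proof.
move=> oU sF sG; apply: smooth_closureP => //; apply: SmoothAdd.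
  exact: SmoothBase.
by apply: SmoothMul; [exact: smooth_closure_cst|exact: SmoothBase].
Qed.

Lemma lap_reflect U F x : open U -> U (reflect_last x) -> smooth_on U F ->
  lap (F \o @reflect_last R n) x = lap F (reflect_last x).
Proof.
move=> oU Ux sF; apply: eq_bigr => i _.
have := @foldr_partial_reflect R n U F [:: i; i] x oU sF Ux.
by rewrite /= addn0 addnn -signr_odd odd_double expr0 mul1r.
Qed.

End MaximumPrinciple.

(** * Interior gradient estimate by a barrier *)

Section GradientEstimate.
Context {R : realType} {n : nat}.
Local Notation E := 'rV[R]_n.+1.
Local Notation e_ i := (delta_mx 0 i : E).
Local Notation lst := (ord_max : 'I_n.+1).
Local Notation N := (n.+1%:R : R).
Implicit Types (f g F G : E -> R) (U : set E).

(** With z_d the last coordinate, the barrier is P/d^2 times the sum of the tangential squares, plus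
    P z_d / d, plus (n P/d^2 + c P/2) z_d (d - z_d). The first term reaches P on the lateral sides
    of the half box and the second on its top. The third is nonnegative and adjusts the Laplacian:
    its n P/d^2 cancels the tangential squares, and c P/2 leaves - c P. *)
Definition barrier_lin (P c d : R) (j : 'I_n.+1) : R :=
  if j == lst then P * N / d + c * P * d / 2 else 0.
Definition barrier_sq (P c d : R) (j : 'I_n.+1) : R :=
  if j == lst then - (P * n%:R / d ^+ 2 + c * P / 2) else P / d ^+ 2.
Definition barrier (P c d : R) (z : E) : R :=
  \sum_j (barrier_lin P c d j * z 0 j + barrier_sq P c d j * (z 0 j * z 0 j)).

Lemma barrierE P c d z : barrier P c d z =
  \sum_(j | j != lst) (P / d ^+ 2 * (z 0 j * z 0 j)) +
  (barrier_lin P c d lst * lastc z + barrier_sq P c d lst * (lastc z * lastc z)).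
Proof.
rewrite /barrier (bigD1 lst) //= addrC; congr (_ + _).
apply: eq_bigr => j /negbTE jl.
by rewrite /barrier_lin /barrier_sq jl mul0r add0r.
Qed.

Lemma sum_barrier_sq P c d : 0 < d ->
  \sum_(j : 'I_n.+1) 2 * barrier_sq P c d j = - (c * P).
Proof.
move=> d0; rewrite (bigD1 lst) //=.
rewrite (eq_bigr (fun=> 2 * (P / d ^+ 2))); last first.
  by move=> j /negbTE jl; rewrite /barrier_sq jl.
rewrite sumr_const /barrier_sq eqxx.
have -> : #|[pred j : 'I_n.+1 | j != lst]| = n.
  by rewrite cardC1 card_ord.
by rewrite -mulr_natr; lra.
Qed.

(** For 0 <= z_d <= d the summands of the barrier are nonnegative, so each of them alone is a lower
    bound. *)
Lemma barrier_lower P c d z : 0 < P -> 0 < c -> 0 < d -> 0 <= lastc z <= d ->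
  0 <= barrier P c d z /\ P / d * lastc z <= barrier P c d z /\
  forall i, i != lst -> P / d ^+ 2 * (z 0 i * z 0 i) <= barrier P c d z.
Proof.
move=> P0 c0 d0 /andP[z0 zd].
have dn0 : d != 0 by rewrite gt_eqF.
have Pd0 : 0 < P / d by rewrite divr_gt0.
have lastpart : P / d * lastc z <=
  barrier_lin P c d lst * lastc z + barrier_sq P c d lst * (lastc z * lastc z).
  rewrite mulrA -mulrDl ler_wpM2r // /barrier_lin /barrier_sq eqxx -subr_ge0.
  have -> : P * N / d + c * P * d / 2 +
       - (P * n%:R / d ^+ 2 + c * P / 2) * lastc z - P / d =
     P * n%:R / d ^+ 2 * (d - lastc z) + c * P / 2 * (d - lastc z).
    by rewrite -[n.+1%:R]/((n.+1)%:R) -natr1; field.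
  have dz : 0 <= d - lastc z by rewrite subr_ge0.
  have cP0 : 0 <= c * P by exact: mulr_ge0 (ltW c0) (ltW P0).
  have Pn0 : 0 <= P * n%:R by exact: mulr_ge0 (ltW P0) (ler0n _ _).
  have d20 : 0 <= d ^+ 2 by exact: exprn_ge0 (ltW d0).
  have cP2 : 0 <= c * P / 2 by lra.
  exact: addr_ge0 (mulr_ge0 (divr_ge0 Pn0 d20) dz) (mulr_ge0 cP2 dz).
have sq j : 0 <= P / d ^+ 2 * (z 0 j * z 0 j).
  have d20 : 0 <= d ^+ 2 by exact: exprn_ge0 (ltW d0).
  have zz : 0 <= z 0 j * z 0 j by rewrite -expr2 sqr_ge0.
  exact: mulr_ge0 (divr_ge0 (ltW P0) d20) zz.
have sums : 0 <= \sum_(j | j != lst) (P / d ^+ 2 * (z 0 j * z 0 j)).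
  by apply: sumr_ge0 => j _.
have last0 : 0 <= P / d * lastc z by rewrite mulr_ge0 // ltW.
rewrite barrierE; split; first by lra.
split; first by lra.
move=> i il; rewrite (bigD1 i) //=.
have : 0 <= \sum_(j < n.+1 | (j != lst) && (j != i)) (P / d ^+ 2 * (z 0 j * z 0 j)).
  by apply: sumr_ge0 => j _.
lra.
Qed.

Definition half_box (d : R) : set E :=
  [set z | forall i, z 0 i \in (if i == lst then `[0, d] else `[- d, d])].

Lemma half_box_compact d : compact (half_box d).
Proof.
pose A i : set R := [set` if i == lst then `[0, d] else `[- d, d]].
rewrite (_ : half_box d = [set z | forall i, A i (z ord0 i)]).
  by apply: rV_compact => i; rewrite /A; case: eqP => _; exact: segment_compact.
by [].
Qed.

Lemma half_boxP d z : half_box d z <->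
  0 <= lastc z <= d /\ forall i, i != lst -> `|z 0 i| <= d.
Proof.
split=> [H|[H1 H2] i].
  split; first by have := H lst; rewrite eqxx in_itv.
  by move=> i /negbTE il; have := H i; rewrite il in_itv ler_norml.
case: eqVneq => [->|il]; rewrite in_itv //=.
by rewrite -ler_norml; exact: H2.
Qed.

Lemma half_box_line d z i : half_box d z -> 0 < lastc z < d ->
  (forall i, i != lst -> `|z 0 i| < d) ->
  exists2 delta : R, 0 < delta &
     forall t : R, `|t| < delta -> half_box d (z + t *: e_ i).
Proof.
move=> Dz /andP[z0 zd] zi; have [il|il] := eqVneq i lst.
  exists (Num.min (lastc z) (d - lastc z)).
    by rewrite lt_min z0 subr_gt0.
  move=> t; rewrite lt_min !ltr_norml => /andP[/andP[t1 t2] /andP[t3 t4]].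
  apply/half_boxP; rewrite lastcD lastcZ lastc_delta il eqxx mulr1; split.
    by apply/andP; split; lra.
  move=> j jl; rewrite !mxE eqxx (negbTE jl) mulr0 addr0; exact/ltW/zi.
exists (d - `|z 0 i|); first by rewrite subr_gt0 zi.
move=> t td; apply/half_boxP.
rewrite lastcD lastcZ lastc_delta (negbTE il) mulr0 addr0; split.
  by rewrite !ltW.
move=> j jl; rewrite !mxE eqxx /=; case: eqP => [->|_]; last first.
  by rewrite mulr0 addr0; exact/ltW/zi.
rewrite mulr1; apply: le_trans (ler_normD _ _) _.
by move: td; lra.
Qed.

(* The comparison function is that of Gilbarg and Trudinger, (3.16), applied to
   the part of f which is odd in the last coordinate. *)
Lemma gradient_estimate0 U f (lam M d : R) : open U -> smooth_on U f ->
  0 < d -> 0 < M ->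
  (forall z : E, (forall i, `|z 0 i| <= d) -> U z /\ `|f z| <= M) ->
  (forall z, U z -> lap f z = - lam * f z) ->
  `|partial lst f 0| <= (N / d + d * (`|lam| + 1) / 2) * M.
Proof.
move=> oU sf d0 M0 HU pde.
(* P bounds the difference W of f and its reflection. Then lap W is at most |lam| P in absolute
   value, and the summand 1 in c makes the comparison with lap of the barrier strict. *)
pose c : R := `|lam| + 1; pose P : R := 2 * M.
have c0 : 0 < c by rewrite /c; have := normr_ge0 lam; lra.
have P0 : 0 < P by rewrite /P; lra.
pose V := U `&` (@reflect_last R n @^-1` U).
have oV : open V.
  apply: openI => //; apply: open_comp => // x _; exact: continuous_reflect_last.
have sfV : smooth_on V f by apply: smooth_on_sub sf => z [].
have srV : smooth_on V (f \o @reflect_last R n).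
  by apply: smooth_on_sub (smooth_on_reflect oU sf) => z [].
pose W (z : E) : R := f z + -1 * (f \o @reflect_last R n) z.
have sW : smooth_on V W by exact: smooth_onD.
have lapW z : V z -> lap W z = - lam * W z.
  move=> [Uz Urz]; rewrite (lapD (-1) oV (conj Uz Urz) sfV srV).
  by rewrite (lap_reflect oU Urz sf) !pde // /W /=; ring.
have inV z : half_box d z -> V z /\ `|W z| <= P.
  move=> /half_boxP[/andP[z0 zd] zi].
  have zn i : `|z 0 i| <= d.
    case: (eqVneq i lst) => [->|il]; last exact: zi.
    by rewrite ger0_norm.
  have rn i : `|reflect_last z 0 i| <= d.
    by rewrite reflect_last_coord normrM normrX normrN1 expr1n mul1r.
  have [Uz fz] := HU z zn; have [Ur fr] := HU _ rn; split; first by split.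
  rewrite /W mulN1r /= /P; apply: le_trans (ler_normB _ _) _; lra.
have sB : smooth_on V (barrier P c d) by exact: quadratic_smooth.
have lapB z : lap (barrier P c d) z = - (c * P).
  by rewrite /barrier lap_quadratic sum_barrier_sq.
have cmp (s : R) : `|s| = 1 -> forall z, half_box d z -> s * W z <= barrier P c d z.
  move=> s1; pose g (z : E) : R := - barrier P c d z + s * W z.
  have sNB : smooth_on V (fun z => - barrier P c d z).
    apply: smooth_closureP => //.
    rewrite (_ : (fun _ => _) = (fun z => -1 * barrier P c d z)).
      by apply: SmoothMul; [exact: smooth_closure_cst|exact: SmoothBase].
    by apply/funext => z; rewrite mulN1r.
  have sg : smooth_on V g by exact: smooth_onD.
  suff H z : half_box d z -> g z <= 0.
    by move=> z /H; rewrite /g; lra.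
  apply: (maximum_principle oV sg) => //.
  - by move=> {}z /inV[].
  - exact: half_box_compact.
  - move=> {}z Dz; have [Vz Wz] := inV z Dz.
    have -> : lap g z = c * P + s * lap W z.
      rewrite (lapD s oV Vz sNB sW); congr (_ + _).
      have -> : (fun z => - barrier P c d z) = (fun z => 0 + -1 * barrier P c d z).
        by apply/funext => y; rewrite mulN1r add0r.
      rewrite (@lapD R n V (cst 0) (barrier P c d)) // ?lapB; last exact: smooth_on_cst.
      rewrite /lap big1 ?add0r; first by ring.
      by move=> i _; rewrite !partial_cst.
    rewrite lapW //; have : `|s * (- lam * W z)| <= `|lam| * P.
      by rewrite normrM s1 mul1r normrM normrN ler_wpM2l.
    rewrite ler_norml => /andP[h1 _].
    by rewrite /c mulrDl mul1r; move: h1; set q := _ * (_ * _); lra.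
  move=> {}z Dz; have [Vz Wz] := inV z Dz.
  have [/andP[z0 zd] zi] := (half_boxP d z).1 Dz.
  have [B0 [Bl Bi]] : 0 <= barrier P c d z /\ P / d * lastc z <= barrier P c d z /\
     forall i, i != lst -> P / d ^+ 2 * (z 0 i * z 0 i) <= barrier P c d z.
    by apply: barrier_lower => //; rewrite z0.
  have sWz : s * W z <= P.
    by apply: le_trans (ler_norm _) _; rewrite normrM s1 mul1r.
  have dn0 : d != 0 by rewrite gt_eqF.
  (* On the bottom W vanishes by oddness; on the top and on the lateral sides the barrier is at
     least P. All other points have room in every coordinate direction. *)
  have [zl0|zl0] := eqVneq (lastc z) 0.
    left; rewrite /g /W /= reflect_last_id // mulN1r subrr mulr0; lra.
  have [zld|zld] := eqVneq (lastc z) d.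
    left; rewrite /g; move: Bl; rewrite zld divfK //; lra.
  have [[i il zid]|noti] := pselect (exists2 i, i != lst & `|z 0 i| = d).
    left; rewrite /g; have := Bi i il.
    have -> : z 0 i * z 0 i = d ^+ 2 by rewrite -zid real_normK ?num_real // expr2.
    by rewrite divfK ?expf_neq0 //; lra.
  right => i; apply: half_box_line => //.
    by rewrite !lt_neqAle z0 zd eq_sym zl0 zld.
  move=> j jl; rewrite lt_neqAle zi // andbT; apply/eqP => zj.
  by apply: noti; exists j.
have V0 : V 0.
  have /inV[] // : half_box d 0.
  apply/half_boxP; rewrite /lastc mxE lexx ltW //; split => // i _.
  by rewrite mxE normr0 ltW.
have r0 : reflect_last (0 : E) = 0.
  by apply: reflect_last_id; rewrite /lastc mxE.
have dW : partial lst W 0 = 2 * partial lst f 0.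
  have df : differentiable f 0 by exact: smooth_on_diff sfV V0.
  have df' : differentiable f (reflect_last 0) by rewrite r0.
  have [dr pr] := partial_reflect lst df'.
  rewrite /W (partialD lst df (differentiableMl (-1) dr)).
  by rewrite (partialMl (-1) lst dr) pr r0 eqxx expr1; ring.
(* Both W and the barrier vanish at 0. Along the last axis the barrier lies below its linear part,
   because its quadratic coefficient is nonpositive. *)
have slope (s : R) : `|s| = 1 -> s * partial lst W 0 <= barrier_lin P c d lst.
  move=> s1; rewrite -partialMl; last exact: smooth_on_diff sW V0.
  apply: (@partial_le_slope R n (fun z => s * W z) V 0 lst _ d) => //.
    apply: smooth_closureP => //.
    by apply: SmoothMul; [exact: smooth_closure_cst|exact: SmoothBase].
  move=> t /andP[t0 td]; rewrite add0r.
  have -> : W 0 = 0 by rewrite /W /= r0 mulN1r subrr.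
  rewrite mulr0 subr0.
  have lt : lastc (t *: e_ lst) = t by rewrite lastcZ lastc_delta eqxx mulr1.
  apply: le_trans (cmp s s1 _ _) _.
    apply/half_boxP; rewrite lt td ltW //; split => // i il.
    by rewrite !mxE eqxx /= (negbTE il) mulr0 normr0 ltW.
  rewrite barrierE lt big1 ?add0r; last first.
    by move=> i il; rewrite !mxE eqxx /= (negbTE il) !mulr0.
  rewrite mulrC gerDl.
  have cP0 : 0 <= c * P by exact: mulr_ge0 (ltW c0) (ltW P0).
  have Pn0 : 0 <= P * n%:R by exact: mulr_ge0 (ltW P0) (ler0n _ _).
  have d20 : 0 <= d ^+ 2 by exact: exprn_ge0 (ltW d0).
  have Pd0 := divr_ge0 Pn0 d20.
  have b0 : barrier_sq P c d lst <= 0 by rewrite /barrier_sq eqxx; lra.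
  exact: mulr_le0_ge0 b0 (mulr_ge0 (ltW t0) (ltW t0)).
have h1 := slope 1 (normr1 _).
have h2 := slope (-1) (normrN1 _).
have bl : barrier_lin P c d lst = 2 * ((N / d + d * c / 2) * M).
  by rewrite /barrier_lin eqxx /P; field; rewrite gt_eqF.
rewrite -/c; move: h1 h2; rewrite bl dW mul1r mulN1r; set q := _ * M => h1 h2.
by rewrite ler_norml; apply/andP; split; lra.
Qed.

End GradientEstimate.

(** The product (2m)(2m-1)...(m+1) has m factors above m and equals binomial(2m, m) m!; the binomial
    coefficient is one term of (1 + 1)^(2m). *)
Lemma leq_expn_fact (m : nat) : (m ^ m <= 4 ^ m * m`!)%N.
Proof.
have h1 : (m ^ m <= (m + m) ^_ m)%N.
  rewrite ffact_prod; have -> : (m ^ m)%N = (\prod_(i < m) m)%N.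
    by rewrite prod_nat_const card_ord.
  apply: leq_prod => i _.
  by rewrite -addnBA ?leq_addr // ltnW.
apply: leq_trans h1 _; rewrite -bin_ffact leq_mul2r; apply/orP; right.
rewrite -[4%N]/(2 ^ 2)%N -expnM mul2n -addnn.
have := expnDn 1 1 (m + m); rewrite addn1 => ->.
have mm : (m < (m + m).+1)%N by rewrite ltnS leq_addr.
by rewrite (bigD1 (Ordinal mm)) //= !exp1n !muln1 leq_addr.
Qed.

(** * Taylor's estimate with vanishing initial data *)

Section Taylor.
Context {R : realType}.

Lemma is_derive_powfact (A s : R) m :
  is_derive s 1 (fun s : R => A * s ^+ m.+1 / m.+1`!%:R) (A * s ^+ m / m`!%:R).
Proof.
have H : is_derive s 1 (fun s : R => s ^+ m.+1) (m.+1%:R * s ^+ m).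
  apply: DeriveDef; first exact: exprn_derivable.
  by rewrite exp_derive [LHS]mulr1.
have -> : (fun s : R => A * s ^+ m.+1 / m.+1`!%:R) =
    (A / m.+1`!%:R) \*: (fun s : R => s ^+ m.+1).
  by apply/funext => u; rewrite /= [RHS]mulrAC.
apply: is_derive_eq; rewrite -[_ *: _]/(A / m.+1`!%:R * (m.+1%:R * s ^+ m)) factS natrM.
have m0 : (m`!%:R : R) != 0 by rewrite pnatr_eq0 -lt0n fact_gt0.
have m1 : (m.+1%:R : R) != 0 by rewrite pnatr_eq0.
have gen (a b p : R) : a != 0 -> b != 0 -> A / (b * a) * (b * p) = A * p / a.
  by move=> a0 b0; field; rewrite a0 b0.
exact: gen.
Qed.

(** Induction on m with phi shifted: the bound for phi 1 makes a phi 0 - A s^(m+1)/(m+1)!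
    nonincreasing for a = 1 and a = -1, and this function starts at 0. *)
Lemma taylor_zero (phi : nat -> R -> R) (A h : R) m :
  (forall j s, (j < m)%N -> 0 <= s <= h -> is_derive s 1 (phi j) (phi j.+1 s)) ->
  (forall j, (j < m)%N -> phi j 0 = 0) ->
  (forall s, 0 <= s <= h -> `|phi m s| <= A) ->
  forall s, 0 <= s <= h -> `|phi 0%N s| <= A * s ^+ m / m`!%:R.
Proof.
elim: m phi => [|m IH] phi dphi phi0 phim s sh.
  by rewrite expr0 mulr1 fact0 divr1; exact: phim.
have {IH} IH := IH (fun j => phi j.+1) (fun j s jm => dphi j.+1 s jm)
  (fun j jm => phi0 j.+1 jm) phim.
have key (a : R) : `|a| = 1 -> a * phi 0%N s <= A * s ^+ m.+1 / m.+1`!%:R.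
  move=> a1.
  pose G := a \*: phi 0%N - (fun s : R => A * s ^+ m.+1 / m.+1`!%:R).
  have dG u : 0 <= u <= h -> is_derive u 1 G (a *: phi 1%N u - A * u ^+ m / m`!%:R).
    move=> uh; apply: is_deriveB; last exact: is_derive_powfact.
    by have := dphi 0%N u isT uh; exact: is_deriveZ.
  have inh u : u \in `[0, s] -> 0 <= u <= h.
    rewrite in_itv /= => /andP[u0 us]; rewrite u0 (le_trans us) //.
    by case/andP: sh.
  have s0 : 0 <= s by case/andP: sh.
  have [||u us e] := @MVT_segment R G (fun u => a *: phi 1%N u - A * u ^+ m / m`!%:R) 0 s s0.
  - move=> u us; apply: dG; apply: inh; exact: subset_itv_oo_cc us.
  - apply: derivable_within_continuous => u us; by case: (dG u (inh u us)).
  have G0 : G 0 = 0.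
    rewrite -[LHS]/(a * phi 0%N 0 - A * 0 ^+ m.+1 / m.+1`!%:R).
    by rewrite phi0 // expr0n /= !mulr0 mul0r subr0.
  rewrite -subr_le0 -[leLHS]/(G s) -[G s]subr0 -{1}G0 e subr0.
  apply: mulr_le0_ge0 => //; rewrite subr_le0.
  apply: le_trans (ler_norm _) _; rewrite normrM a1 mul1r; exact/IH/inh.
rewrite ler_norml; apply/andP; split.
  by have := key (-1) (normrN1 _); rewrite mulN1r lerNl.
by have := key 1 (normr1 _); rewrite mul1r.
Qed.

End Taylor.

Section UniqueContinuation.
Context {R : realType} {n : nat}.
Local Notation E := 'rV[R]_n.+1.
Local Notation e_ i := (delta_mx 0 i : E).
Local Notation lst := (ord_max : 'I_n.+1).
Local Notation N := (n.+1%:R : R).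
Implicit Types (f g F G : E -> R) (U : set E).

Lemma open_shift U (x : E) : open U -> open [set z | U (z + x)].
Proof.
move=> oU; apply: (@open_comp _ _ (fun z : E => z + x) U) => // z _.
by apply: (@continuousD _ _ _ id (cst x)); [exact: cvg_id|exact: cst_continuous].
Qed.

Lemma smooth_on_shift U f (x : E) : smooth_on U f ->
  smooth_on [set z | U (z + x)] (fun z => f (z + x)).
Proof.
move=> sf s y Uy; rewrite foldr_partial_shift; apply: differentiable_shift.
exact: sf.
Qed.

Lemma lap_shift f (x y : E) : lap (fun z => f (z + x)) y = lap f (y + x).
Proof.
apply: eq_bigr => i _.
by have := congr1 (@^~ y) (foldr_partial_shift f x [:: i; i]).
Qed.

Lemma gradient_estimate U f (lam M d : R) (x : E) : open U -> smooth_on U f ->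
  0 < d -> 0 < M ->
  (forall z : E, (forall i, `|z 0 i - x 0 i| <= d) -> U z /\ `|f z| <= M) ->
  (forall z, U z -> lap f z = - lam * f z) ->
  `|partial lst f x| <= (N / d + d * (`|lam| + 1) / 2) * M.
Proof.
move=> oU sf d0 M0 HU pde.
have H := @gradient_estimate0 R n [set z | U (z + x)] (fun z => f (z + x)) lam M d
  (open_shift (x := x) oU) (smooth_on_shift (x := x) sf) d0 M0.
have := congr1 (@^~ 0) (foldr_partial_shift f x [:: lst]).
rewrite /= add0r => <-; apply: H.
  by move=> z zd; apply: HU => i; rewrite mxE addrK.
by move=> z Uz; rewrite lap_shift; exact: pde.
Qed.

Definition dlast (k : nat) f : E -> R := iter k (@partial R R n lst) f.

Lemma smooth_on_dlast U f k : smooth_on U f -> smooth_on U (dlast k f).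
Proof. by move=> sf; elim: k => //= k IH; exact: smooth_on_partial. Qed.

Lemma lap_dlast U f lam k : open U -> smooth_on U f ->
  (forall z, U z -> lap f z = - lam * f z) ->
  forall z, U z -> lap (dlast k f) z = - lam * dlast k f z.
Proof.
move=> oU sf pde; elim: k => //= k IH z Uz.
have sk := smooth_on_dlast k sf.
rewrite (lap_partial lst oU sk Uz).
rewrite -(partialMl (- lam) lst (smooth_on_diff sk Uz)).
exact: near_eq_partial (near_open_eq oU IH Uz).
Qed.

(** Derivatives in the last coordinate solve the same equation, so the gradient estimate can be
    iterated; each application costs a margin d of the cube. *)
Lemma dlast_bound U f (lam M r d : R) m : open U -> smooth_on U f ->
  0 < d -> 0 < M ->
  (forall z : E, (forall i, `|z 0 i| <= r) -> U z /\ `|f z| <= M) ->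
  (forall z, U z -> lap f z = - lam * f z) ->
  forall z : E, (forall i, `|z 0 i| <= r - m%:R * d) ->
  `|dlast m f z| <= (N / d + d * (`|lam| + 1) / 2) ^+ m * M.
Proof.
move=> oU sf d0 M0 HU pde; set K := N / d + _.
have K0 : 0 < K.
  have h1 : 0 < N / d by rewrite divr_gt0 // ltr0Sn.
  have h2 : 0 <= d * (`|lam| + 1) / 2.
    by rewrite divr_ge0 // mulr_ge0 ?ltW // addr_gt0.
  by rewrite /K; lra.
elim: m => [|m IH] z zd.
  by rewrite expr0 mul1r; apply: (proj2 (HU z _)) => i; have := zd i; rewrite mul0r subr0.
rewrite exprS -mulrA; apply: (@gradient_estimate U (dlast m f) lam (K ^+ m * M) d) => //.
- exact: smooth_on_dlast.
- by rewrite mulr_gt0 // exprn_gt0.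
- move=> y yz; have yi i : `|y 0 i| <= r - m%:R * d.
    have -> : y 0 i = z 0 i + (y 0 i - z 0 i) by rewrite addrC subrK.
    apply: le_trans (ler_normD _ _) _.
    apply: le_trans (lerD (zd i) (yz i)) _.
    by rewrite -natr1 mulrDl mul1r; lra.
  split; last exact: IH.
  apply: (proj1 (HU y _)) => i; apply: le_trans (yi i) _.
  by rewrite gerBl mulr_ge0 // ltW.
- exact: lap_dlast.
Qed.

Lemma zero_on_hyperplane U g y : open U -> smooth_on U g -> U y -> lastc y = 0 ->
  (forall z, U z -> 0 < lastc z -> g z = 0) -> g y = 0.
Proof.
move=> oU sg Uy y0 g0; apply/eqP; apply: contraT => gy.
have cg := smooth_on_continuous sg Uy.
have Np : \forall z \near y, g z != 0 /\ U z.
  apply: filterI; last exact: open_nbhs_nbhs.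
  by apply: (cvgr_neq0 _ cg).
have [r /= r0 Hr] := (nbhs_normP (0 : R) _).1 (half_line (e_ lst) Np).
have r2 : `|0 - r / 2| < r by rewrite sub0r normrN gtr0_norm; lra.
have [] := Hr (r / 2) r2; rewrite g0 ?eqxx //.
- by case: (Hr (r / 2) r2).
- by rewrite lastcD lastcZ lastc_delta eqxx mulr1 y0 addr0; lra.
Qed.

Lemma dlast_zero U f k : open U -> smooth_on U f ->
  (forall z, U z -> 0 < lastc z -> f z = 0) ->
  forall z, U z -> 0 <= lastc z -> dlast k f z = 0.
Proof.
move=> oU sf f0 z Uz z0.
suff H : forall z, U z -> 0 < lastc z -> dlast k f z = 0.
  move: z0; rewrite le_eqVlt => /orP[/eqP z0|]; last exact: H.
  exact: zero_on_hyperplane oU (smooth_on_dlast k sf) Uz (esym z0) H.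
move=> {z Uz z0}; elim: k => //= k IH z Uz z0.
have oV : open (U `&` [set z | 0 < lastc z]).
  by apply: openI => //; exact: open_lastc_gt0.
rewrite (near_eq_partial (g := cst 0) lst (near_open_eq oV _ _)) //.
  by rewrite partial_cst.
by move=> y [Uy y0]; exact: IH.
Qed.

(* The width of the strip depends neither on the solution nor on lam: moving m
   times by r / (2 m), the gradient estimate bounds the m-th derivative by
   (C m / r) ^ m for large m. *)
Lemma unique_continuation U f (lam r : R) : open U -> smooth_on U f -> 0 < r ->
  (forall z : E, (forall i, `|z 0 i| <= r) -> U z) ->
  (forall z, U z -> lap f z = - lam * f z) ->
  (forall z, U z -> 0 < lastc z -> f z = 0) ->
  forall x : E, (forall i, `|x 0 i| <= r / 2) -> - (r / (32 * N)) <= lastc x <= 0 ->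
  f x = 0.
Proof.
move=> oU sf r0 HU pde f0 x xr /andP[x1 x0].
have N0 : 0 < N by rewrite ltr0Sn.
have [M M0 fM] : exists2 M : R, 0 < M & forall z : E, (forall i, `|z 0 i| <= r) -> `|f z| <= M.
  pose D : set E := [set z | forall i, [set` `[- r, r]] (z 0 i)].
  have DP z : D z <-> forall i, `|z 0 i| <= r.
    by split=> H i; have := H i; rewrite /= in_itv /= ler_norml.
  have cD : compact D.
    apply: (@rV_compact R n.+1 (fun=> [set` `[- r, r]])) => i.
    exact: segment_compact.
  have cf : {within D, continuous (fun z => `|f z|)}.
    apply: continuous_in_subspaceT => y; rewrite inE => /DP /HU Uy.
    have cfy := smooth_on_continuous sf Uy; exact: (cvg_norm cfy).
  have D0 : D 0 by apply/DP => i; rewrite mxE normr0 ltW.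
  have [c _ cmax] := EVT_max_rV (ex_intro _ _ D0) cD cf.
  exists (`|f c| + 1); first by have := normr_ge0 (f c); lra.
  move=> z /DP Dz; have : `|f z| <= `|f c| by apply: cmax; rewrite inE.
  lra.
pose c : R := `|lam| + 1.
have c0 : 0 < c by rewrite /c; have := normr_ge0 lam; lra.
pose h := - lastc x.
have h0 : 0 <= h by rewrite /h; lra.
(* The foot of x on the hyperplane, where all normal derivatives of f vanish; Taylor's estimate runs
   from y down to x. *)
pose y := x + h *: e_ lst.
have yx (s : R) i : i != lst -> (y + s *: - e_ lst) 0 i = x 0 i.
  by move=> il; rewrite !mxE eqxx /= (negbTE il) oppr0 !mulr0 !addr0.
have yl (s : R) : (y + s *: - e_ lst) 0 lst = - s.
  by rewrite !mxE !eqxx /= mulr1 mulrN1 /h /lastc; ring.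
have hr : h <= r / 2.
  by have := xr lst; rewrite /h -/(lastc x) ler_norml => /andP[? _]; lra.
have yr (s : R) : 0 <= s <= h -> forall i, `|(y + s *: - e_ lst) 0 i| <= r / 2.
  move=> /andP[s0 sh] i; case: (eqVneq i lst) => [->|il]; last by rewrite yx.
  by rewrite yl normrN ger0_norm // (le_trans sh).
have yU (s : R) : 0 <= s <= h -> U (y + s *: - e_ lst).
  by move=> sh; apply: HU => i; apply: le_trans (yr s sh i) _; lra.
have bound m : (0 < m)%N -> `|f x| <=
   (N / (r / (2 * m%:R)) + r / (2 * m%:R) * c / 2) ^+ m * M * h ^+ m / m`!%:R.
  move=> m0; have mR0 : 0 < (m%:R : R) by rewrite ltr0n.
  (* The m steps of length d use up r / 2, which is the room left around the segment from y to x. *)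
  set d := r / (2 * m%:R); set K := N / d + _.
  have d0 : 0 < d by rewrite divr_gt0 // mulr_gt0.
  pose phi j (s : R) := (-1) ^+ j * dlast j f (y + s *: - e_ lst).
  have dphi j s : (j < m)%N -> 0 <= s <= h -> is_derive s 1 (phi j) (phi j.+1 s).
    move=> jm sh; have dd := smooth_on_diff (smooth_on_dlast j sf) (yU s sh).
    rewrite /phi exprSr -mulrA; apply: is_deriveZ.
    have -> : -1 * dlast j.+1 f (y + s *: - e_ lst) =
              'D_(- e_ lst) (dlast j f) (y + s *: - e_ lst).
      rewrite mulN1r (deriveE _ dd).
      apply: (etrans _ (esym (raddfN _ _))); congr (- _).
      exact: (partialE lst dd).
    apply: is_derive_line; exact: diff_derivable.
  have phi0 j : (j < m)%N -> phi j 0 = 0.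
    move=> jm; have h00 : 0 <= (0 : R) <= h by rewrite lexx.
    rewrite /phi (dlast_zero j oU sf f0 (yU 0 h00)) ?mulr0 //.
    by rewrite -[lastc _]/((y + 0 *: - e_ lst) 0 lst) yl oppr0.
  have phim s : 0 <= s <= h -> `|phi m s| <= K ^+ m * M.
    move=> sh; rewrite /phi normrM normrX normrN1 expr1n mul1r.
    apply: (@dlast_bound U f lam M r d m) => //.
      by move=> z zr; split; [exact: HU|exact: fM].
    move=> i; apply: le_trans (yr s sh i) _.
    have -> : m%:R * d = r / 2.
      rewrite /d; move: (m%:R : R) mR0 => q q0; field; by rewrite gt_eqF.
    by lra.
  have hh : 0 <= h <= h by rewrite h0 lexx.
  have := taylor_zero dphi phi0 phim hh.
  rewrite /phi expr0 mul1r.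
  have -> // : y + h *: - e_ lst = x by rewrite /y scalerN addrK.
(* From m1 on, the term of K containing c is at most the other one, 2 N m / r. The eigenvalue thus
   affects m1 but not the width of the strip. *)
have [m1 Hm1] : exists m1 : nat, r * r * c / (8 * N) <= m1%:R.
  exists (Num.truncn (r * r * c / (8 * N))).+1; apply: ltW; exact: truncnS_gt.
(* Origin of the 32: K <= 4 N m / r and h <= r / (32 N) give K h <= m / 8, and (m / 8)^m <= (4 /
   8)^m m! leaves 2^-m. *)
have small m : (m1 <= m)%N -> (0 < m)%N -> `|f x| <= M / 2 ^+ m.
  move=> mm m0; apply: le_trans (bound m m0) _.
  have mR0 : 0 < (m%:R : R) by rewrite ltr0n.
  have m1' : 1 <= (m%:R : R) by rewrite ler1n.
  have mR : r * r * c / (8 * N) <= m%:R by apply: le_trans Hm1 _; rewrite ler_nat.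
  set K := N / _ + _.
  have K0 : 0 <= K.
    have e0 : 0 < r / (2 * m%:R) by rewrite divr_gt0 // mulr_gt0.
    have e1 := divr_gt0 N0 e0; have e2 := mulr_gt0 e0 c0.
    by apply: addr_ge0; [exact: ltW|apply: divr_ge0; [exact: ltW|]].
  have KE : K <= 4 * N * m%:R / r.
    have -> : K = 2 * N * m%:R / r + r * c / (4 * m%:R).
      rewrite /K; move: (m%:R : R) mR0 => q q0; field; by rewrite !gt_eqF.
    suff : r * c / (4 * m%:R) <= 2 * N * m%:R / r by lra.
    rewrite ler_pdivrMr ?mulr_gt0 // mulrAC ler_pdivlMr //.
    have H1 : r * r * c <= m%:R * (8 * N) by move: mR; rewrite ler_pdivrMr // mulr_gt0.
    have H2 : 0 <= m%:R * (8 * N) by apply: mulr_ge0; apply: ltW => //; rewrite mulr_gt0.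
    have -> : r * c * r = r * r * c by ring.
    have -> : 2 * N * m%:R * (4 * m%:R) = m%:R * (8 * N) * m%:R by ring.
    by apply: le_trans H1 _; rewrite ler_peMr.
  have hb : h <= r / (32 * N) by rewrite /h lerNl.
  have Kh : K * h <= m%:R / 8.
    have r32 : 0 <= r / (32 * N) by rewrite divr_ge0 // ?mulr_ge0 // ltW.
    apply: le_trans (ler_pM K0 h0 KE hb) _.
    rewrite le_eqVlt; apply/orP; left; apply/eqP.
    by move: (m%:R : R) => q; field; rewrite !gt_eqF.
  rewrite [_ * M * _]mulrAC -exprMn [_ ^+ m * M]mulrC -mulrA; apply: ler_wpM2l; first exact: ltW.
  have f0' : 0 < (m`!%:R : R) by rewrite ltr0n fact_gt0.
  rewrite ler_pdivrMr //.
  apply: (@le_trans _ _ ((m%:R / 8) ^+ m)).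
    apply: lerXn2r Kh; rewrite nnegrE; first exact: mulr_ge0.
    by rewrite divr_ge0 // ltW.
  rewrite expr_div_n ler_pdivrMr ?exprn_gt0 //.
  have := leq_expn_fact m; rewrite -(ler_nat R) natrX natrM natrX.
  move/le_trans; apply.
  rewrite le_eqVlt; apply/orP; left; apply/eqP.
  have -> : (8 : R) = 2 * 4 by ring.
  rewrite exprMn; have : (2 ^+ m : R) != 0 by rewrite expf_neq0.
  by move: (2 ^+ m) (4 ^+ m) (m`!%:R) => a b q a0; field.
apply/eqP; rewrite -normr_le0; apply/ler_addgt0Pl => e e0; rewrite addr0.
have [m2 Hm2] : exists m2 : nat, M / e <= m2%:R.
  exists (Num.truncn (M / e)).+1; apply: ltW; exact: truncnS_gt.
pose m := (maxn m1 m2).+1.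
apply: le_trans (small m _ _) _ => //.
  by rewrite /m ltnW // ltnS leq_maxl.
rewrite ler_pdivrMr ?exprn_gt0 // mulrC -ler_pdivrMr //.
apply: le_trans Hm2 _; rewrite -natrX ler_nat.
apply: (@leq_trans m); first by rewrite /m ltnW // ltnS leq_maxr.
exact/ltnW/ltn_expl.
Qed.

End UniqueContinuation.

(** * Charts and tilings *)

Section SmoothAt.
Context {R : realType} {n : nat}.
Local Notation E := 'rV[R]_n.+1.
Context {W : normedModType R}.
Implicit Types (f : E -> W).

Lemma smooth_at_sub (U U' : set E) f x : (\forall y \near x, U' y -> U y) ->
  smooth_at U f x -> smooth_at U' f x.
Proof.
move=> UU [F [sF Ff]]; exists F; split => //.
by apply: filterS2 UU Ff => y H1 H2 /H1.
Qed.

Lemma smooth_at_eq (U : set E) f g x : (\forall y \near x, U y -> f y = g y) ->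
  smooth_at U f x -> smooth_at U g x.
Proof.
move=> fg [F [sF Ff]]; exists F; split => //.
by apply: filterS2 fg Ff => y H1 H2 Uy; rewrite H2 // H1.
Qed.

Lemma smooth_at_interior (U : set E) f x : nbhs x U ->
  smooth_at U f x -> smooth_near f x.
Proof.
move=> Ux [F [sF Ff]]; apply: smooth_near_eq sF.
by apply: filterS2 Ux Ff => y Uy; exact.
Qed.

Lemma smooth_near_at (U : set E) f x : smooth_near f x -> smooth_at U f x.
Proof. by move=> sf; exists f; split => //; apply: filterE. Qed.

Lemma smooth_on_addcst (U : set E) f (c : W) : open U -> smooth_on U f ->
  smooth_on U (fun y => f y + c).
Proof.
move=> oU sf; pose P h := smooth_on U h \/ h = (fun y => f y + c).
have dh h : P h -> forall y, U y -> differentiable h y.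
  case=> [sh y Uy|-> y Uy]; first exact: smooth_on_diff sh Uy.
  apply: (@differentiableD _ _ _ f (cst c)); first exact: smooth_on_diff sf Uy.
  exact: differentiable_cst.
apply: (smooth_coind (P := P)) => //; last by right.
move=> h i [sh|->].
  by exists (partial i h) => //; left; exact: smooth_on_partial.
exists (partial i f); first by left; exact: smooth_on_partial.
move=> y Uy; have df := smooth_on_diff sf Uy.
have dc : differentiable (cst c : E -> W) y by exact: differentiable_cst.
rewrite (@partialD R n W f (cst c) y i df dc).
by rewrite partial_cst addr0.
Qed.

Lemma smooth_near_addcst f (c : W) x : smooth_near f x ->
  smooth_near (fun y => f y + c) x.
Proof.
move=> /smooth_nearP[U [oU Ux sf]]; apply/smooth_nearP; exists U; split => //.
exact: smooth_on_addcst.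
Qed.

End SmoothAt.

Section Jacobian.
Context {R : realType} {n : nat}.
Local Notation E := 'rV[R]_n.+1.

Lemma row_jacobian (f : E -> E) x i : differentiable f x ->
  row i ('J f x) = partial i f x.
Proof. by move=> df; rewrite rowE -deriveEjacobian. Qed.

Lemma jacobian_eq (f g : E -> E) x y : differentiable f x -> differentiable g y ->
  (forall i, partial i f x = partial i g y) -> 'J f x = 'J g y.
Proof.
move=> df dg fg; apply/row_matrixP => i.
exact: (etrans (row_jacobian i df) (etrans (fg i) (esym (row_jacobian i dg)))).
Qed.

End Jacobian.

Lemma continuous_within_nbhsP {T U : topologicalType} (A : set T) (f : T -> U) :
  {within A, continuous f} <->
  forall x, A x -> forall V, nbhs (f x) V -> \forall y \near x, A y -> V (f y).
Proof.
split=> [/subspace_continuousP H x Ax V Vf|H]; first exact: H Ax _ Vf.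
by apply/subspace_continuousP => x Ax V Vf; exact: H.
Qed.

Section Charts.
Context {R : realType} {n : nat}.
Local Notation E := 'rV[R]_n.+1.
Local Notation lst := (ord_max : 'I_n.+1).

Definition chart_restrict (X : Type) (p : chart n X) (W : set E) : chart n X :=
  Chart (cdom p `&` W) (cmap p) (cmet p).

Section Riemannian.
Context {X : ptopologicalType} (g : riemannian R n X).
Implicit Types (p q : @chart R n X).

Lemma atlas_restrict p W : atlas g p -> open W -> atlas g (chart_restrict p W).
Proof.
move=> ap oW; apply: atlas_maximal.
- have [dp ip cp op mp] := atlas_chart ap; split.
  + case: dp => [[odp pI]|[[W0 oW0 dE] pI]]; [left|right]; split => /=.
    * exact: openI.
    * by move=> _ [z [pz Wz] <-]; apply: pI; exists z.
    * by exists (W0 `&` W); [exact: openI|rewrite dE setIAC].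
    * by move=> x [px Wx]; exact: pI.
  + by apply: sub_in2 ip => x; rewrite !inE => -[].
  + apply/continuous_within_nbhsP => x [px Wx] V Vf.
    have := (continuous_within_nbhsP _ _).1 cp x px V Vf.
    by apply: filterS => y H [/H].
  + by move=> W' oW'; rewrite /= -setIA; apply: op; exact: openI.
  + move=> x [px Wx]; have [sm ms mpos] := mp x px; split => //.
    by apply: smooth_at_sub sm; apply: filterE => y [].
- by move=> _ [z [pz _] <-]; exists p => //; exists z.
- move=> q aq; split.
    move=> x y [px Wx] qy e; have [tau [st te tq tm]] := atlas_compat ap aq px qy e.
    by exists tau; split => //; apply: filterS tq => z H [/H].
  move=> x y qx [py Wy] e; have [tau [st te tq tm]] := atlas_compat aq ap qx py e.
  exists tau; split => //.
  have tW : \forall z \near x, W (tau z).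
    apply: (smooth_near_continuous st); apply: open_nbhs_nbhs.
    by split => //; rewrite te.
  by apply: filterS2 tW tq => z Wz H qz; have [] := H qz.
Qed.

(** Moves a face point to the origin, so that a flat chart can be given the half-cube domain
    required by [inner_face_isometry]. The metric is a separate argument, equal to the translated
    one on the domain only, so that it can be literally constant. *)
Lemma atlas_translate p u (W : set E) (met : E -> 'M[R]_n.+1) :
  atlas g p -> boundary_domain (inter g) p -> lastc u = 0 -> open W ->
  (forall z, (W `&` @half_space R n) z -> cdom p (z + u) /\ met z = cmet p (z + u)) ->
  atlas g (Chart (W `&` @half_space R n) (fun z => cmap p (z + u)) met).
Proof.
move=> ap bp u0 oW WD; set D := W `&` _ in WD *.
have lu z : lastc (z + u) = lastc z by rewrite lastcD u0 addr0.
have cs (v x : E) : {for x, continuous (fun z : E => z + v)}.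
  by apply: (@continuousD _ _ _ id (cst v)); [exact: cvg_id|exact: cst_continuous].
have [_ ip cp op mp] := atlas_chart ap.
have dhalf z : cdom p z -> lastc z <= 0 by case: bp => [[W0 _ ->]] _ [].
apply: atlas_maximal.
- split => /=.
  + right; split; first by exists W.
    by move=> z /WD[pz _] /=; rewrite -(lu z); case: bp => _; exact.
  + move=> x y; rewrite !inE => /WD[px _] /WD[py _] e.
    by apply: (addIr u); apply: ip; rewrite ?inE.
  + apply/continuous_within_nbhsP => x Dx V Vf; have [px _] := WD x Dx.
    have : \forall y \near x, cdom p (y + u) -> V (cmap p (y + u)).
      exact: (cs u x _ ((continuous_within_nbhsP _ _).1 cp (x + u) px V Vf)).
    by apply: filterS => y H Dy; apply: H; case: (WD y Dy).
  + move=> W' oW'.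
    have oT : open [set y | (W `&` W') (y - u)] by apply: open_shift; exact: openI.
    rewrite (_ : _ @` _ = cmap p @` (cdom p `&` [set y | (W `&` W') (y - u)])).
      exact: op.
    rewrite eqEsubset; split=> [_ [z [Dz W'z] <-]|_ [y [py [Wy W'y]] <-]].
      exists (z + u) => //; have [pz _] := WD z Dz; split => //.
      by rewrite /= addrK; split => //; case: Dz.
    exists (y - u); last by rewrite subrK.
    split => //; split => //; rewrite /half_space /= -lu subrK; exact: dhalf.
  + move=> x Dx; have [px mx] := WD x Dx; rewrite mx; have [sm ms mpos] := mp _ px.
    split => //; case: sm => F [sF Ff]; exists (fun z => F (z + u)); split.
      exact: smooth_near_shift.
    have : \forall z \near x, cdom p (z + u) -> F (z + u) = cmet p (z + u).
      exact: (cs u x) Ff.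
    by apply: filterS => z H Dz; have [pz ->] := WD z Dz; exact: H.
- by move=> _ [z /WD[pz _] <-]; exists p => //; exists (z + u).
- move=> q aq; split.
    move=> x y Dx qy /= e; have [px mx] := WD x Dx.
    have [tau [st te tq tm]] := atlas_compat ap aq px qy e.
    exists (fun z => tau (z + u)); split.
    + exact: smooth_near_shift.
    + exact: te.
    + have : \forall z \near x, cdom p (z + u) ->
          cdom q (tau (z + u)) /\ cmap q (tau (z + u)) = cmap p (z + u).
        exact: (cs u x) tq.
      by apply: filterS => z H /WD[pz _]; exact: H.
    + rewrite /= mx tm; have dt := smooth_near_diff st.
      suff -> : 'J (fun z => tau (z + u)) x = 'J tau (x + u) by [].
      apply: (jacobian_eq (differentiable_shift dt) dt) => i.
      exact: (congr1 (@^~ x) (foldr_partial_shift tau u [:: i])).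
  move=> x y qx Dy /= e; have [py my] := WD y Dy.
  have [tau [st te tq tm]] := atlas_compat aq ap qx py e.
  exists (fun z => tau z - u); split.
  + exact: smooth_near_addcst.
  + by rewrite te addrK.
  + have tW : \forall z \near x, W (tau z - u).
      apply: (smooth_near_continuous (smooth_near_addcst (- u) st)).
      by apply: open_nbhs_nbhs; split => //; rewrite te addrK; case: Dy.
    apply: filterS2 tW tq => z Wz H qz; have [pt et] := H qz.
    rewrite subrK; split => //; split => //.
    by rewrite /half_space /= -lu subrK; exact: dhalf.
  + rewrite /= my tm; have dt := smooth_near_diff st.
    have sc := smooth_near_addcst (- u) st.
    suff -> : 'J (fun z => tau z - u) x = 'J tau x by [].
    apply: (jacobian_eq (smooth_near_diff sc) dt) => i.
    have dc : differentiable (cst (- u) : E -> E) x by exact: differentiable_cst.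
    apply: (etrans (@partialD R n E tau (cst (- u)) x i dt dc)).
    by rewrite partial_cst addr0.
Qed.

End Riemannian.
End Charts.

Lemma near_open_point {T : topologicalType} (W : set T) x : open W -> W x -> nbhs x W.
Proof. by move=> oW Wx; exact: (open_nbhs_nbhs (conj oW Wx)). Qed.

Lemma within_interior {T U : topologicalType} (D : set T) (f : T -> U) (A : set U) x :
  {within D, continuous f} -> D x -> open A -> A (f x) ->
  interior [set z | D z -> A (f z)] x.
Proof.
move=> cf Dx oA Ax; exact: ((continuous_within_nbhsP D f).1 cf x Dx A (near_open_point oA Ax)).
Qed.

Lemma open_interior_domain {R : realType} {n : nat} {X : ptopologicalType}
    (g : riemannian R n X) (p : chart n X) u : atlas g p -> cdom p u ->
  inter g (cmap p u) -> nbhs u (cdom p).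
Proof.
move=> ap pu Iu; have [[[op _]|[[W oW dE] bI]] _ _ _ _] := atlas_chart ap.
  exact: near_open_point.
rewrite dE; apply: filterI.
  by apply: near_open_point => //; move: pu; rewrite dE => -[].
have lu := (bI u pu).1 Iu.
by apply: filterS (near_open_point open_lastc_lt0 lu) => z /ltW.
Qed.

(** * Topology of the block and of the tiling near faces and away from them *)

Section Block.
Context {R : realType} {n C : nat} {B : ptopologicalType}.
Variable b : building_block R n B C.

Lemma closure_face_inter c x : closure (face b c) x -> ~ inter b x.
Proof.
move=> cx Ix; have [y [fy Iy]] := cx _ (near_open_point (inter_open b) Ix).
by have [_ [W _ fE]] := face_smooth b c; move: fy; rewrite fE => -[_]; exact.
Qed.

Lemma face_closure_face c x : face b c x -> closure (face b c) x.
Proof. exact: subset_closure. Qed.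

(** Faces are relatively open in the boundary, so a face meeting the closure of another would meet
    that face itself. *)
Lemma face_unique c c' x : face b c x -> closure (face b c') x -> c' = c.
Proof.
move=> fx cx; apply/eqP; apply: contraT => cc.
have [_ [W oW fE]] := face_smooth b c.
have Wx : W x by move: fx; rewrite fE => -[].
have [y [fy Wy]] := cx _ (near_open_point oW Wx).
have : (face b c' `&` face b c) y.
  split => //; rewrite fE; split => //.
  by have [_ [W' _ fE']] := face_smooth b c'; move: fy; rewrite fE' => -[].
by rewrite (face_disjoint b cc).
Qed.

(** The open set on which no two copies are identified; there each [inc t i] is an open
    embedding. *)
Definition away_from_faces (x : B) : Prop := forall c, ~ closure (face b c) x.

Lemma open_away_from_faces : open away_from_faces.
Proof.
rewrite openE => x Ox; rewrite /interior.
apply: (@filter_forall B 'I_C (fun c => ~` closure (face b c)) (nbhs x) _) => c.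
apply: near_open_point; last exact: Ox.
by apply: closed_openC; exact: closed_closure.
Qed.

Lemma inter_away_from_faces x : inter b x -> away_from_faces x.
Proof. by move=> Ix c cx; exact: closure_face_inter cx Ix. Qed.

Definition covered (x : B) : Prop := (\bigcup_(p in atlas b) cimage p) x.

Lemma open_covered : open covered.
Proof.
apply: bigcup_open => p ap; have [_ _ _ op _] := atlas_chart ap.
by rewrite /cimage -[cdom p]setIT; apply: op; exact: openT.
Qed.

Lemma bdir_bneu_away x : (bdir b `|` bneu b) x -> away_from_faces x.
Proof.
by move=> Dx c cx; have : set0 x by rewrite -(bdir_bneu_face b c).
Qed.

Lemma bdir_bneu_covered x : (bdir b `|` bneu b) x -> covered x /\ ~ inter b x.
Proof.
case=> H.
  have [cD [W _ E]] := bdir_smooth b; split; first exact: cD.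
  by move: H; rewrite E => -[].
have [cD [W _ E]] := bneu_smooth b; split; first exact: cD.
by move: H; rewrite E => -[].
Qed.

Section Tiling.
Context {V : nat} {M : ptopologicalType}.
Variable t : tiling b V M.

Lemma inc_continuous i : continuous (inc t i).
Proof. by apply/continuousP => W oW; exact: ((inc_open t W).1 oW i). Qed.

Lemma inc_same i j x y : inc t i x = inc t j y -> x = y.
Proof. by move/inc_eq => []. Qed.

Lemma inc_inj_away i j x y : away_from_faces x -> inc t i x = inc t j y -> i = j.
Proof.
move=> Ox /inc_eq[_ /connectP[p]].
case: p => [_ ->//|k p /=]; case/andP => /existsP[c /andP[_ /asboolP cx]].
by case: (Ox c).
Qed.

Lemma inc_open_away i (W : set B) : open W -> W `<=` away_from_faces ->
  open (inc t i @` W).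
Proof.
move=> oW WO; apply: (inc_open t _).2 => k; have [<-|ik] := eqVneq i k.
  suff -> : inc t i @^-1` (inc t i @` W) = W by [].
  rewrite eqEsubset; split=> [x [y Wy]|x Wx]; last by exists x.
  by move/inc_same => <-.
suff -> : inc t k @^-1` (inc t i @` W) = set0 by exact: open0.
rewrite eqEsubset; split=> // x [y Wy] /inc_inj_away - /(_ (WO _ Wy)) /eqP.
by rewrite (negbTE ik).
Qed.

Lemma inter_away i x : away_from_faces x -> inter t (inc t i x) <-> inter b x.
Proof.
move=> Ox; rewrite tiling_inter; split=> [|Ix]; last by left; exists i => //; exists x.
case=> [[k _ [y Iy]]|[c [k [j [_ [y fy]]]]]] /inc_same yx; first by rewrite -yx.
by case: (Ox c); rewrite -yx; exact: face_closure_face.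
Qed.

(** Every step of a gluing path over x crosses the c-th face by [face_unique], and gluing along it
    is a matching, so a second step returns to the start. *)
Lemma inc_face c x i j y : face b c x ->
  inc t i x = inc t j y <-> x = y /\ (i = j \/ glued t c i j).
Proof.
move=> fx; split=> [|[<-]].
  move/inc_eq => [<- /connectP[p pp ->]]; split => //.
  elim: p i pp => [|k p IH] i /=; first by left.
  case/andP => /existsP[c' /andP[gik /asboolP cx]] pp.
  have cc := face_unique fx cx; rewrite cc in gik.
  case: (IH k pp) => [<-|gkj]; first by right.
  by left; apply: (glued_unique (c := c) (i := k)) gkj; rewrite glued_sym.
move=> ij; apply/inc_eq; split => //; case: ij => [->|g]; first exact: connect0.
apply: connect1; apply/existsP; exists c; rewrite g /=; apply/asboolP.
exact: face_closure_face.
Qed.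

Lemma inter_face c x i : face b c x ->
  inter t (inc t i x) <-> exists j, glued t c i j.
Proof.
move=> fx; have cfx := face_closure_face fx.
rewrite tiling_inter; split=> [|[j gj]]; last first.
  by right; exists c, i, j; split => //; exists x.
case=> [[k _ [y Iy]] /inc_same e|[c' [k [j [gkj [y fy e]]]]]].
  by case: (closure_face_inter cfx); rewrite -e.
have yx := inc_same e; rewrite yx in fy e.
have cc := face_unique fy cfx; rewrite -cc in gkj.
have /(inc_face _ _ _ fx)[_ [ki|gki]] := e; first by exists j; rewrite -ki.
by exists k; rewrite glued_sym.
Qed.

(* A chart of M near a point of the i-th copy away from the faces is a chart of
   B, and therefore induces a chart of every other copy. *)
Lemma atlas_pullback i p u x : atlas t p -> cdom p u -> cmap p u = inc t i x ->
  away_from_faces x -> covered x ->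
  exists p' : chart n B, [/\ atlas b p', cdom p' u,
    exists2 W, open W & cdom p' = cdom p `&` W, cmet p' = cmet p &
    forall z, cdom p' z -> away_from_faces (cmap p' z) /\
                           inc t i (cmap p' z) = cmap p z].
Proof.
move=> ap pu e Ox Cx.
pose A : set B := [set y | away_from_faces y /\ covered y].
have oA : open A by apply: openI; [exact: open_away_from_faces|exact: open_covered].
have AO : A `<=` away_from_faces by move=> y [].
have inj y z : A y -> inc t i y = inc t i z -> y = z by move=> _ /inc_same.
pose W := interior [set z | cdom p z -> (inc t i @` A) (cmap p z)].
have oW : open W by exact: open_interior.
have [dp ip cp op mp] := atlas_chart ap.
have Wu : W u.
  apply: (within_interior cp pu); first exact: inc_open_away.
  by exists x.
(* A local inverse of [inc t i] composed with p. The default value of [get] is irrelevant: on the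
   domain shrunk by W a preimage exists, and [inc_same] makes it unique. *)
pose f z : B := get [set y | A y /\ inc t i y = cmap p z].
have fP z : cdom p z -> W z -> A (f z) /\ inc t i (f z) = cmap p z.
  move=> pz /interior_subset /(_ pz) [y Ay ey].
  exact: (@getPex _ [set y | A y /\ inc t i y = cmap p z] (ex_intro _ y (conj Ay ey))).
have fu : f u = x.
  by have [_] := fP u pu Wu; rewrite e => /inc_same.
exists (Chart (cdom p `&` W) f (cmet p)); split => //; last 2 first.
- by exists W.
- by move=> z [pz Wz]; have [[Oz _] ez] := fP z pz Wz.
apply: atlas_maximal.
- split => /=.
  + case: dp => [[odp pI]|[[W0 oW0 dE] pI]]; [left|right]; split => /=.
    * exact: openI.
    * move=> _ [z [pz Wz] <-]; have [[Oz _] ez] := fP z pz Wz.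
      by apply/(inter_away i Oz); rewrite ez; apply: pI; exists z.
    * by exists (W0 `&` W); [exact: openI|rewrite dE setIAC].
    * move=> z [pz Wz]; have [[Oz _] ez] := fP z pz Wz.
      by rewrite -pI // -ez inter_away.
  + move=> z z'; rewrite !inE => -[pz Wz] [pz' Wz'] ff.
    have [_ ez] := fP z pz Wz; have [_ ez'] := fP z' pz' Wz'.
    by apply: ip; rewrite ?inE // -ez -ez' ff.
  + apply/continuous_within_nbhsP => z [pz Wz] S Sf; have [Az ez] := fP z pz Wz.
    have oG : open (inc t i @` (interior S `&` A)).
      by apply: inc_open_away; [apply: openI => //; exact: open_interior|move=> y [_ /AO]].
    have Gz : (inc t i @` (interior S `&` A)) (cmap p z) by exists (f z).
    have := (continuous_within_nbhsP _ _).1 cp z pz _ (near_open_point oG Gz).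
    apply: filterS => z' H [pz' Wz']; have [y [Sy Ay]] := H pz'.
    have [Az' <-] := fP z' pz' Wz'; move/inc_same => <-.
    exact: interior_subset Sy.
  + move=> W' oW'.
    have oP : open (cmap p @` (cdom p `&` (W `&` W'))) by apply: op; exact: openI.
    rewrite (_ : _ @` _ = (inc t i @^-1` (cmap p @` (cdom p `&` (W `&` W')))) `&` A).
      by apply: openI => //; exact: ((inc_open t _).1 oP i).
    rewrite eqEsubset; split=> [_ [z [[pz Wz] W'z] <-]|y [[z [pz [Wz W'z]] ez] Ay]].
      have [Az ez] := fP z pz Wz; split => //.
      by exists z.
    exists z; first by split.
    by have [_] := fP z pz Wz; rewrite ez => /inc_same.
  + move=> z [pz Wz]; have [sm ms mpos] := mp z pz; split => //.
    by apply: smooth_at_sub sm; apply: filterE => y [].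
- by move=> _ [z [pz Wz] <-]; have [[_ Cz] _] := fP z pz Wz.
(* Coordinate changes with a chart q of B are borrowed from M: restricted to [Wq], so that its image
   avoids the faces, q is carried into M by [inc_isometry], and the atlas of M compares it with
   p. *)
move=> q aq.
have [dq iq cq oq mq] := atlas_chart aq.
pose Wq := interior [set z | cdom q z -> A (cmap q z)].
have oWq : open Wq by exact: open_interior.
have aqW := atlas_restrict aq oWq.
have at_q : atlas t (Chart (cdom q `&` Wq) (inc t i \o cmap q) (cmet q)).
  have H c j : glued t c i j ->
      cimage (chart_restrict q Wq) `&` closure (face b c) = set0.
    move=> _; rewrite -subset0 => y [[z [qz Wz] <-] cy].
    by have /AO /(_ c) := interior_subset Wz qz.
  exact: inc_isometry aqW H.
have inWq z : cdom q z -> A (cmap q z) -> Wq z.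
  by move=> qz Az; exact: (within_interior cq qz oA Az).
split.
- move=> z y [pz Wz] qy /= ez.
  have [Az fz] := fP z pz Wz.
  have Wy : Wq y by apply: inWq => //; rewrite -ez.
  have [tau [st te tq tm]] := atlas_compat ap at_q pz (conj qy Wy)
    (etrans (esym fz) (congr1 (inc t i) ez)).
  exists tau; split => //; apply: filterS tq => z' H [pz' Wz'].
  have [[qz' _] /=] := H pz'; have [Az' <-] := fP z' pz' Wz'.
  by move/inc_same.
- move=> y z qy [pz Wz] /= ez.
  have [Az fz] := fP z pz Wz.
  have Wy : Wq y by apply: inWq => //; rewrite ez.
  have [tau [st te tq tm]] := atlas_compat at_q ap (conj qy Wy) pz
    (etrans (congr1 (inc t i) ez) fz).
  exists tau; split => //.
  have tW : \forall z \near y, W (tau z).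
    by apply: (smooth_near_continuous st); apply: near_open_point => //; rewrite te.
  apply: filterS3 (near_open_point oWq Wy) tW tq => y' Wy' Wt H qy'.
  have [pt /= ett] := H (conj qy' Wy'); split => //.
  by have [_] := fP _ pt Wt; rewrite ett => /inc_same.
Qed.

End Tiling.
End Block.

(** * Eigenfunctions near a face *)

Section Flat.
Context {R : realType} {n : nat}.
Local Notation E := 'rV[R]_n.+1.
Local Notation lst := (ord_max : 'I_n.+1).
Implicit Types (f F G : E -> R).

Lemma open_cube (l : R) : open (@cube R n l).
Proof.
rewrite openE => z zl; rewrite /interior.
apply: (@filter_forall E _ (fun i (y : E) => - l < y 0 i < l) (nbhs z) _) => i.
have c : {for z, continuous (fun y : E => y 0 i)} by exact: coord_continuous.
have [z1 z2] := andP (zl i).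
have N1 : \forall y \near z, - l < (y : E) 0 i by exact: (cvgr_gt _ c _ z1).
have N2 : \forall y \near z, (y : E) 0 i < l by exact: (cvgr_lt _ c _ z2).
by apply: filterS2 N1 N2 => y -> ->.
Qed.

Lemma cube_norm (l : R) (z : E) : 0 < l -> cube l z -> `|z| < l.
Proof.
move=> l0 zl; rewrite [`|_|]mx_normrE; apply: bigmax_lt => // -[a i] _ /=.
by rewrite (ord1 a) ltr_norml.
Qed.

Lemma smooth_on_reflect_last (U : set E) : smooth_on U (@reflect_last R n).
Proof.
have H s : exists2 c : E, differentiable (cst c : E -> E) 0 &
    foldr (@partial R E n) (@reflect_last R n) s =
      if s is [::] then @reflect_last R n else cst c.
  elim: s => [|j s [c _ IH]]; first by exists 0 => //; exact: differentiable_cst.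
  case: s IH => [|k s] IH.
    exists (reflect_last (delta_mx 0 j)); first exact: differentiable_cst.
    apply/funext => y; have [d dE] := is_diff_reflect_last y.
    exact: (etrans (partialE j d) (dE _)).
  exists 0; first exact: differentiable_cst.
  by rewrite [LHS]/= -/(foldr _ _ (k :: s)) IH; exact: partial_cst.
move=> s y _; have [c _ ->] := H s; case: s => [|j s].
  by case: (is_diff_reflect_last y).
exact: differentiable_cst.
Qed.

Lemma cube0 (l : R) : 0 < l -> cube l (0 : E).
Proof. by move=> l0 i; rewrite mxE oppr_lt0 l0. Qed.

Lemma laplacian_flat f x : laplacian (fun=> 1%:M) f x = - lap f x.
Proof.
rewrite /laplacian /lap det1 sqrtr1 invr1 mul1r; congr (- _).
apply: eq_bigr => i _; congr (partial i _ x); apply/funext => y.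
rewrite mul1r invmx1 (bigD1 i) //= big1 ?addr0 => [|j ji].
  by rewrite mxE eqxx mulr1n mul1r.
by rewrite mxE eq_sym (negbTE ji) mulr0n mul0r.
Qed.

Lemma normal_derivative_flat f x :
  normal_derivative (fun=> 1%:M) f x = partial lst f x.
Proof.
rewrite /normal_derivative invmx1 (bigD1 lst) //= big1 ?addr0 => [|j ji].
  by rewrite !mxE eqxx mulr1n sqrtr1 divr1 mul1r.
by rewrite !mxE eq_sym (negbTE ji) mulr0n !mul0r.
Qed.

(** Normal derivative at a face point of a function known only on the half cube, computed from a
    chosen smooth extension. By [extension_partial] the choice is immaterial; without any extension
    the default [cst 0] gives 0. *)
Definition normal_trace (l : R) f y : R :=
  partial lst (xget (cst 0) [set F | smooth_extension (half_cube l) f y F]) y.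

Lemma extension_partial (l : R) f y F G i : half_cube l y ->
  smooth_extension (half_cube l) f y F -> smooth_extension (half_cube l) f y G ->
  partial i F y = partial i G y.
Proof.
move=> [yl y0] [sF Ff] [sG Gf]; apply: partial_one_sided => //.
- exact: smooth_near_diff.
- exact: smooth_near_diff.
have N : \forall z \near y, cube l z by exact: (open_nbhs_nbhs (conj (open_cube (l := l)) yl)).
by apply: filterS2 N (filterI Ff Gf) => z zl [H1 H2] z0; rewrite H1 // H2.
Qed.

Lemma normal_traceE (l : R) f y F : half_cube l y ->
  smooth_extension (half_cube l) f y F -> normal_trace l f y = partial lst F y.
Proof.
move=> yl eF; apply: (@extension_partial l f) => //.
exact: (@xgetPex _ (cst 0) [set F | smooth_extension (half_cube l) f y F] (ex_intro _ F eF)).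
Qed.

(** The equation is imposed strictly inside; on the face it follows by continuity for every smooth
    extension, see [half_solution_extension]. *)
Definition half_solution (l lam : R) f : Prop :=
  (forall y, half_cube l y -> lastc y < 0 ->
     smooth_near f y /\ lap f y = - lam * f y) /\
  (forall y, half_cube l y -> lastc y = 0 -> smooth_at (half_cube l) f y).

(** One relation for three situations. A glued pair has equal values and opposite outward
    derivatives. A Dirichlet entry -1 reads f = - f and a void condition on the derivative; a
    Neumann entry 1 is void for values and makes the normal derivative its own opposite. *)
Definition reflects (V : nat) (l : R) (A : 'M[R]_V) (f : 'I_V -> E -> R) : Prop :=
  forall y, half_cube l y -> lastc y = 0 -> forall j,
  f j y = \sum_k A j k * f k y /\
  normal_trace l (f j) y = - \sum_k A j k * normal_trace l (f k) y.

End Flat.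

Section Face.
Context {R : realType} {n C : nat} {B : ptopologicalType}.
Variable b : building_block R n B C.
Local Notation E := 'rV[R]_n.+1.
Local Notation lst := (ord_max : 'I_n.+1).

(** Keeping clear of the closures of the other faces makes the chart usable in a copy whose c-th
    face is outer while other faces are glued. *)
Record face_chart (c : 'I_C) (l : R) (psi : E -> B) : Prop := FaceChart {
  face_chart_gt0 : 0 < l;
  face_chart_atlas : atlas b (Chart (half_cube l) psi (fun=> 1%:M));
  face_chart_face : forall x, half_cube l x -> lastc x = 0 -> face b c (psi x);
  face_chart_other : forall x c', half_cube l x -> c' != c ->
    ~ closure (face b c') (psi x);
  face_chart_inter : forall x, half_cube l x -> lastc x < 0 -> inter b (psi x) }.

(** The chart of [face_flat] is translated along the face to put x at the origin, then shrunk until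
    its image meets the closure of no other face. The norm on row vectors is the maximum norm, so
    cubes serve as balls. *)
Lemma ex_face_chart c x : face b c x ->
  exists l psi, face_chart c l psi /\ psi 0 = x.
Proof.
move=> fx; have [p [ap [W oW pE] p1 fp]] := face_flat b c.
have [u pu ux] := fp _ fx.
have nIx := closure_face_inter (face_closure_face fx).
have [dp _ cp _ _] := atlas_chart ap.
have bp : boundary_domain (inter b) p.
  by case: dp => // -[_ pI]; case: nIx; apply: pI; exists u.
have u0 : lastc u = 0.
  apply/eqP; rewrite eq_le; move: (pu); rewrite pE => -[_ /= ->] /=.
  by rewrite leNgt; apply/negP => /(bp.2 u pu); rewrite ux.
have [_ [Wf oWf fE]] := face_smooth b c.
pose G : set B := [set y | Wf y /\ forall c', c' != c -> ~ closure (face b c') y].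
have oG : open G.
  apply: openI => //; rewrite openE => y yG; rewrite /interior.
  apply: (@filter_forall B 'I_C (fun c' y => c' != c -> ~ closure (face b c') y) (nbhs y) _) => c'.
  have [->|c'c] := eqVneq c' c; first exact: filterE.
  have oc : open (~` closure (face b c')) by apply: closed_openC; exact: closed_closure.
  by apply: filterS (near_open_point oc (yG c' c'c)) => z.
have Gx : G (cmap p u).
  rewrite ux; split; first by move: fx; rewrite fE => -[].
  by move=> c' /eqP c'c cx; apply: c'c; exact: face_unique fx cx.
have Wu : W u by move: pu; rewrite pE => -[].
have Nu : \forall z \near u, W z /\ (cdom p z -> G (cmap p z)).
  have N1 : \forall z \near u, W z by exact: near_open_point.
  have N2 : \forall z \near u, cdom p z -> G (cmap p z).
    exact: ((continuous_within_nbhsP (cdom p) (cmap p)).1 cp u pu G (near_open_point oG Gx)).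
  by apply: filterS2 N1 N2.
have [l /= l0 Hl] := (nbhs_normP u _).1 Nu.
have Hz z : half_cube l z -> cdom p (z + u) /\ G (cmap p (z + u)).
  move=> [zl z0]; have [Wz Gz] : W (z + u) /\ (cdom p (z + u) -> G (cmap p (z + u))).
    apply: Hl => /=; have -> : u - (z + u) = - z by rewrite opprD addrCA subrr addr0.
    by rewrite normrN; exact: cube_norm.
  have pz : cdom p (z + u).
    by rewrite pE; split => //; rewrite /half_space /= lastcD u0 addr0.
  by split => //; exact: Gz.
exists l, (fun z => cmap p (z + u)); split; last by rewrite add0r.
split => //.
- apply: (atlas_translate ap bp u0 (open_cube (l := l))) => z zD.
  by have [pz _] := Hz z zD; rewrite p1.
- move=> z zD z0; have [pz [Wz _]] := Hz z zD; rewrite fE; split => //.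
  by move=> Iz; have := (bp.2 _ pz).1 Iz; rewrite lastcD z0 u0 addr0 ltxx.
- by move=> z c' zD; have [_ [_]] := Hz z zD; exact.
- move=> z zD z0; have [pz _] := Hz z zD.
  by apply/(bp.2 _ pz); rewrite lastcD u0 addr0.
Qed.

Section Solutions.
Context {V : nat} {M : ptopologicalType}.
Variable t : tiled_manifold b V M.

Lemma adjacency_glued bc c j k (v : 'I_V -> R) : glued t c j k ->
  \sum_i adjacency t bc c j i * v i = v k.
Proof.
move=> g; have jk : k != j.
  by apply/eqP => kj; move: g; rewrite kj glued_irrefl.
have no : ~~ outer t c j by rewrite negbK; apply/existsP; exists k.
rewrite (bigD1 k) //= big1 => [|i ik]; rewrite mxE.
  by rewrite eq_sym (negbTE jk) g mul1r addr0.
case: eqP => [_|_]; first by rewrite (negbTE no) mul0r.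
case gi: (glued t c j i); last by rewrite mul0r.
by move: ik; rewrite (glued_unique g gi) eqxx.
Qed.

Lemma adjacency_outer bc c j (v : 'I_V -> R) : outer t c j ->
  \sum_i adjacency t bc c j i * v i = if bc c j then - v j else v j.
Proof.
move=> o; rewrite (bigD1 j) //= big1 => [|i ij]; rewrite mxE.
  by rewrite eqxx o addr0; case: (bc c j); rewrite ?mulN1r ?mul1r.
rewrite eq_sym (negbTE ij).
case gi: (glued t c j i); last by rewrite mul0r.
by move: o; rewrite /outer => /existsP; case; exists i.
Qed.

Lemma outerP c j : outer t c j \/ exists k, glued t c j k.
Proof.
rewrite /outer; case: existsP => [[k g]|no]; last by left.
by right; exists k.
Qed.

Lemma outer_inter c j x : outer t c j -> face b c x -> ~ inter t (inc t j x).
Proof.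
by move=> o fx /(inter_face t j fx)[k g]; move/existsP: o; apply; exists k.
Qed.

Variables (bc : 'I_C -> 'I_V -> bool) (lam : R) (phi : M -> R).
Hypothesis sol : solution t bc lam phi.
Variables (c : 'I_C) (l : R) (psi : E -> B).
Hypothesis fc : face_chart c l psi.

Let f (j : 'I_V) (x : E) : R := phi (inc t j (psi x)).

Lemma solution_interior j y : half_cube l y -> lastc y < 0 ->
  smooth_near (f j) y /\ lap (f j) y = - lam * f j y.
Proof.
move=> yD y0.
have ap := atlas_restrict (face_chart_atlas fc) (@open_lastc_lt0 R n).
have aq : atlas t (Chart (half_cube l `&` [set x | lastc x < 0])
                         (inc t j \o psi) (fun=> 1%:M)).
  have H c' k : glued t c' j k ->
    cimage (chart_restrict (Chart (half_cube l) psi (fun=> 1%:M)) [set x : E | lastc x < 0])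
     `&` closure (face b c') = set0.
    move=> _; rewrite -subset0 => z [[x [xD x0] <-] cz].
    exact: closure_face_inter cz (face_chart_inter fc xD x0).
  exact: inc_isometry ap H.
have Iy : inter t (inc t j (psi y)).
  apply/inter_away; first exact/inter_away_from_faces/(face_chart_inter fc).
  exact: (face_chart_inter fc).
case: sol => _ sm pde _ _.
have yq : (half_cube l `&` [set x | lastc x < 0]) y by [].
split.
  apply: (smooth_at_interior _ (sm _ y aq yq _)); last by left; left.
  by apply: (open_interior_domain ap yq); exact: (face_chart_inter fc).
have := pde _ y aq yq Iy; rewrite /= laplacian_flat.
by move/eqP; rewrite eqr_oppLR -mulNr => /eqP.
Qed.

Lemma solution_outer j : outer t c j ->
  atlas t (Chart (half_cube l) (inc t j \o psi) (fun=> 1%:M)).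
Proof.
move=> o; have H c' k : glued t c' j k ->
    cimage (Chart (half_cube l) psi (fun=> 1%:M)) `&` closure (face b c') = set0.
  move=> g; rewrite -subset0 => z [[x xD <-] cz].
  have [cc|cc] := eqVneq c' c; last exact: (face_chart_other fc xD cc cz).
  by move/existsP: o; apply; exists k; rewrite -cc.
exact: inc_isometry (face_chart_atlas fc) H.
Qed.

(** The chart across the inner face turns phi into one smooth function F on the cube; F extends the
    j-th restriction and its reflection the k-th, whence the opposite normal traces. *)
Lemma solution_glued j k : glued t c j k ->
  forall y, half_cube l y -> lastc y = 0 ->
  let F := fun x => phi (if lastc x <= 0 then inc t j (psi x)
                         else inc t k (psi (reflect_last x))) in
  smooth_extension (half_cube l) (f j) y F /\
  smooth_extension (half_cube l) (f k) y (F \o @reflect_last R n).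
Proof.
move=> g y yD y0 F.
have aq := inner_face_isometry g (face_chart_gt0 fc) (face_chart_atlas fc)
  (face_chart_face fc).
case: sol => _ sm _ _ _.
have Iy : inter t (cmap (Chart (cube l) (fun x : E => if lastc x <= 0
     then inc t j (psi x) else inc t k (psi (reflect_last x)))
     (fun=> (1%:M : 'M[R]_n.+1))) y).
  rewrite /= y0 lexx; apply/(inter_face t j (face_chart_face fc yD y0)).
  by exists k.
have yc : cube l y by case: yD.
have sF : smooth_near F y.
  apply: (smooth_at_interior _ (sm _ y aq yc _)); last by left; left.
  exact: near_open_point (open_cube (l := l)) yc.
split; split => //.
- by apply: filterE => z [_ z0]; rewrite /F z0.
- apply: smooth_near_comp; last by rewrite reflect_last_id.
  by apply/smooth_nearP; exists setT; split; [exact: openT|by []|exact: smooth_on_reflect_last].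
- apply: filterE => z [zl z0]; rewrite /F /= reflect_last_lastc reflect_lastK.
  rewrite oppr_le0; case: ifP => // z1; congr phi.
  have z00 : lastc z = 0 by apply/eqP; rewrite eq_le z1 andbT.
  rewrite reflect_last_id //.
  apply/(inc_face t _ _ _ (face_chart_face fc (conj zl z0) z00)).
  by split => //; right.
Qed.

Lemma flat_half_solution j : half_solution l lam (f j).
Proof.
split; first by move=> y; exact: solution_interior.
move=> y yD y0; have [oj|[k g]] := outerP c j; last first.
  have H := solution_glued g yD y0; eexists; exact: H.1.
case: sol => _ sm _ _ _; apply: (sm _ y (solution_outer oj) yD).
have fy := face_chart_face fc yD y0.
case bcj: (bc c j); [left; right|right]; right; exists c, j;
  split; rewrite ?bcj //; by exists (psi y).
Qed.

Lemma flat_reflects : reflects l (adjacency t bc c) f.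
Proof.
move=> y yD y0 j; have fy := face_chart_face fc yD y0.
have [oj|[k g]] := outerP c j; last first.
  rewrite !(adjacency_glued _ _ g); split.
    congr phi; apply/(inc_face t _ _ _ fy); split => //; by right.
  have [e1 e2] := solution_glued g yD y0.
  rewrite (normal_traceE yD e1) (normal_traceE yD e2).
  have dF := smooth_near_diff e1.1.
  have dF' : differentiable (fun x => phi (if lastc x <= 0 then inc t j (psi x)
        else inc t k (psi (reflect_last x)))) (reflect_last y).
    by rewrite reflect_last_id.
  have [_ ->] := partial_reflect lst dF'.
  by rewrite eqxx expr1 mulN1r opprK reflect_last_id.
rewrite !(adjacency_outer _ _ oj).
case: sol => _ _ _ dir neu.
case bcj: (bc c j).
  rewrite opprK; split => //.
  have -> : f j y = 0.
    by apply: dir; right; exists c, j.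
  by rewrite oppr0.
split => //.
suff -> : normal_trace l (f j) y = 0 by rewrite oppr0.
have [F eF] := (flat_half_solution j).2 y yD y0.
rewrite (normal_traceE yD eF) -normal_derivative_flat.
apply: (neu _ y F (solution_outer oj) yD _ eF); rewrite /=.
by right; exists c, j; split; rewrite ?bcj //.
Qed.

End Solutions.
End Face.

(** * Solutions on a half cube up to its face *)

Section HalfSolutions.
Context {R : realType} {n : nat}.
Local Notation E := 'rV[R]_n.+1.
Local Notation lst := (ord_max : 'I_n.+1).
Local Notation N := (n.+1%:R : R).
Implicit Types (f g u F G : E -> R).

Lemma lap_near_eq f g x : (\forall y \near x, f y = g y) -> lap f x = lap g x.
Proof.
move=> fg; apply: eq_bigr => i _; apply: near_eq_partial.
have := near_join fg; apply: filterS => y; exact: near_eq_partial.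
Qed.

Lemma lap_lin (I : finType) (a : I -> R) (f : I -> E -> R) x :
  (forall j, smooth_near (f j) x) ->
  lap (fun y => \sum_j a j * f j y) x = \sum_j a j * lap (f j) x.
Proof.
move=> sf; rewrite /lap.
under [RHS]eq_bigr do rewrite mulr_sumr.
rewrite exchange_big; apply: eq_bigr => i _ /=.
have N1 : \forall y \near x, forall j, smooth_near (f j) y.
  apply: (@filter_forall E I (fun j y => smooth_near (f j) y) (nbhs x) _) => j.
  exact: smooth_near_nbhs.
have dp j : differentiable (partial i (f j)) x.
  exact: smooth_near_diff (smooth_near_partial i (sf j)).
rewrite -(partial_lin a i dp); apply: near_eq_partial.
apply: filterS N1 => y sy; apply: partial_lin => j; exact: smooth_near_diff.
Qed.

Lemma extension_lin (I : finType) (a : I -> R) (U : set E) (f F : I -> E -> R) y :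
  (forall j, smooth_extension U (f j) y (F j)) ->
  smooth_extension U (fun z => \sum_j a j * f j z) y (fun z => \sum_j a j * F j z).
Proof.
move=> eF; split; first by apply: smooth_near_lin => j; case: (eF j).
have H : \forall z \near y, forall j, U z -> F j z = f j z.
  apply: (@filter_forall E I (fun j z => U z -> F j z = f j z) (nbhs y) _) => j.
  by case: (eF j).
by apply: filterS H => z H Uz; apply: eq_bigr => j _; rewrite H.
Qed.

Lemma half_solution_lin (I : finType) (a : I -> R) (f : I -> E -> R) l lam :
  (forall j, half_solution l lam (f j)) ->
  half_solution l lam (fun y => \sum_j a j * f j y).
Proof.
move=> hf; split=> [y yD y0|y yD y0].
  have sf j : smooth_near (f j) y by case: ((hf j).1 y yD y0).
  split; first exact: smooth_near_lin.
  rewrite lap_lin // mulr_sumr; apply: eq_bigr => j _.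
  by have [_ ->] := (hf j).1 y yD y0; rewrite mulrCA.
have /choice[F HF] : forall j, exists F, smooth_extension (half_cube l) (f j) y F.
  by move=> j; exact: (hf j).2.
by exists (fun z => \sum_j a j * F j z); exact: extension_lin.
Qed.

Lemma normal_trace_lin (I : finType) (a : I -> R) (f : I -> E -> R) l lam y :
  (forall j, half_solution l lam (f j)) -> half_cube l y -> lastc y = 0 ->
  normal_trace l (fun y => \sum_j a j * f j y) y =
  \sum_j a j * normal_trace l (f j) y.
Proof.
move=> hf yD y0.
have /choice[F HF] : forall j, exists F, smooth_extension (half_cube l) (f j) y F.
  by move=> j; exact: (hf j).2.
rewrite (normal_traceE yD (extension_lin a HF)).
have dF j : differentiable (F j) y by apply: smooth_near_diff; case: (HF j).
rewrite (partial_lin a lst dF); apply: eq_bigr => j _.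
by rewrite (normal_traceE yD (HF j)).
Qed.

Lemma zero_on_hyperplane_left (U : set E) g y : open U -> smooth_on U g -> U y ->
  lastc y = 0 -> (forall z, U z -> lastc z < 0 -> g z = 0) -> g y = 0.
Proof.
move=> oU sg Uy y0 g0.
have oV : open (@reflect_last R n @^-1` U).
  by apply: open_comp => // z _; exact: continuous_reflect_last.
have := @zero_on_hyperplane R n _ _ y oV (smooth_on_reflect oU sg).
rewrite /= reflect_last_id // => ->//.
by move=> z Uz z0; apply: g0 => //; rewrite reflect_last_lastc oppr_lt0.
Qed.

Record boundary_extension (l lam : R) (u : E -> R) (U : set E) F : Prop :=
  BoundaryExtension {
  bext_open : open U;
  bext_cube : U `<=` cube l;
  bext_smooth : smooth_on U F;
  bext_eq : forall z, U z -> lastc z <= 0 -> F z = u z;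
  bext_pde : forall z, U z -> lastc z <= 0 -> lap F z = - lam * F z;
  bext_trace : forall z, U z -> lastc z = 0 -> partial lst F z = normal_trace l u z }.

Lemma bext_sub l lam u U U' F : open U' -> U' `<=` U ->
  boundary_extension l lam u U F -> boundary_extension l lam u U' F.
Proof.
move=> oU UU [oU1 Uc sF Fu pF dF]; split => //.
- by move=> z /UU /Uc.
- exact: smooth_on_sub sF.
- by move=> z /UU; exact: Fu.
- by move=> z /UU; exact: pF.
- by move=> z /UU; exact: dF.
Qed.

Lemma half_solution_extension l lam u y : half_solution l lam u ->
  half_cube l y -> lastc y = 0 ->
  exists U F, boundary_extension l lam u U F /\ U y.
Proof.
move=> [hint hbd] yD y0; have [F [sF Fu]] := hbd y yD y0.
have [U1 [oU1 Uy1 sF1]] := (smooth_nearP F y).1 sF.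
pose U2 := interior [set z | half_cube l z -> F z = u z].
have oU2 : open U2 by exact: open_interior.
have yc : cube l y by case: yD.
exists (U1 `&` U2 `&` cube l), F; split; last by [].
have Fu' z : U2 z -> half_cube l z -> F z = u z.
  by move=> /interior_subset; exact.
have oU : open (U1 `&` U2 `&` cube l).
  by apply: openI; [exact: openI|exact: open_cube].
have sU : smooth_on (U1 `&` U2 `&` cube l) F.
  by apply: smooth_on_sub sF1 => z [[]].
have pde_lt z : (U1 `&` U2 `&` cube l) z -> lastc z < 0 -> lap F z = - lam * F z.
  move=> [[U1z U2z] zc] z0.
  have Nz : \forall w \near z, F w = u w.
    apply: (near_open (openI oU2 (openI (open_cube (l := l)) (@open_lastc_lt0 R n)))).
      by split.
    by move=> w [U2w [wc w0]]; apply: Fu' => //; split => //; exact: ltW.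
  rewrite (lap_near_eq Nz) (nbhs_singleton Nz).
  by case: (hint z (conj zc (ltW z0)) z0).
split; [exact: oU| |exact: sU| | |].
- by move=> z [].
- by move=> z [[_ U2z] zc] z0; apply: Fu'.
- move=> z Uz; rewrite le_eqVlt => /orP[/eqP z0|]; last exact: pde_lt.
  (* At the face the equation for F is the limit of the equation inside. *)
  have s : smooth_on (U1 `&` U2 `&` cube l) (fun w => lap F w + lam * F w).
    by apply: smooth_onD => //; exact: smooth_on_lap.
  have := zero_on_hyperplane_left oU s Uz z0.
  rewrite mulNr => H; apply/eqP; rewrite -subr_eq0 opprK; apply/eqP/H.
  by move=> w Uw w0; rewrite pde_lt // mulNr addNr.
- move=> z [[U1z U2z] zc] z0; have zD : half_cube l z.
    by split => //; rewrite /half_space /= z0.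
  rewrite (normal_traceE zD (F := F)) //; split.
    by apply/smooth_nearP; exists U1.
  by apply: near_open oU2 U2z _ => w; exact: Fu'.
Qed.

(** Extended by zero, u becomes a smooth solution on the open cube. Unique continuation with r = l /
    2, whose closed cube fits inside, gives the bounds l / 4 and l / (64 N). *)
Lemma zero_cauchy_data l lam u : 0 < l -> half_solution l lam u ->
  (forall y, half_cube l y -> lastc y = 0 -> u y = 0 /\ normal_trace l u y = 0) ->
  forall x : E, (forall i, `|x 0 i| <= l / 4) ->
    - (l / (64 * N)) <= lastc x <= 0 -> u x = 0.
Proof.
move=> l0 hu u0 x xl /andP[x1 x0].
pose H := half_glue u (cst 0).
have oc : open (@cube R n l) by exact: open_cube.
have lt_near z : cube l z -> lastc z < 0 -> \forall w \near z, u w = H w.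
  by move=> _; exact: near_glue_lt.
have gt_near z : 0 < lastc z -> \forall w \near z, (cst 0 : E -> R) w = H w.
  exact: near_glue_gt.
have sH : smooth_on (cube l) H.
  move=> s y yc; suff /nbhs_singleton : smooth_near H y by exact.
  have [y0|y0|y0] := ltgtP (lastc y) 0.
  - apply: smooth_near_eq (near_glue_lt u (cst 0) y0) _.
    by case: (hu.1 y (conj yc (ltW y0)) y0).
  - apply: smooth_near_eq (near_glue_gt u (cst 0) y0) _.
    exact: smooth_near_cst.
  have yD : half_cube l y by split => //; rewrite /half_space /= y0.
  have [U [F [[oU Uc sF Fu pF dF] Uy]]] := half_solution_extension hu yD y0.
  have hD z : U z -> lastc z = 0 -> half_cube l z.
    by move=> Uz z0; split; [exact: Uc|rewrite /half_space /= z0].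
  have sg : smooth_on U (half_glue F (cst 0)).
    apply: (glue_zero_smooth oU sF pF) => z Uz z0.
      by rewrite Fu ?z0 //; case: (u0 z (hD z Uz z0) z0).
    by rewrite dF //; case: (u0 z (hD z Uz z0) z0).
  have e : \forall z \near y, half_glue F (cst 0) z = H z.
    apply: near_open oU Uy _ => z Uz; rewrite /H /half_glue; case: ifP => // z0.
    exact: Fu.
  apply: smooth_near_eq e _; apply/smooth_nearP; by exists U.
have pde_gt z : 0 < lastc z -> lap H z + lam * H z = 0.
  move=> z0; have e := gt_near z z0.
  rewrite -(lap_near_eq e) -(nbhs_singleton e) mulr0 addr0 /lap big1 // => i _.
  by rewrite !partial_cst.
have pde z : cube l z -> lap H z = - lam * H z.
  move=> zc; have [z0|z0|z0] := ltgtP (lastc z) 0.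
  - have e := lt_near z zc z0; rewrite -(lap_near_eq e) -(nbhs_singleton e).
    by case: (hu.1 z (conj zc (ltW z0)) z0).
  - by apply/eqP; rewrite mulNr -subr_eq0 opprK; apply/eqP/pde_gt.
  - have s : smooth_on (cube l) (fun w => lap H w + lam * H w).
      by apply: smooth_onD => //; exact: smooth_on_lap.
    have := zero_on_hyperplane oc s zc z0.
    rewrite mulNr => K; apply/eqP; rewrite -subr_eq0 opprK; apply/eqP/K.
    by move=> w _; exact: pde_gt.
have r0 : 0 < l / 2 by rewrite divr_gt0.
have Hx : H x = 0.
  apply: (@unique_continuation R n (cube l) H lam (l / 2)) => //.
  - move=> z zl i; have := zl i; rewrite -ltr_norml => /le_lt_trans; apply.
    by rewrite ltr_pdivrMr // ltr_pMr // ltr1n.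
  - move=> z _ z0; by rewrite -(nbhs_singleton (gt_near z z0)).
  - move=> i; apply: le_trans (xl i) _; rewrite le_eqVlt; apply/orP; left; apply/eqP.
    by field.
  - rewrite x0 andbT; apply: le_trans x1; rewrite lerN2.
    rewrite le_eqVlt; apply/orP; left; apply/eqP.
    have gen (q : R) : q != 0 -> l / (64 * q) = l / 2 / (32 * q).
      by move=> q0; field.
    by apply: gen; rewrite pnatr_eq0.
by move: Hx; rewrite /H /half_glue x0.
Qed.

End HalfSolutions.

(** * From intertwining matrices to adjacency matrices *)

Section Measure.
Context {R : realType}.

Lemma open_measurable_borel (X : ptopologicalType) (A : set (borel X)) :
  open (A : set X) -> measurable A.
Proof. by move=> oA; exact: sub_sigma_algebra. Qed.

Definition box m (a : 'rV[R]_m) (l : R) : set 'rV[R]_m :=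
  [set x | forall i, a 0 i - l < x 0 i < a 0 i + l].

Lemma iterated_integral0 m : iterated_integral (fun _ : 'rV[R]_m => 0%E) = 0%E.
Proof. by elim: m => //= m ->; rewrite integral0. Qed.

Lemma iterated_integral_box m (a : 'rV[R]_m) (l : R) : 0 < l ->
  iterated_integral (fun x => (\1_(box a l) x)%:E) = ((2 * l) ^+ m)%:E.
Proof.
move=> l0; elim: m a => [|m IH] a /=.
  by rewrite expr0 indicE mem_set // => -[].
pose a0 := a 0 ord0; pose a' : 'rV[R]_m := \row_i a 0 (lift ord0 i).
pose J : set R := [set` `]a0 - l, a0 + l[].
have H (s : R) : iterated_integral (fun x : 'rV[R]_m =>
    (\1_(box a l) (row_mx (s%:M : 'rV[R]_1) x : 'rV[R]_(1 + m)))%:E)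
    = ((cst ((2 * l) ^+ m)%:E) \_ J) s.
  have boxE (x : 'rV[R]_m) : box a l (row_mx (s%:M : 'rV[R]_1) x : 'rV[R]_(1 + m)) <->
      J s /\ box a' l x.
    have e0 : (row_mx (s%:M : 'rV[R]_1) x : 'rV[R]_(1 + m)) 0 ord0 = s.
      have -> : ord0 = lshift m (ord0 : 'I_1) by exact: val_inj.
      by rewrite row_mxEl mxE eqxx mulr1n.
    have eS i : (row_mx (s%:M : 'rV[R]_1) x : 'rV[R]_(1 + m)) 0 (lift ord0 i) = x 0 i.
      have -> : lift ord0 i = rshift 1 i by exact: val_inj.
      by rewrite row_mxEr.
    split=> [bx|[Js bx] i].
      split; first by have := bx ord0; rewrite e0 /J /= in_itv.
      by move=> i; have := bx (lift ord0 i); rewrite eS mxE.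
    have [j ->|->] := unliftP ord0 i; last by rewrite e0; move: Js; rewrite /J /= in_itv.
    by have := bx j; rewrite eS mxE.
  rewrite patchE; case: ifPn => [/set_mem Js|Js].
    rewrite -(IH a'); congr iterated_integral; apply/funext => x.
    rewrite !indicE; have [bx|bx] := pselect (box a' l x).
      by rewrite !mem_set //; apply/boxE.
    by rewrite !memNset // => /boxE[].
  rewrite -[RHS](iterated_integral0 m); congr iterated_integral; apply/funext => x.
  rewrite indicE memNset // => /boxE[Js' _]; move: Js; rewrite notin_setE; exact.
under eq_integral do rewrite H.
rewrite -integral_mkcond integral_cst; last exact: measurable_itv.
have := @lebesgue_measure_itv R `]a0 - l, a0 + l[; rewrite /= lte_fin.
have -> : a0 - l < a0 + l by rewrite ltrD2l gtrN.
rewrite -EFinB => ->; rewrite -EFinM exprSr; congr (_ * _)%:E; ring.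
Qed.

(** The integral of a nonnegative function is a supremum over the simple functions below it, hence
    monotone even for nonmeasurable functions; this lets the function h of [chebyshev_Lnorm2] be
    arbitrary. *)
Lemma le_integral_ge0 d (T : measurableType d) (mu : {measure set T -> \bar R})
    (f g : T -> \bar R) : (forall x, 0 <= f x)%E -> (forall x, f x <= g x)%E ->
  (\int[mu]_x f x <= \int[mu]_x g x)%E.
Proof.
move=> f0 fg; have g0 x : (0 <= g x)%E by exact: le_trans (f0 x) (fg x).
rewrite !ge0_integralTE //; apply: ereal_sup_le => _ [h hf <-].
by exists h => // x; exact: le_trans (hf x) (fg x).
Qed.

Lemma chebyshev_Lnorm2 d (T : measurableType d) (mu : {measure set T -> \bar R})
    (h : T -> R) (A : set T) (a e : R) : measurable A -> 0 <= a -> 0 <= e ->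
  (forall x, A x -> a <= `|h x|) ->
  ('N[mu]_2%:E[(fun x => (h x)%:E)] < e%:E)%E ->
  ((a ^+ 2)%:E * mu A <= (e ^+ 2)%:E)%E.
Proof.
move=> mA a0 e0 ha hN.
rewrite -integral_cst // integral_mkcond.
apply: (@le_trans _ _ (Lnorm mu 2%:E (fun x => (h x)%:E) `^ 2)%E).
  rewrite poweR_Lnorm //; apply: le_integral_ge0.
    by move=> x; rewrite patchE; case: ifP => // _; rewrite lee_fin sqr_ge0.
  move=> x; rewrite patchE; case: ifPn => [/set_mem Ax|_]; last exact: poweR_ge0.
  by rewrite /= -powR_mulrn // lee_fin ge0_ler_powR ?nnegrE // ha.
rewrite -powR_mulrn // -poweR_EFin.
apply: gt0_ler_poweR => //.
- by rewrite in_itv /= Lnorm_ge0 leey.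
- by rewrite in_itv /= lee_fin e0 leey.
- exact: ltW.
Qed.

End Measure.

Lemma continuous_finsum {R : realType} {X : topologicalType} (I : finType)
    (F : I -> X -> R) : (forall i, continuous (F i)) ->
  continuous (fun x => \sum_i F i x).
Proof.
move=> cF; elim: (index_enum I) => [|i r IH].
  rewrite (_ : (fun _ => _) = cst 0); first exact: cst_continuous.
  by apply/funext => x; rewrite big_nil.
rewrite (_ : (fun _ => _) = (fun x => F i x + \sum_(j <- r) F j x)).
  by move=> x; apply: continuousD; [exact: cF|exact: IH].
by apply/funext => x; rewrite big_cons.
Qed.

(** * Volume near a face and density of the eigenfunctions *)

Section FaceVolume.
Context {R : realType} {n C : nat} {B : ptopologicalType}.
Variable b : building_block R n B C.
Local Notation E := 'rV[R]_n.+1.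
Local Notation lst := (ord_max : 'I_n.+1).

Lemma open_box (z : E) (r : R) : open (box z r).
Proof.
have H : box z r = [set y | cube r (y + - z)].
  rewrite eqEsubset; split=> y H i; have := H i; rewrite !mxE => /andP[h1 h2].
    by apply/andP; split; lra.
  by apply/andP; split; lra.
by rewrite H; apply: open_shift; exact: open_cube.
Qed.

Lemma half_cube_box (l : R) (x : E) (P : E -> Prop) : half_cube l x ->
  (\forall y \near x, half_cube l y -> P y) ->
  exists z r, 0 < r /\ forall y, box z r y -> [/\ half_cube l y, lastc y < 0 & P y].
Proof.
move=> [xl x0] NP.
have Nc : \forall y \near x, cube l y by exact: (near_open_point (open_cube (l := l)) xl).
have [r /= r0 Hr] := (nbhs_normP x _).1 (filterI Nc NP).
(* A box of half-width r / 2 centred r / 2 below x lies in the open half space and within distance r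
   of x, even when x is on the face. *)
exists (x - (r / 2) *: delta_mx 0 lst), (r / 2); split; first by rewrite divr_gt0.
move=> y yz.
have y0 : lastc y < 0.
  have := yz lst; rewrite !mxE !eqxx mulr1 /= -/(lastc y) -/(lastc x) subrK.
  by move=> /andP[_ /lt_le_trans]; apply.
have yx : `|x - y| < r.
  rewrite [`|_|]mx_normrE; apply: bigmax_lt => // -[a i] _ /=; rewrite (ord1 a).
  have := yz i; rewrite !mxE eqxx /= => /andP[h1 h2]; rewrite ltr_norml.
  move: h1 h2; case: (i == lst) => /=; rewrite ?mulr1n ?mulr0n => h1 h2;
    by apply/andP; split; lra.
have [yl Py] := Hr y yx.
have yD : half_cube l y by split => //; exact: ltW.
by split => //; exact: Py.
Qed.

Context {c : 'I_C} {l : R} {psi : E -> B} (fc : face_chart b c l psi).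

Lemma face_chart_vol (A : set E) : open A ->
  (forall x, A x -> half_cube l x /\ lastc x < 0) ->
  vol b (psi @` A) = iterated_integral (fun x => (\1_A x)%:E).
Proof.
move=> oA HA; have ap := atlas_restrict (face_chart_atlas fc) (@open_lastc_lt0 R n).
have mA : measurable (A : set (borel E)) by exact: open_measurable_borel.
have sA : A `<=` half_cube l `&` [set x | lastc x < 0] by move=> x /HA[xD x0].
apply: (etrans (vol_chart ap mA sA)).
by apply: congr1; apply/funext => x; rewrite det1 sqrtr1 mul1r.
Qed.

Lemma face_chart_open (A : set E) : open A ->
  (forall x, A x -> half_cube l x) -> open (psi @` A).
Proof.
move=> oA HA; have [_ _ _ op _] := atlas_chart (face_chart_atlas fc).
rewrite (_ : A = half_cube l `&` A); first exact: op.
by rewrite eqEsubset; split => [x Ax|x []//]; split => //; exact: HA.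
Qed.

Lemma face_chart_continuous (X : topologicalType) (phi : B -> X) : continuous phi ->
  forall x, half_cube l x -> forall W, open W -> W (phi (psi x)) ->
  \forall y \near x, half_cube l y -> W (phi (psi y)).
Proof.
move=> cphi x xD W oW Wx; have [_ _ cp _ _] := atlas_chart (face_chart_atlas fc).
have oW' : open (phi @^-1` W) by apply: open_comp.
exact: ((continuous_within_nbhsP _ _).1 cp x xD _ (near_open_point oW' Wx)).
Qed.

(** If f and g differed at a point, by continuity they would differ on the image of a whole box,
    which has positive volume and cannot lie in a null set. *)
Lemma ae_eq_face_chart (f g : B -> R) : continuous f -> continuous g ->
  {ae vol b, forall x : borel B, f x = g x} ->
  forall x, half_cube l x -> f (psi x) = g (psi x).
Proof.
move=> cf cg [A [mA A0 fgA]] x xD; apply/eqP; rewrite -subr_eq0; apply: contraT => fx.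
have ch : continuous (fun y => f y - g y) by move=> y; apply: continuousB; [exact: cf|exact: cg].
have oW : open [set s : R | s != 0] by exact: open_neq.
have [z [r [r0 zr]]] := half_cube_box xD (face_chart_continuous ch xD oW fx).
have ob : open (box z r) by exact: open_box.
have vE : vol b (psi @` box z r) = ((2 * r) ^+ n.+1)%:E.
  by rewrite face_chart_vol ?iterated_integral_box // => y /zr[].
have : (vol b (psi @` box z r) <= vol b A)%E.
  apply: le_measure; rewrite ?inE //.
    by apply: open_measurable_borel; apply: face_chart_open => // y /zr[].
  move=> _ [y yz <-]; apply: fgA => /= e; have [_ _] := zr y yz.
  by rewrite /= e subrr eqxx.
rewrite A0 vE lee_fin leNgt exprn_gt0 // mulr_gt0 //.
Qed.

Section Copy.
Context {V : nat} {M : ptopologicalType}.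
Variable t : tiled_manifold b V M.

Lemma face_chart_vol_copy j (A : set E) : open A ->
  (forall x, A x -> half_cube l x /\ lastc x < 0) ->
  vol t (inc t j @` (psi @` A)) = vol b (psi @` A).
Proof.
move=> oA HA; rewrite face_chart_vol //.
have ap := atlas_restrict (face_chart_atlas fc) (@open_lastc_lt0 R n).
have H c' k : glued t c' j k ->
    cimage (chart_restrict (Chart (half_cube l) psi (fun=> 1%:M)) [set x : E | lastc x < 0])
     `&` closure (face b c') = set0.
  move=> _; rewrite -subset0 => z [[x [xD x0] <-] cz].
  exact: closure_face_inter cz (face_chart_inter fc xD x0).
have aq := inc_isometry ap H.
have mA : measurable (A : set (borel E)) by exact: open_measurable_borel.
have sA : A `<=` half_cube l `&` [set x | lastc x < 0] by move=> x /HA[xD x0].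
rewrite image_comp; apply: (etrans (vol_chart aq mA sA)).
by apply: congr1; apply/funext => x; rewrite det1 sqrtr1 mul1r.
Qed.

Lemma inc_vol_open j (A : set E) : open A ->
  (forall x, A x -> half_cube l x /\ lastc x < 0) ->
  open (inc t j @` (psi @` A)).
Proof.
move=> oA HA; apply: inc_open_away.
  by apply: face_chart_open => // x /HA[].
by move=> _ [x /HA[xD x0] <-]; apply/inter_away_from_faces/(face_chart_inter fc).
Qed.

(* Approximating the indicator of one copy of the box by eigenfunctions: on the
   box the relation forces some copy to carry an error bounded below. *)
Lemma no_linear_relation bc (s : 'I_V -> R) z r : 0 < r ->
  (forall x, box z r x -> half_cube l x /\ lastc x < 0) ->
  (forall lam phi, solution t bc lam phi ->
     forall x, box z r x -> \sum_j s j * phi (inc t j (psi x)) = 0) ->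
  forall j, s j = 0.
Proof.
move=> r0 zr rel j0; apply/eqP; apply: contraT => sj0.
have ob : open (box z r) by exact: open_box.
pose G : set M := inc t j0 @` (psi @` box z r).
have oG : open G by exact: inc_vol_open.
have mG : measurable (G : set (borel M)) by exact: open_measurable_borel.
pose f : borel M -> R := \1_G.
have fL : f \in Lfun (vol t) 2%:E.
  apply/andP; split; rewrite inE /=; first exact/measurable_indicP.
  rewrite /finite_norm unlock; apply: poweR_lty.
  under eq_integral => x _.
    have -> : (`|(EFin \o f) x| `^ 2 = (\1_G x)%:E)%E.
      rewrite /= /f indicE; case: (x \in G).
        by rewrite normr1 powR1.
      by rewrite normr0 powR0.
    over.
  rewrite integral_indic // setIT ltey_eq; apply/orP; left.
  exact: fin_num_measure.
pose sigma := \sum_j `|s j| + 1.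
have sigma0 : 0 < sigma by rewrite ltr_wpDl // sumr_ge0.
(* By [relg], errors at most a in all copies would give |s j0| <= sigma a = |s j0| / 2. So at each
   point of the box some copy has error above a. *)
pose a := `|s j0| / sigma / 2.
have a0 : 0 < a by rewrite !divr_gt0 // normr_gt0.
pose omega := (2 * r) ^+ n.+1.
have omega0 : 0 < omega by rewrite exprn_gt0 // mulr_gt0.
(* By the Chebyshev inequality the part of the box where a given copy has error above a has volume
   at most e^2 / a^2 = omega / (V + 1)^2; V such parts cannot cover the volume omega. *)
pose e := a * Num.sqrt omega / V.+1%:R.
have e0 : 0 < e by rewrite divr_gt0 // mulr_gt0 // sqrtr_gt0.
have [_ _ _ dense] := tiled_spectral t bc.
have [m [lam [phi [sphi hN]]]] := dense f e fL e0.
pose h (x : M) : R := f x - \sum_k phi k x.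
have cphi k : continuous (phi k) by case: (sphi k).
have csum : continuous (fun x : M => \sum_k phi k x).
  exact: continuous_finsum.
have fE j x : box z r x -> f (inc t j (psi x)) = (j == j0)%:R.
  move=> bx; have [xD x0] := zr x bx.
  have ax : away_from_faces b (psi x).
    exact/inter_away_from_faces/(face_chart_inter fc xD x0).
  rewrite /f indicE; have [->|jj0] := eqVneq j j0.
    by rewrite mem_set //; exists (psi x) => //; exists x.
  rewrite memNset // => -[y _ ey]; move/eqP: jj0; apply.
  exact: inc_inj_away ax (esym ey).
pose g j (y : B) : R := (j == j0)%:R - \sum_k phi k (inc t j y).
have cg j : continuous (g j).
  move=> y; apply: cvgB; first exact: cvg_cst.
  exact: (continuous_comp (@inc_continuous _ _ _ _ b V M t j y) (csum _)).
have hE j x : box z r x -> h (inc t j (psi x)) = g j (psi x).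
  by move=> bx; rewrite /h fE.
(* The relation holds for each approximating eigenfunction, whatever its eigenvalue, so only the
   indicator function contributes. *)
have relg x : box z r x -> \sum_j s j * g j (psi x) = s j0.
  move=> bx; rewrite /g; under eq_bigr do rewrite mulrBr.
  rewrite sumrB (bigD1 j0) //= eqxx mulr1 big1 ?addr0; last first.
    by move=> j /negbTE ->; rewrite mulr0.
  rewrite [X in _ - X](_ : _ = 0) ?subr0 //.
  under eq_bigr do rewrite mulr_sumr.
  rewrite exchange_big big1 // => k _; exact: (rel _ _ (sphi k)).
pose A j : set E := box z r `&` [set x | a < `|g j (psi x)|].
have oW : open [set u : R | a < `|u|].
  apply: (@open_comp _ _ (fun u : R => `|u|) [set u | a < u]); last exact: open_gt.
  by move=> u _; exact: norm_continuous.
have oA j : open (A j).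
  rewrite openE => x [bx ax]; rewrite /interior.
  have [xD x0] := zr x bx.
  have N1 : \forall y \near x, box z r y by exact: (near_open_point ob bx).
  have N2 := face_chart_continuous (@cg j) xD oW ax.
  apply: filterS2 N1 N2 => y by_ H; split => //; apply: H.
  by case: (zr y by_).
have HA j x : A j x -> half_cube l x /\ lastc x < 0 by case=> + _; exact: zr.
have cover : box z r `<=` \bigcup_(j in [set: 'I_V]) A j.
  move=> x bx; apply: contrapT => nA.
  have gle j : `|g j (psi x)| <= a.
    by rewrite leNgt; apply/negP => ga; apply: nA; exists j.
  have : `|s j0| <= \sum_j `|s j| * a.
    rewrite -(relg x bx); apply: le_trans (ler_norm_sum _ _ _) _; apply: ler_sum => j _.
    by rewrite normrM ler_wpM2l.
  rewrite -mulr_suml => sle.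
  have : sigma * a = `|s j0| / 2.
    by rewrite /a; field; rewrite gt_eqF.
  have : 0 < `|s j0| by rewrite normr_gt0.
  move: sle; rewrite /sigma mulrDl mul1r.
  by move: (_ * a) (`|s j0|) a0 => q p; lra.
have volA j : ((a ^+ 2)%:E * vol b (psi @` A j) <= (e ^+ 2)%:E)%E.
  rewrite -(face_chart_vol_copy j (oA j) (HA j)).
  have mA : measurable (inc t j @` (psi @` A j) : set (borel M)).
    by apply: open_measurable_borel; exact: inc_vol_open (oA j) (HA j).
  have ah x : (inc t j @` (psi @` A j)) x -> a <= `|h x|.
    by move=> [_ [y [by_ ay] <-] <-]; rewrite hE //; exact: ltW.
  exact: (@chebyshev_Lnorm2 R _ _ (vol t) h _ a e mA (ltW a0) (ltW e0) ah hN).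
have vbox : vol b (psi @` box z r) = omega%:E.
  by rewrite face_chart_vol // iterated_integral_box.
have sub : (vol b (psi @` box z r) <= \sum_j vol b (psi @` A j))%E.
  have mA j : [set: 'I_V] j -> measurable (psi @` A j : set (borel B)).
    move=> _; apply: open_measurable_borel; apply: face_chart_open => //.
    by move=> x /(HA j)[].
  have mbox : measurable (psi @` box z r : set (borel B)).
    apply: open_measurable_borel; apply: face_chart_open => //.
    by move=> x /zr[].
  have sub : psi @` box z r `<=` \bigcup_(j in [set: 'I_V]) (psi @` A j).
    by move=> _ [x bx <-]; have [j _ Ax] := cover x bx; exists j => //; exists x.
  have := content_sub_fsum (vol b) finite_finset mA mbox sub.
  rewrite (fsbigE (index_enum 'I_V)); first by under eq_bigl do rewrite in_setT.
  - exact: index_enum_uniq.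
  - by [].
  - by move=> i _; rewrite mem_index_enum.
have : ((a ^+ 2 * omega)%:E <= (e ^+ 2 *+ V)%:E)%E.
  rewrite EFinM -vbox; apply: (@le_trans _ _ ((a ^+ 2)%:E * \sum_j vol b (psi @` A j))%E).
    by apply: lee_wpmul2l; [rewrite lee_fin sqr_ge0|exact: sub].
  rewrite ge0_sume_distrr; last by move=> j _; exact: measure_ge0.
  apply: (@le_trans _ _ (\sum_(j < V) (e ^+ 2)%:E)%E).
    by apply: lee_sum => j _; exact: volA.
  by rewrite sumEFin sumr_const card_ord.
rewrite lee_fin leNgt => /negP; case.
have e2 : e ^+ 2 = a ^+ 2 * omega / V.+1%:R ^+ 2.
  by rewrite /e expr_div_n exprMn sqr_sqrtr // ltW.
rewrite e2 -mulr_natr -mulrA gtr_pMr; last by rewrite mulr_gt0 // exprn_gt0.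
rewrite mulrC ltr_pdivrMr ?exprn_gt0 // mul1r -natrX ltr_nat.
by rewrite expnS expn1 mulSn ltn_addr.
Qed.

End Copy.
End FaceVolume.

Lemma normal_trace_eq {R : realType} {n : nat} (l : R) (f g : 'rV[R]_n.+1 -> R) y :
  (forall x, half_cube l x -> f x = g x) -> normal_trace l f y = normal_trace l g y.
Proof.
move=> fg; rewrite /normal_trace; congr (partial _ (xget _ _) y).
rewrite eqEsubset; split=> F [sF Ff]; split=> //; apply: filterS Ff => z H zD.
  by rewrite H // fg.
by rewrite H // fg.
Qed.

Section Forward.
Context {R : realType} {n C V : nat} {B M M' : ptopologicalType}.
Context {b : building_block R n B C}.
Variables (t : tiled_manifold b V M) (t' : tiled_manifold b V M').
Variables (bc bc' : 'I_C -> 'I_V -> bool) (T : 'M[R]_V).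
Local Notation E := 'rV[R]_n.+1.
Local Notation lst := (ord_max : 'I_n.+1).
Local Notation N := (n.+1%:R : R).

Lemma transplants_face c l psi phi phi' : face_chart b c l psi ->
  continuous phi -> continuous phi' -> transplants t t' T phi phi' ->
  forall i x, half_cube l x ->
  phi' (inc t' i (psi x)) = \sum_j T i j * phi (inc t j (psi x)).
Proof.
move=> fc cphi cphi' tr i x xD.
apply: (ae_eq_face_chart fc (f := fun y => phi' (inc t' i y))
  (g := fun y => \sum_j T i j * phi (inc t j y)) _ _ (tr i) xD).
  by move=> y; exact: (continuous_comp (@inc_continuous _ _ _ _ b V M' t' i y) (cphi' _)).
apply: continuous_finsum => j y; apply: cvgMr.
exact: (continuous_comp (@inc_continuous _ _ _ _ b V M t j y) (cphi _)).
Qed.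

(* On a face the transplanted function reflects both according to the adjacency
   matrix of M' and, as a combination of the phi_j, according to that of M; the
   difference has vanishing Cauchy data on the face, hence vanishes nearby. *)
Lemma converts_adjacency : converts t t' bc bc' T ->
  forall c, adjacency t' bc' c *m T = T *m adjacency t bc c.
Proof.
move=> conv c; set A' := adjacency t' bc' c; set A := adjacency t bc c.
have [x0 fx0] := face_nonempty b c.
have [l [psi [fc _]]] := ex_face_chart fx0.
have l0 := face_chart_gt0 fc.
have N1 : 1 <= N by rewrite ler1n.
(* The depth of the strip in [zero_cauchy_data]. The box z of half-width w / 2 centred at depth w /
   2 fits into it and is independent of the solution, as [no_linear_relation] requires. *)
pose w := l / (64 * N).
have w0 : 0 < w by rewrite divr_gt0 // mulr_gt0 // (lt_le_trans _ N1).
have wl : w < l / 4.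
  rewrite /w ltr_pdivrMr ?mulr_gt0 // ?(lt_le_trans _ N1) //; nra.
pose z : E := - (w / 2) *: delta_mx 0 lst.
have zw x : box z (w / 2) x -> (forall i, `|x 0 i| <= l / 4) /\ - w <= lastc x < 0.
  move=> xz; split.
    move=> i; have := xz i; rewrite !mxE eqxx /= => /andP[h1 h2].
    move: h1 h2; case: (i == lst); rewrite ?mulr1n ?mulr0n => h1 h2;
      by rewrite ler_norml; apply/andP; split; lra.
  have := xz lst; rewrite !mxE !eqxx /= mulr1n /lastc => /andP[h1 h2].
  by apply/andP; split; lra.
have zD x : box z (w / 2) x -> half_cube l x /\ lastc x < 0.
  move=> /zw[xl /andP[_ xlt0]]; split => //; split; last exact: ltW.
  move=> i; have := xl i; rewrite -ltr_norml => /le_lt_trans; apply; lra.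
pose S := A' *m T - T *m A.
suff S0 : S = 0 by apply/eqP; rewrite -subr_eq0 -/S S0.
apply/matrixP => i j; rewrite [RHS]mxE; move: j.
apply: (no_linear_relation fc (t := t) (bc := bc) (s := S i) (z := z) (r := w / 2)) => //.
  by rewrite divr_gt0.
move=> lam phi sol x xz.
have [phi' sol' tr] := conv lam phi sol.
have cphi : continuous phi by case: sol.
have cphi' : continuous phi' by case: sol'.
have trf := transplants_face fc cphi cphi' tr.
pose f k (x : E) := phi (inc t k (psi x)).
pose f' k (x : E) := phi' (inc t' k (psi x)).
have hf k : half_solution l lam (f k) by exact: flat_half_solution sol _ _ _ fc _.
have hf' k : half_solution l lam (f' k) by exact: flat_half_solution sol' _ _ _ fc _.
have rf : reflects l A f by exact: flat_reflects sol _ _ _ fc.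
have rf' : reflects l A' f' by exact: flat_reflects sol' _ _ _ fc.
(* Matrix identity S v = A' (T v) - T (A v), used once for the values and once for the normal traces
   on the face. *)
have SE (v v' : 'I_V -> R) : (forall k, v' k = \sum_j T k j * v j) ->
    \sum_j S i j * v j = \sum_k A' i k * v' k - \sum_k T i k * \sum_j A k j * v j.
  move=> vv; under eq_bigr do rewrite !mxE mulrBl !mulr_suml.
  rewrite sumrB; congr (_ - _); rewrite exchange_big /=; apply: eq_bigr => k _.
    by rewrite vv mulr_sumr; apply: eq_bigr => j _; rewrite mulrA.
  by rewrite mulr_sumr; apply: eq_bigr => j _; rewrite mulrA.
apply: (zero_cauchy_data l0 (half_solution_lin (S i) hf)); last 2 first.
- by case: (zw x xz).
- by have [_ /andP[h1 h2]] := zw x xz; rewrite h1 ltW.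
move=> y yD y0.
have tf k : f' k y = \sum_j T k j * f j y by exact: trf.
have ntf k : normal_trace l (f' k) y = \sum_j T k j * normal_trace l (f j) y.
  rewrite -(normal_trace_lin (T k) hf yD y0); apply: normal_trace_eq => u uD.
  exact: trf.
have fE k : f k y = \sum_j A k j * f j y by case: (rf y yD y0 k).
have nfE k : normal_trace l (f k) y = - \sum_j A k j * normal_trace l (f j) y.
  by case: (rf y yD y0 k).
have f'E : f' i y = \sum_j A' i j * f' j y by case: (rf' y yD y0 i).
have nf'E : normal_trace l (f' i) y = - \sum_j A' i j * normal_trace l (f' j) y.
  by case: (rf' y yD y0 i).
split.
  rewrite (SE _ _ tf) -f'E tf; apply/eqP; rewrite subr_eq0; apply/eqP.
  by apply: eq_bigr => k _; rewrite -fE.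
rewrite (normal_trace_lin (S i) hf yD y0) (SE _ _ ntf).
rewrite -[X in X - _]opprK -nf'E ntf -opprD; apply/eqP; rewrite oppr_eq0; apply/eqP.
rewrite -big_split big1 // => k _ /=.
by rewrite -mulrDr nfE addNr mulr0.
Qed.

End Forward.

(** * From adjacency matrices to intertwining matrices *)

Section Laplacian.
Context {R : realType} {n : nat}.
Local Notation E := 'rV[R]_n.+1.
Local Notation lst := (ord_max : 'I_n.+1).
Implicit Types (f F G : E -> R) (g : E -> 'M[R]_n.+1) (U : set E).

Lemma posdef_det_neq0 (A : 'M[R]_n.+1) :
  (forall v : E, v != 0 -> 0 < (v *m A *m v^T) 0 0) -> \det A != 0.
Proof.
move=> pA; apply/det0P => -[v v0 vA]; have := pA v v0.
by rewrite vA mul0mx mxE ltxx.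
Qed.

Lemma smooth_closure_det U m (g : E -> 'M[R]_m) :
  (forall i j, smooth_closure U (fun y => g y i j)) ->
  smooth_closure U (fun y => \det (g y)).
Proof.
move=> sg; rewrite /determinant; apply: smooth_closure_sum => s _.
apply: SmoothMul; first exact: smooth_closure_cst.
exact: smooth_closure_prod.
Qed.

Definition flux g f i (y : E) : R :=
  Num.sqrt (\det (g y)) * \sum_j invmx (g y) i j * partial j f y.

Lemma laplacianE g f x : laplacian g f x =
  - ((Num.sqrt (\det (g x)))^-1 * \sum_i partial i (flux g f i) x).
Proof. by []. Qed.

Section Metric.
Variables (U : set E) (g : E -> 'M[R]_n.+1).
Hypotheses (oU : open U) (sg : smooth_on U g).
Hypothesis det_neq0 : forall y, U y -> \det (g y) != 0.

Lemma smooth_closure_entry i j : smooth_closure U (fun y => g y i j).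
Proof. by apply: SmoothBase; exact: smooth_on_entry. Qed.

(** Cramer's rule, valid on U where the determinant does not vanish. *)
Lemma smooth_closure_invmx i j : smooth_closure U (fun y => invmx (g y) i j).
Proof.
have cof k m : smooth_closure U (fun y => cofactor (g y) k m).
  rewrite /cofactor; apply: SmoothMul; first exact: smooth_closure_cst.
  apply: smooth_closure_det => a a'.
  rewrite (_ : (fun _ => _) = (fun y => g y (lift k a) (lift m a'))).
    exact: smooth_closure_entry.
  by apply/funext => y; rewrite !mxE.
have s : smooth_closure U (fun y => (\det (g y))^-1 * cofactor (g y) j i).
  apply: SmoothMul => //; apply: SmoothInv => //.
  by apply: smooth_closure_det => a a'; exact: smooth_closure_entry.
apply: SmoothBase; apply: smooth_on_eq (smooth_closureP oU s) => // y Uy.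
by rewrite /invmx unitmxE unitfE det_neq0 // !mxE.
Qed.

Lemma smooth_closure_sqrt_det : smooth_closure U (fun y => Num.sqrt (\det (g y))).
Proof.
apply: SmoothSqrt => //.
by apply: smooth_closure_det => a a'; exact: smooth_closure_entry.
Qed.

(* Where the determinant is negative, the square root and its inverse are both
   locally zero. *)
Lemma smooth_on_inv_sqrt_det :
  smooth_on U (fun y => (Num.sqrt (\det (g y)))^-1).
Proof.
have sd : smooth_closure U (fun y => \det (g y)).
  by apply: smooth_closure_det => a a'; exact: smooth_closure_entry.
have s : smooth_closure U (fun y => Num.sqrt ((\det (g y))^-1)).
  apply: SmoothSqrt; first exact: SmoothInv.
  by move=> y Uy; rewrite invr_eq0 det_neq0.
apply: smooth_on_eq (smooth_closureP oU s) => // y Uy.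
have [d0|d0] := leP 0 (\det (g y)); first by rewrite sqrtrV.
by rewrite !ler0_sqrtr ?invr0 ?invr_le0 // ltW.
Qed.

Lemma smooth_on_flux f i : smooth_on U f -> smooth_on U (flux g f i).
Proof.
move=> sf; apply: smooth_closureP => //; apply: SmoothMul.
  exact: smooth_closure_sqrt_det.
apply: smooth_closure_sum => j _; apply: SmoothMul.
  exact: smooth_closure_invmx.
by apply: SmoothBase; exact: smooth_on_partial.
Qed.

Lemma smooth_on_laplacian f : smooth_on U f -> smooth_on U (laplacian g f).
Proof.
move=> sf; apply: smooth_closureP => //.
rewrite (_ : laplacian g f = (fun x => -1 * ((Num.sqrt (\det (g x)))^-1 *
   \sum_i partial i (flux g f i) x))); last first.
  by apply/funext => x; rewrite mulN1r.
apply: SmoothMul; first exact: smooth_closure_cst.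
apply: SmoothMul; first exact/SmoothBase/smooth_on_inv_sqrt_det.
apply: smooth_closure_sum => i _; apply: SmoothBase.
by apply: smooth_on_partial; exact: smooth_on_flux.
Qed.

Lemma laplacian_lin (I : finType) (a : I -> R) (f : I -> E -> R) x : U x ->
  (forall j, smooth_on U (f j)) ->
  laplacian g (fun y => \sum_j a j * f j y) x = \sum_j a j * laplacian g (f j) x.
Proof.
move=> Ux sf.
have e i : partial i (flux g (fun y => \sum_j a j * f j y) i) x =
    \sum_j a j * partial i (flux g (f j) i) x.
  have dflux j : differentiable (flux g (f j) i) x.
    exact: smooth_on_diff (smooth_on_flux i (sf j)) Ux.
  rewrite -(partial_lin a i dflux); apply: near_eq_partial.
  apply: near_open oU Ux _ => y Uy; rewrite /flux.
  transitivity (Num.sqrt (\det (g y)) *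
    \sum_k \sum_j a j * (invmx (g y) i k * partial k (f j) y)).
    congr (_ * _); apply: eq_bigr => k _.
    have df j : differentiable (f j) y by exact: smooth_on_diff (sf j) Uy.
    by rewrite (partial_lin a k df) mulr_sumr; apply: eq_bigr => j _; rewrite mulrCA.
  rewrite exchange_big mulr_sumr; apply: eq_bigr => j _ /=.
  by rewrite -mulr_sumr mulrCA.
rewrite laplacianE (eq_bigr _ (fun i _ => e i)) exchange_big /=.
rewrite mulr_sumr -sumrN; apply: eq_bigr => j _.
by rewrite laplacianE -mulr_sumr mulrCA mulrN.
Qed.

End Metric.

Lemma laplacian_near_eq g f F x : (\forall y \near x, f y = F y) ->
  laplacian g f x = laplacian g F x.
Proof.
move=> fF; rewrite (laplacianE g f x) (laplacianE g F x).
apply: (congr1 (fun s => - (_ * s))); apply: eq_bigr => i _.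
apply: near_eq_partial; have := near_join fF; apply: filterS => y fFy.
rewrite /flux; congr (_ * _); apply: eq_bigr => j _; congr (_ * _).
exact: near_eq_partial fFy.
Qed.

Lemma smooth_near_half_glue l lam u v y : half_solution l lam u ->
  half_solution l lam v ->
  (forall z, half_cube l z -> lastc z = 0 ->
     u z = v z /\ normal_trace l u z = - normal_trace l v z) ->
  half_cube l y -> lastc y = 0 ->
  smooth_near (half_glue u (v \o @reflect_last R n)) y.
Proof.
move=> hu hv uv yD y0.
have [U1 [F [eF U1y]]] := half_solution_extension hu yD y0.
have [U2 [G [eG U2y]]] := half_solution_extension hv yD y0.
(* [glue_reflect_smooth] needs a domain invariant under the reflection. *)
pose U3 := U1 `&` U2; pose U := U3 `&` (@reflect_last R n @^-1` U3).
have oU3 : open U3 by apply: openI; [exact: bext_open eF|exact: bext_open eG].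
have oU : open U.
  by apply: openI => //; apply: open_comp => // z _; exact: continuous_reflect_last.
have [|_ Uc sF Fu pF dF] := bext_sub (U' := U) oU _ eF; first by move=> z [[]].
have [|_ _ sG Gv pG dG] := bext_sub (U' := U) oU _ eG; first by move=> z [[]].
have Ur z : U z -> U (reflect_last z).
  by move=> [z3 rz3]; split => //; rewrite /preimage /= reflect_lastK.
have hD z : U z -> lastc z = 0 -> half_cube l z.
  by move=> Uz z0; split; [exact: Uc|rewrite /half_space /= z0].
have s : smooth_on U (half_glue F (G \o @reflect_last R n)).
  apply: (glue_reflect_smooth oU Ur sF sG pF pG) => z Uz z0.
    by rewrite Fu ?Gv ?z0 //; case: (uv z (hD z Uz z0) z0).
  by rewrite dF ?dG //; case: (uv z (hD z Uz z0) z0).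
have Uy : U y by split; rewrite /preimage /= ?reflect_last_id.
have e : \forall z \near y, half_glue F (G \o @reflect_last R n) z =
                            half_glue u (v \o @reflect_last R n) z.
  apply: near_open oU Uy _ => z Uz; rewrite /half_glue; case: ifPn => z0.
    exact: Fu.
  apply: Gv; first exact: Ur.
  by rewrite reflect_last_lastc oppr_le0 ltW // ltNge.
by apply: smooth_near_eq e _; apply/smooth_nearP; exists U.
Qed.

(** The intertwining relation turns T (A v) into A' (T v); this applies to the values and, with the
    sign of the normal direction, to the normal traces. *)
Lemma reflects_mul V l lam (A A' T : 'M[R]_V) (f : 'I_V -> E -> R) :
  (forall j, half_solution l lam (f j)) -> A' *m T = T *m A ->
  reflects l A f -> reflects l A' (fun i x => \sum_j T i j * f j x).
Proof.
move=> hf AT rf y yD y0 i.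
have key (v : 'I_V -> R) : \sum_j T i j * \sum_k A j k * v k =
    \sum_k A' i k * \sum_j T k j * v j.
  transitivity (\sum_k (T *m A) i k * v k).
    under [RHS]eq_bigr do rewrite mxE mulr_suml.
    rewrite exchange_big; apply: eq_bigr => j _ /=; rewrite mulr_sumr.
    by apply: eq_bigr => k _; rewrite mulrA.
  rewrite -AT; under eq_bigr do rewrite mxE mulr_suml.
  rewrite exchange_big; apply: eq_bigr => j _ /=; rewrite mulr_sumr.
  by apply: eq_bigr => k _; rewrite mulrA.
split.
  rewrite -key; apply: eq_bigr => j _; congr (_ * _).
  by case: (rf y yD y0 j).
rewrite (normal_trace_lin (T i) hf yD y0).
under [in RHS]eq_bigr do rewrite (normal_trace_lin _ hf yD y0).
rewrite -key -sumrN; apply: eq_bigr => j _.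
by have [_ ->] := rf y yD y0 j; rewrite mulrN.
Qed.

End Laplacian.

(** * Boundary behaviour under changes of charts *)

Section ChartChange.
Context {R : realType} {n : nat} {X : ptopologicalType}.
Variable g : riemannian R n X.
Local Notation E := 'rV[R]_n.+1.
Local Notation lst := (ord_max : 'I_n.+1).

Lemma smooth_at_change (f : X -> R) p q u v : atlas g p -> atlas g q ->
  cdom p u -> cdom q v -> cmap p u = cmap q v ->
  smooth_at (cdom q) (f \o cmap q) v -> smooth_at (cdom p) (f \o cmap p) u.
Proof.
move=> ap aq pu qv e [F [sF Ff]].
have [tau [st te tq tm]] := atlas_compat ap aq pu qv e.
exists (F \o tau); split; first by apply: smooth_near_comp; rewrite ?te.
have ct := smooth_near_continuous st.
have Ff' : \forall z \near u, cdom q (tau z) -> F (tau z) = (f \o cmap q) (tau z).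
  have Ff1 : nbhs (tau u) [set y | cdom q y -> F y = (f \o cmap q) y] by rewrite te.
  exact: (ct _ Ff1).
by apply: filterS2 tq Ff' => z H1 H2 pz; have [qz ez] := H1 pz; rewrite /= H2 //= ez.
Qed.

Lemma boundary_chart p u : atlas g p -> cdom p u -> ~ inter g (cmap p u) ->
  boundary_domain (inter g) p /\ lastc u = 0.
Proof.
move=> ap pu nI; have [[[_ pI]|bp] _ _ _ _] := atlas_chart ap.
  by case: nI; apply: pI; exists u.
split => //; have [[W _ pE] bI] := bp.
have ule : lastc u <= 0 by move: pu; rewrite pE => -[].
by apply/eqP; rewrite eq_le ule leNgt; apply/negP => /(bI u pu).
Qed.

Lemma extension_partial_chart (f : X -> R) p u F G i : atlas g p -> cdom p u ->
  ~ inter g (cmap p u) ->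
  smooth_extension (cdom p) (f \o cmap p) u F ->
  smooth_extension (cdom p) (f \o cmap p) u G -> partial i F u = partial i G u.
Proof.
move=> ap pu nI [sF Ff] [sG Gf]; have [[[W oW pE] bI] u0] := boundary_chart ap pu nI.
apply: partial_one_sided (smooth_near_diff sF) (smooth_near_diff sG) _ _.
  by rewrite u0.
have Wu : W u by move: pu; rewrite pE => -[].
apply: filterS2 (near_open_point oW Wu) (filterI Ff Gf) => z Wz [H1 H2] z0.
have pz : cdom p z by rewrite pE.
by rewrite H1 // H2.
Qed.

Lemma normal_derivative_eq0 (h : E -> 'M[R]_n.+1) F u :
  (invmx (h u) *m \col_j partial j F u) lst 0 = 0 -> normal_derivative h F u = 0.
Proof.
rewrite mxE => H; rewrite /normal_derivative.
have -> : \sum_j invmx (h u) lst j / Num.sqrt (invmx (h u) lst lst) * partial j F u =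
   (Num.sqrt (invmx (h u) lst lst))^-1 *
     \sum_j invmx (h u) lst j * (\col_k partial k F u) j 0.
  by rewrite mulr_sumr; apply: eq_bigr => j _; rewrite mxE mulrA [_^-1 * _]mulrC.
by rewrite H mulr0.
Qed.

(* A change of coordinates preserves the boundary, so the last column of its
   Jacobian vanishes off the diagonal. *)
Lemma normal_derivative_change (f : X -> R) p q u v F G : atlas g p -> atlas g q ->
  cdom p u -> cdom q v -> cmap p u = cmap q v -> ~ inter g (cmap p u) ->
  cmet q v = 1%:M ->
  smooth_extension (cdom p) (f \o cmap p) u F ->
  smooth_extension (cdom q) (f \o cmap q) v G -> partial lst G v = 0 ->
  normal_derivative (cmet p) F u = 0.
Proof.
move=> ap aq pu qv e nI mq eF eG G0.
have [tau [st te tq tm]] := atlas_compat ap aq pu qv e.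
have [[[W oW pE] bIp] u0] := boundary_chart ap pu nI.
have nIq : ~ inter g (cmap q v) by rewrite -e.
have [[[Wq oWq qE] bIq] v0] := boundary_chart aq qv nIq.
have dt := smooth_near_diff st.
have ct := smooth_near_continuous st.
set J := 'J tau u in tm.
have JE i j : J i j = partial i (fun z => tau z 0 j) u.
  have := congr1 (fun r : E => r 0 j) (row_jacobian i dt).
  rewrite mxE => ->; symmetry; exact: partial_entry.
clearbody J.
have eGt : smooth_extension (cdom p) (f \o cmap p) u (G \o tau).
  have [sG Gf] := eG; split; first by apply: smooth_near_comp; rewrite ?te.
  have Gf' : \forall z \near u, cdom q (tau z) -> G (tau z) = (f \o cmap q) (tau z).
    have Gf1 : nbhs (tau u) [set y | cdom q y -> G y = (f \o cmap q) y] by rewrite te.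
    exact: (ct _ Gf1).
  by apply: filterS2 tq Gf' => z H1 H2 pz; have [qz ez] := H1 pz; rewrite /= H2 //= ez.
have dG : differentiable G (tau u) by rewrite te; apply: smooth_near_diff; case: eG.
have dFE : \col_j partial j F u = J *m \col_j partial j G v.
  apply/colP => i; rewrite !mxE (extension_partial_chart i ap pu nI eF eGt).
  rewrite partial_comp //; apply: eq_bigr => j _.
  have -> : (\col_k partial k G v) j 0 = partial j G v by rewrite mxE.
  by rewrite te -JE mulrC.
have J0 k : k != lst -> J k lst = 0.
  move=> kl; rewrite JE; apply: partial_tangential => //.
    exact: differentiable_entry.
  have Wu : W u by move: pu; rewrite pE => -[].
  apply: filterS2 (near_open_point oW Wu) tq => z Wz H z0.
  have pz : cdom p z by rewrite pE; split => //; rewrite /half_space /= z0.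
  have [qz ez] := H pz.
  have nIz : ~ inter g (cmap q (tau z)).
    by rewrite ez => /(bIp z pz); rewrite z0 ltxx.
  by have [_] := boundary_chart aq qz nIz.
have [_ _ pos] : [/\ smooth_at (cdom p) (cmet p) u, (cmet p u)^T = cmet p u &
   forall w : E, w != 0 -> 0 < (w *m cmet p u *m w^T) 0 0].
  by have [_ _ _ _ mp] := atlas_chart ap; exact: mp.
have gu : cmet p u \in unitmx by rewrite unitmxE unitfE posdef_det_neq0.
rewrite mq mulmx1 in tm.
have Ju : J \in unitmx.
  by move: gu; rewrite tm !unitmxE det_mulmx unitrM => /andP[].
apply: normal_derivative_eq0; set y := invmx _ *m _.
(* Here y is the gradient in the coordinates of p. As g = J J^T and dF = J dG, its image J^T y is dG
   in the coordinates of q. The last row of J^T has only its diagonal entry, so that entry times the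
   last component of y is 0. *)
have Jy : J^T *m y = \col_j partial j G v.
  apply: (can_inj (mulKmx Ju)); rewrite mulmxA -tm -dFE /y mulmxA mulmxV //.
  by rewrite mul1mx.
have := congr1 (fun c : 'cV[R]_n.+1 => c lst 0) Jy.
rewrite [RHS]mxE G0 mxE (bigD1 lst) //= big1 ?addr0 => [|k kl]; last first.
  by rewrite mxE J0 // mul0r.
rewrite mxE => /eqP; rewrite mulf_eq0 => /orP[/eqP Jll|/eqP //].
(* If the diagonal entry vanished as well, J would have a zero column and could not be
   invertible. *)
have : col lst J = 0.
  apply/colP => k; rewrite !mxE; have [->|kl] := eqVneq k lst; first by [].
  exact: J0.
move=> Jc; have : J *m delta_mx lst 0 = 0 :> 'cV[R]_n.+1 by rewrite -colE.
move/(congr1 (mulmx (invmx J))); rewrite mulKmx // mulmx0.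
move/(congr1 (fun c : 'cV[R]_n.+1 => c lst 0)); rewrite !mxE !eqxx /=.
by move/eqP; rewrite oner_eq0.
Qed.

End ChartChange.

(** * The transplanted function solves the Zaremba problem *)

Section Backward.
Context {R : realType} {n C V : nat} {B M M' : ptopologicalType}.
Context {b : building_block R n B C}.
Variables (t : tiled_manifold b V M) (t' : tiled_manifold b V M').
Variables (bc bc' : 'I_C -> 'I_V -> bool) (T : 'M[R]_V).
Hypothesis AT : forall c, adjacency t' bc' c *m T = T *m adjacency t bc c.
Local Notation E := 'rV[R]_n.+1.
Local Notation lst := (ord_max : 'I_n.+1).
Variables (lam : R) (phi : M -> R).
Hypothesis sol : solution t bc lam phi.

Let block (i : 'I_V) (x : B) : R := \sum_j T i j * phi (inc t j x).

Let cphi : continuous phi. Proof. by case: sol. Qed.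

Lemma continuous_inc_comp j : continuous (fun x => phi (inc t j x)).
Proof.
move=> x; have h1 := @inc_continuous _ _ _ _ b V M t j x.
exact: (continuous_comp h1 (@cphi (inc t j x))).
Qed.

Lemma continuous_block i : continuous (block i).
Proof.
by apply: continuous_finsum => j y; apply: cvgMr; exact: continuous_inc_comp.
Qed.

(** Values, unlike derivatives, are controlled on the closure of a face: for inner faces by the
    identification, for Dirichlet faces by continuity, for Neumann faces trivially. Closures are
    needed because they are what the gluing identifies. *)
Lemma closure_face_adjacency c x j : closure (face b c) x ->
  phi (inc t j x) = \sum_k adjacency t bc c j k * phi (inc t k x).
Proof.
move=> cx; have [oj|[k g]] := outerP t c j; last first.
  rewrite (adjacency_glued _ _ g); congr phi; apply/inc_eq; split => //.
  by apply: connect1; apply/existsP; exists c; rewrite g /=; apply/asboolP.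
rewrite (adjacency_outer _ _ oj); case bcj: (bc c j) => //.
suff -> : phi (inc t j x) = 0 by rewrite oppr0.
apply/eqP; apply: contraT => nx.
have oW : open [set s : R | s != 0] by exact: open_neq.
have oW' : open ((fun y => phi (inc t j y)) @^-1` [set s : R | s != 0]).
  by apply: open_comp => // y _; exact: continuous_inc_comp.
have [y [fy /=]] := cx _ (near_open_point oW' nx).
case: sol => _ _ _ dir _; rewrite dir ?eqxx //; right; exists c, j; split => //.
Qed.

Lemma block_adjacency c x i : closure (face b c) x ->
  block i x = \sum_k adjacency t' bc' c i k * block k x.
Proof.
move=> cx; transitivity (\sum_k (T *m adjacency t bc c) i k * phi (inc t k x)).
  rewrite /block; under eq_bigr => j _ do rewrite (closure_face_adjacency j cx) mulr_sumr.
  under [RHS]eq_bigr do rewrite mxE mulr_suml.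
  rewrite exchange_big; apply: eq_bigr => j _ /=.
  by apply: eq_bigr => k _; rewrite mulrA.
rewrite -AT; under eq_bigr do rewrite mxE mulr_suml.
rewrite exchange_big; apply: eq_bigr => j _ /=; rewrite mulr_sumr.
by apply: eq_bigr => k _; rewrite mulrA.
Qed.

Lemma block_glued c x i k : closure (face b c) x -> glued t' c i k ->
  block i x = block k x.
Proof. by move=> cx g; rewrite (block_adjacency i cx) (adjacency_glued _ _ g). Qed.

Lemma block_eq i k x y : inc t' i x = inc t' k y -> block i x = block k y.
Proof.
move=> /inc_eq[<- /connectP[p pp ->]]; elim: p i pp => //= m p IH i /andP[+ pp].
move=> /existsP[c /andP[g /asboolP cx]].
by rewrite (block_glued cx g); exact: IH.
Qed.

Lemma ex_transplant : exists phi' : M' -> R, forall i x, phi' (inc t' i x) = block i x.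
Proof.
have /choice[s Hs] : forall m, exists ix : 'I_V * B, inc t' ix.1 ix.2 = m.
  by move=> m; have [i [x e]] := inc_surj t' m; exists (i, x).
exists (fun m => block (s m).1 (s m).2) => i x.
by apply: block_eq; rewrite Hs.
Qed.

Variable phi' : M' -> R.
Hypothesis phi'E : forall i x, phi' (inc t' i x) = block i x.

Lemma continuous_transplant : continuous phi'.
Proof.
apply/continuousP => W oW; apply: (inc_open t' _).2 => i.
rewrite (_ : _ @^-1` _ = block i @^-1` W).
  by apply: open_comp => // x _; exact: continuous_block.
by apply/funext => x; rewrite /preimage /= phi'E.
Qed.

Let regular (x : B) : Prop := inter b x \/ bdir b x \/ bneu b x.

Lemma regular_away x : regular x -> away_from_faces b x /\ covered b x.
Proof.
move=> [Ix|Dx].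
  by split; [exact: inter_away_from_faces|exact: (atlas_cover Ix)].
by split; [exact: bdir_bneu_away|case: (bdir_bneu_covered Dx)].
Qed.

Lemma regular_part j x : regular x ->
  (inter t `|` dirichlet_part t bc `|` neumann_part t bc) (inc t j x).
Proof.
move=> rx; have [ax _] := regular_away rx; case: rx => [Ix|[Dx|Nx]].
- by left; left; apply/inter_away.
- by left; right; left; exists j => //; exists x.
- by right; left; exists j => //; exists x.
Qed.

Lemma part_cases m :
  (inter t' `|` dirichlet_part t' bc' `|` neumann_part t' bc') m ->
  exists i x, m = inc t' i x /\ (regular x \/ exists c, face b c x).
Proof.
case=> [[Im|Dm]|Nm].
- move: Im; rewrite tiling_inter => -[[i _ [x Ix <-]]|[c [i [j [_ [x fx <-]]]]]].
    by exists i, x; split => //; left; left.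
  by exists i, x; split => //; right; exists c.
- case: Dm => [[i _ [x Dx <-]]|[c [i [_ _ [x fx <-]]]]].
    by exists i, x; split => //; left; right; left.
  by exists i, x; split => //; right; exists c.
- case: Nm => [[i _ [x Nx <-]]|[c [i [_ _ [x fx <-]]]]].
    by exists i, x; split => //; left; right; right.
  by exists i, x; split => //; right; exists c.
Qed.

(* Near a point away from the faces, a chart of M' induces charts of all copies
   in M with the same metric. *)
Lemma regular_pullback i x p u : atlas t' p -> cdom p u -> cmap p u = inc t' i x ->
  regular x ->
  exists p' : chart n B, [/\ cdom p' u, cmap p' u = x,
    exists2 W, open W & cdom p' = cdom p `&` W,
    forall j, atlas t (Chart (cdom p') (inc t j \o cmap p') (cmet p)) &
    forall z, cdom p' z ->
      phi' (cmap p z) = \sum_j T i j * phi (inc t j (cmap p' z))].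
Proof.
move=> ap pu e rx; have [ax cx] := regular_away rx.
have [p' [ap' p'u dW mE zE]] := atlas_pullback ap pu e ax cx.
exists p'; split => //.
- by have [_] := zE u p'u; rewrite e => /inc_same.
- move=> j; have H c k : glued t c j k -> cimage p' `&` closure (face b c) = set0.
    move=> _; rewrite -subset0 => y [[z pz <-] cy].
    by have [/(_ c)] := zE z pz.
  by rewrite -mE; exact: inc_isometry ap' H.
- by move=> z pz; have [_ <-] := zE z pz; rewrite phi'E.
Qed.

Lemma regular_extension i x p u : atlas t' p -> cdom p u -> cmap p u = inc t' i x ->
  regular x -> smooth_at (cdom p) (phi' \o cmap p) u.
Proof.
move=> ap pu e rx.
have [p' [p'u p'x [W oW dE] aj zE]] := regular_pullback ap pu e rx.
case: sol => _ sm _ _ _.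
have /choice[F HF] : forall j, exists F,
    smooth_extension (cdom p') (phi \o (inc t j \o cmap p')) u F.
  move=> j; apply: (sm _ u (aj j) p'u).
  by rewrite /= p'x; exact: regular_part.
have Wu : W u by move: p'u; rewrite dE => -[].
apply: (@smooth_at_sub _ _ _ (cdom p')).
  by apply: filterS (near_open_point oW Wu) => z Wz pz; rewrite dE.
exists (fun z => \sum_j T i j * F j z).
have [sF Ff] := extension_lin (T i) HF; split => //.
by apply: filterS Ff => z H pz; rewrite H //= zE.
Qed.

Section FaceChart.
Variables (c : 'I_C) (l : R) (psi : E -> B).
Hypothesis fc : face_chart b c l psi.

Lemma block_half_solution i : half_solution l lam (fun x => block i (psi x)).
Proof. by apply: half_solution_lin => j; exact: (flat_half_solution sol fc). Qed.

Lemma block_reflects :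
  reflects l (adjacency t' bc' c) (fun i x => block i (psi x)).
Proof.
apply: (reflects_mul _ (AT c) (flat_reflects sol fc)) => j.
exact: (flat_half_solution sol fc).
Qed.

Lemma half_cube0 : half_cube l (0 : E).
Proof.
split; first exact: cube0 (face_chart_gt0 fc).
by rewrite /half_space /= /lastc mxE.
Qed.

(** Smoothness is checked in one chart at the point and transferred to p: the half-cube chart if the
    face is outer, and the chart across it if it is inner, where phi' is the reflected gluing of two
    blocks. *)
Lemma face_smooth_at i p u : atlas t' p -> cdom p u ->
  cmap p u = inc t' i (psi 0) -> smooth_at (cdom p) (phi' \o cmap p) u.
Proof.
move=> ap pu e; have h0 := half_cube0.
have l0 : lastc (0 : E) = 0 by rewrite /lastc mxE.
have [oi|[k g]] := outerP t' c i.
  apply: (smooth_at_change ap (solution_outer fc oi) pu h0 e).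
  apply: smooth_at_eq ((block_half_solution i).2 _ h0 l0).
  by apply: filterE => z _; rewrite /= phi'E.
have aq := inner_face_isometry g (face_chart_gt0 fc) (face_chart_atlas fc)
  (face_chart_face fc).
have c0 : cube l (0 : E) by case: h0.
have eq0 : cmap p u = (if lastc (0 : E) <= 0 then inc t' i (psi 0)
   else inc t' k (psi (reflect_last 0))) by rewrite l0 lexx.
apply: (smooth_at_change ap aq pu c0 eq0).
apply: smooth_near_at.
rewrite (_ : _ \o _ = half_glue (fun x => block i (psi x))
   ((fun x => block k (psi x)) \o @reflect_last R n)).
  apply: (smooth_near_half_glue (block_half_solution i) (block_half_solution k)) => //.
  move=> y yD y0; have [e1 e2] := block_reflects yD y0 i.
  by move: e1 e2; rewrite !(adjacency_glued _ _ g).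
by apply/funext => x; rewrite /half_glue /=; case: ifP => _; rewrite phi'E.
Qed.

Lemma outer_face_trace i : outer t' c i -> ~~ bc' c i ->
  normal_trace l (fun x => block i (psi x)) 0 = 0.
Proof.
move=> oi ni; have l0 : lastc (0 : E) = 0 by rewrite /lastc mxE.
have [_] := block_reflects half_cube0 l0 i.
rewrite (adjacency_outer _ _ oi) (negbTE ni); set d := normal_trace _ _ _.
by move=> e; move: e; lra.
Qed.

End FaceChart.

Lemma transplant_smooth p u : atlas t' p -> cdom p u ->
  (inter t' `|` dirichlet_part t' bc' `|` neumann_part t' bc') (cmap p u) ->
  smooth_at (cdom p) (phi' \o cmap p) u.
Proof.
move=> ap pu /part_cases[i [x [e [rx|[c fx]]]]]; first exact: (regular_extension ap pu e rx).
have [l [psi [fc p0]]] := ex_face_chart fx.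
by apply: (face_smooth_at fc ap pu (i := i)); rewrite p0.
Qed.

Lemma smooth_metric (X : ptopologicalType) (g : riemannian R n X) p u :
  atlas g p -> cdom p u -> nbhs u (cdom p) ->
  exists U, [/\ open U, U u, U `<=` cdom p, smooth_on U (cmet p) &
    forall y, U y -> \det (cmet p y) != 0].
Proof.
move=> ap pu Nu; have [_ _ _ _ mp] := atlas_chart ap.
have [sm _ _] := mp u pu.
have [U [oU Uu sU]] := (smooth_nearP _ _).1 (smooth_at_interior Nu sm).
exists (U `&` interior (cdom p)); split.
- by apply: openI => //; exact: open_interior.
- by split.
- by move=> y [_ /interior_subset].
- by apply: smooth_on_sub sU => y [].
- move=> y [_ /interior_subset py]; apply: posdef_det_neq0.
  by have [_ _] := mp y py.
Qed.

(** In the pulled-back coordinates all restrictions of phi satisfy the equation for one and the same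
    metric, so linearity suffices. *)
Lemma transplant_pde_inter i x p u : atlas t' p -> cdom p u ->
  cmap p u = inc t' i x -> inter b x ->
  laplacian (cmet p) (phi' \o cmap p) u = lam * phi' (cmap p u).
Proof.
move=> ap pu e Ix; have rx : regular x by left.
have [p' [p'u p'x [W oW dE] aj zE]] := regular_pullback ap pu e rx.
have Iu : inter t' (cmap p u).
  by rewrite e; apply/inter_away => //; exact: inter_away_from_faces.
have Nu := open_interior_domain ap pu Iu.
have Wu : W u by move: p'u; rewrite dE => -[].
have N' : nbhs u (cdom p').
  by rewrite dE; apply: filterI => //; exact: near_open_point.
have [U [oU Uu Up sg dg]] := smooth_metric ap pu Nu.
case: sol => _ sm pde _ _.
have Ij j : inter t (inc t j x).
  by apply/inter_away => //; exact: inter_away_from_faces.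
have sf j : smooth_near (phi \o (inc t j \o cmap p')) u.
  apply: (smooth_at_interior N' (sm _ u (aj j) p'u _)).
  by rewrite /= p'x; exact: regular_part.
have /choice[Uj HUj] : forall j, exists U, [/\ open U, U u &
    smooth_on U (phi \o (inc t j \o cmap p'))].
  by move=> j; apply/smooth_nearP.
pose U1 := U `&` interior [set z | forall j, Uj j z].
have N1 : \forall z \near u, forall j, Uj j z.
  apply: (@filter_forall E 'I_V Uj (nbhs u) _) => j.
  by case: (HUj j) => o1 u1 _; exact: near_open_point.
have oU1 : open U1 by apply: openI => //; exact: open_interior.
have U1u : U1 u by split.
have e1 : \forall z \near u, (phi' \o cmap p) z =
    \sum_j T i j * (phi \o (inc t j \o cmap p')) z.
  by apply: filterS N' => z pz; rewrite /= zE.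
rewrite (laplacian_near_eq _ e1) (laplacian_lin (U := U1)) //.
- rewrite zE // mulr_sumr; apply: eq_bigr => j _.
  rewrite mulrCA; congr (_ * _).
  by apply: (pde _ u (aj j) p'u); rewrite /= p'x.
- by apply: smooth_on_sub sg => z [].
- by move=> y [Uy _]; exact: dg.
- move=> j; case: (HUj j) => _ _; apply: smooth_on_sub => z.
  by move=> [_ /interior_subset]; exact.
Qed.

(* The equation passes from the dense union of the block interiors to the inner
   faces by continuity. *)
Lemma transplant_pde p u : atlas t' p -> cdom p u -> inter t' (cmap p u) ->
  laplacian (cmet p) (phi' \o cmap p) u = lam * phi' (cmap p u).
Proof.
move=> ap pu Iu; have Nu := open_interior_domain ap pu Iu.
have [U [oU Uu Up sg dg]] := smooth_metric ap pu Nu.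
have sphi : smooth_near (phi' \o cmap p) u.
  apply: (smooth_at_interior Nu); apply: transplant_smooth => //.
  by left; left.
have [U2 [oU2 U2u s2]] := (smooth_nearP _ _).1 sphi.
pose U3 := U `&` U2.
have oU3 : open U3 by exact: openI.
have sL : smooth_on U3 (fun z => laplacian (cmet p) (phi' \o cmap p) z +
                                 - lam * (phi' \o cmap p) z).
  apply: smooth_onD => //; last by apply: smooth_on_sub s2 => z [].
  apply: smooth_on_laplacian => //.
  - by apply: smooth_on_sub sg => z [].
  - by move=> y [Uy _]; exact: dg.
  - by apply: smooth_on_sub s2 => z [].
set L := (fun z => _) in sL.
suff : L u = 0.
  by rewrite /L /= mulNr => /eqP; rewrite subr_eq0 => /eqP.
apply/eqP; apply: contraT => Lu.
have U3u : U3 u by split.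
have cL := smooth_on_continuous sL U3u.
have NL : \forall z \near u, L z != 0 /\ U3 z.
  have N1 : \forall z \near u, L z != 0 by exact: (cvgr_neq0 _ cL).
  have N2 : \forall z \near u, U3 z by exact: near_open_point.
  by apply: filterS2 N1 N2.
pose W := interior [set z | L z != 0 /\ U3 z].
have Wp : cdom p `&` W = W.
  rewrite eqEsubset; split=> [z []//|z Wz]; split => //.
  by have [_ [/Up]] := interior_subset Wz.
have [_ _ _ op _] := atlas_chart ap.
have oM : open (cmap p @` W) by rewrite -Wp; apply: op; exact: open_interior.
have [i [x ex]] := inc_surj t' (cmap p u).
have oB := (inc_open t' _).1 oM i.
have Bx : (inc t' i @^-1` (cmap p @` W)) x.
  by rewrite /preimage /= ex; exists u.
have : closure (inter b) x by rewrite inter_dense.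
move=> /(_ _ (near_open_point oB Bx))[y [Iy [z Wz ez]]].
have [Lz [Uz _]] := interior_subset Wz.
move: Lz; rewrite /L (transplant_pde_inter ap (Up _ Uz) ez Iy).
by rewrite /= mulNr subrr eqxx.
Qed.

Lemma transplant_dirichlet m : dirichlet_part t' bc' m -> phi' m = 0.
Proof.
case=> [[i _ [x Dx <-]]|[c [i [oi bi [x fx <-]]]]]; rewrite phi'E.
  rewrite /block big1 // => j _; case: sol => _ _ _ dir _.
  by rewrite dir ?mulr0 //; left; exists j => //; exists x.
have := block_adjacency i (face_closure_face fx).
by rewrite (adjacency_outer _ _ oi) bi; set v := block i x; lra.
Qed.

Lemma transplant_neumann p u F : atlas t' p -> cdom p u ->
  neumann_part t' bc' (cmap p u) ->
  smooth_extension (cdom p) (phi' \o cmap p) u F ->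
  normal_derivative (cmet p) F u = 0.
Proof.
move=> ap pu Nu eF; case: Nu => [[i _ [x Nx e]]|[c [i [oi ni [x fx e]]]]].
  have rx : regular x by right; right.
  have [p' [p'u p'x [W oW dE] aj zE]] := regular_pullback ap pu (esym e) rx.
  have nI : ~ inter t' (cmap p u).
    rewrite -e => /(inter_away t' i (regular_away rx).1).
    by case: (bdir_bneu_covered (or_intror Nx)).
  case: sol => _ sm _ _ neu.
  have /choice[G HG] : forall j, exists G,
      smooth_extension (cdom p') (phi \o (inc t j \o cmap p')) u G.
    move=> j; apply: (sm _ u (aj j) p'u).
    by rewrite /= p'x; exact: regular_part.
  have G0 j : normal_derivative (cmet p) (G j) u = 0.
    apply: (neu _ u (G j) (aj j) p'u _ (HG j)).
    by rewrite /= p'x; left; exists j => //; exists x.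
  have Wu : W u by move: p'u; rewrite dE => -[].
  have eG : smooth_extension (cdom p) (phi' \o cmap p) u (fun z => \sum_j T i j * G j z).
    have [sG Gf] := extension_lin (T i) HG; split => //.
    apply: filterS2 (near_open_point oW Wu) Gf => z Wz H pz.
    have p'z : cdom p' z by rewrite dE.
    by rewrite H //= zE.
  have dG j : differentiable (G j) u by apply: smooth_near_diff; case: (HG j).
  rewrite /normal_derivative.
  under eq_bigr => k _ do
    rewrite (extension_partial_chart k ap pu nI eF eG) (partial_lin _ k dG) mulr_sumr.
  rewrite exchange_big big1 // => j _ /=.
  transitivity (T i j * normal_derivative (cmet p) (G j) u); last by rewrite G0 mulr0.
  by rewrite /normal_derivative mulr_sumr; apply: eq_bigr => k _; rewrite mulrCA.
(* On an outer face the vanishing normal derivative is known in the flat chart only and has to be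
   carried over to p. *)
have [l [psi [fc p0]]] := ex_face_chart fx.
have h0 := half_cube0 fc.
have l0 : lastc (0 : E) = 0 by rewrite /lastc mxE.
have [G eG] := (block_half_solution fc i).2 _ h0 l0.
have tr := outer_face_trace fc oi ni.
rewrite (normal_traceE h0 eG) in tr.
have e0 : cmap p u = (inc t' i \o psi) 0 by rewrite /= p0 e.
have nI : ~ inter t' (cmap p u) by rewrite -e; exact: (outer_inter oi fx).
have eG' : smooth_extension (half_cube l) (phi' \o (inc t' i \o psi)) 0 G.
  by case: eG => sG Gf; split => //; apply: filterS Gf => z H zD; rewrite /= phi'E H.
exact: (normal_derivative_change ap (solution_outer fc oi) pu h0 e0 nI erefl eF eG' tr).
Qed.

Lemma transplant_solution : solution t' bc' lam phi'.
Proof.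
split.
- exact: continuous_transplant.
- exact: transplant_smooth.
- exact: transplant_pde.
- exact: transplant_dirichlet.
- exact: transplant_neumann.
Qed.

End Backward.

Lemma adjacency_converts {R : realType} {n C V : nat} {B M M' : ptopologicalType}
    {b : building_block R n B C} (t : tiled_manifold b V M)
    (t' : tiled_manifold b V M') (bc bc' : 'I_C -> 'I_V -> bool) (T : 'M[R]_V) :
  (forall c, adjacency t' bc' c *m T = T *m adjacency t bc c) ->
  converts t t' bc bc' T.
Proof.
move=> AT lam phi sol; have [phi' phi'E] := ex_transplant AT sol.
exists phi'; first exact: transplant_solution phi'E.
by move=> i; apply: aeW => x; exact: phi'E.
Qed.

Lemma intertwining_adjacency (R : realType) (n C V : nat)
    (B M M' : ptopologicalType) (b : building_block R n B C)
    (t : tiled_manifold b V M) (t' : tiled_manifold b V M')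
    (bc bc' : 'I_C -> 'I_V -> bool) (T : 'M[R]_V) : T \in unitmx ->
  intertwining t t' bc bc' T <->
  forall c, adjacency t' bc' c = T *m adjacency t bc c *m invmx T.
Proof.
move=> uT; split=> [[conv _] c|AT].
  by rewrite -(converts_adjacency conv c) mulmxK.
(* Conjugation is symmetric: the same lemma serves for the inverse of T with the two manifolds
   exchanged. *)
split; apply: adjacency_converts => c; rewrite AT.
  by rewrite mulmxKV.
by rewrite mulmxA mulKmx.
Qed.

Theorem mainTheorem1 (R : realType) (n C V : nat) (B M M' : ptopologicalType)
    (b : building_block R n B C)
    (t : tiled_manifold b V M) (t' : tiled_manifold b V M')
    (bc bc' : 'I_C -> 'I_V -> bool) :
  (forall T : 'M[R]_V, T \in unitmx ->
     (intertwining t t' bc bc' T <->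
      forall c, adjacency t' bc' c = T *m adjacency t bc c *m invmx T))
  /\
  (transplantable t t' bc bc' <->
   exists2 T : 'M[R]_V, T \in unitmx &
     forall c, adjacency t' bc' c = T *m adjacency t bc c *m invmx T).
Proof.
split=> [T uT|]; first exact: intertwining_adjacency.
by split=> -[T uT] H; exists T => //; apply/intertwining_adjacency.
Qed.
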